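(* Let $n\ge1$, $\delta>\frac{n-1}{2}$, $1<p<\infty$, $1\le q<\infty$ and $0\le\lambda\le n$. Then, for $r>0$, the Bochner--Riesz operator $B_r^\delta$ is bounded on the Lorentz--Morrey space $\mathcal{L}_{p,q;\lambda}(\mathbb{R}^n)$; that is, there is a constant $C>0$, independent of $f$, such that $$\|B_r^\delta f\|_{\mathcal{L}_{p,q;\lambda}(\mathbb{R}^n)}\le C\|f\|_{\mathcal{L}_{p,q;\lambda}(\mathbb{R}^n)}\quad\text{for all } f\in\mathcal{L}_{p,q;\lambda}(\mathbb{R}^n).$$
   Context: The Bochner--Riesz operator $B_r^\delta$ ($r>0$) is given by $\widehat{B_r^\delta(f)}(\xi)=(1-r^2|\xi|^2)_+^\delta\,\hat f(\xi)$; equivalently it is convolution with the kernel $B_r^\delta(x)=r^{-n}B^\delta(x/r)$, where $B^\delta$ is the function with Fourier transform $(1-|\xi|^2)_+^\delta$. $B(x,r)$ is the open ball in $\mathbb{R}^n$ with center $x$ and radius $r$. The non-increasing rearrangement of a measurable $f$ is $f^*(t)=\inf\{\mu>0:\ |\{x:|f(x)|>\mu\}|\le t\}$, $t>0$. For $0<p,q<\infty$, $\|f\|_{L_{p,q}(\mathbb{R}^n)}=\left(\int_0^\infty (t^{1/p}f^*(t))^q\frac{dt}{t}\right)^{1/q}$. For $1\le p<\infty$, $0<q<\infty$, $0\le\lambda\le n$, the Lorentz--Morrey space $\mathcal{L}_{p,q;\lambda}(\mathbb{R}^n)$ is the set of all measurable functions $f$ on $\mathbb{R}^n$ with $\|f\|_{\mathcal{L}_{p,q;\lambda}(\mathbb{R}^n)}:=\sup_{x\in\mathbb{R}^n,\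 r>0} r^{-\lambda/p}\|f\chi_{B(x,r)}\|_{L_{p,q}(\mathbb{R}^n)}<\infty$. *)

(* Defs.v *)
From HB Require Import structures.
From mathcomp Require Import all_boot all_order all_algebra.
From mathcomp Require Import complex.
From mathcomp Require Import all_classical all_reals all_analysis.
Set Implicit Arguments.
Unset Strict Implicit.
Unset Printing Implicit Defensive.
Import Order.TTheory GRing.Theory Num.Theory.
Import numFieldNormedType.Exports.
Local Open Scope classical_set_scope.
Local Open Scope ring_scope.

Section borel_lebesgue.
Context (R : realType).
Notation T := (measurableTypeR R).

Section step.
Context (n : nat) (m : {sigma_finite_measure set (n.-tuple T) -> \bar R}).

Definition tuple_cons (x : T * n.-tuple T) : n.+1.-tuple T :=
  [the n.+1.-tuple T of x.1 :: x.2].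

Definition tuple_uncons (x : n.+1.-tuple T) : T * n.-tuple T :=
  (thead x, [tuple of behead x]).

Lemma tuple_consK : cancel tuple_cons tuple_uncons.
Proof. by case=> a t; congr (_, _); exact/val_inj. Qed.

Lemma measurable_tuple_cons : measurable_fun [set: T * n.-tuple T] tuple_cons.
Proof. exact: measurable_cons. Qed.

Lemma measurable_tuple_uncons : measurable_fun [set: n.+1.-tuple T] tuple_uncons.
Proof.
apply: measurable_fun_pair; first exact: measurable_tnth.
exact: measurable_behead.
Qed.

Definition lebesgue_step : set (n.+1.-tuple T) -> \bar R :=
  pushforward (@lebesgue_measure R \x m)%E tuple_cons.

Let mpreimage (A : set (n.+1.-tuple T)) :
  measurable A -> measurable (tuple_cons @^-1` A).
Proof. by move=> mA; rewrite -[_ @^-1` _]setTI; exact: measurable_tuple_cons. Qed.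

Let lebesgue_step0 : lebesgue_step set0 = 0%E.
Proof. by rewrite /lebesgue_step /pushforward preimage_set0 measure0. Qed.

Let lebesgue_step_ge0 A : (0 <= lebesgue_step A)%E.
Proof. by rewrite /lebesgue_step /pushforward; exact: measure_ge0. Qed.

Let lebesgue_step_sigma_additive : semi_sigma_additive lebesgue_step.
Proof.
move=> F mF tF mUF; rewrite /lebesgue_step /pushforward preimage_bigcup.
apply: measure_semi_sigma_additive.
- by move=> i; exact: mpreimage.
- apply/trivIsetP => /= i j _ _ ij; rewrite -preimage_setI.
  by move/trivIsetP : tF => /(_ _ _ _ _ ij) ->//; rewrite preimage_set0.
- by rewrite -preimage_bigcup; exact: mpreimage.
Qed.

HB.instance Definition _ := isMeasure.Build _ _ _ lebesgue_step
  lebesgue_step0 lebesgue_step_ge0 lebesgue_step_sigma_additive.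

Let lebesgue_step_sigma_finite : sigma_finite [set: n.+1.-tuple T] lebesgue_step.
Proof.
have /sigma_finiteP[F [TF ndF Ffin]] := sigma_finiteT (@lebesgue_measure R).
have /sigma_finiteP[G [TG ndG Gfin]] := sigma_finiteT m.
exists (fun i => tuple_uncons @^-1` (F i `*` G i)).
  rewrite -preimage_bigcup (_ : \bigcup_i (F i `*` G i) = setT) ?preimage_setT//.
  rewrite -subTset => -[a t] _.
  have [i _ Fia] : (\bigcup_i F i) a by rewrite -TF.
  have [j _ Gjt] : (\bigcup_i G i) t by rewrite -TG.
  exists (maxn i j) => //; split => /=.
  - by move: Fia; exact/subsetPset/ndF/leq_maxl.
  - by move: Gjt; exact/subsetPset/ndG/leq_maxr.
move=> i; have [mF Foo] := Ffin i; have [mG Goo] := Gfin i.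
have mFG : measurable (F i `*` G i) by exact: measurableX.
split; first by rewrite -[_ @^-1` _]setTI; exact: measurable_tuple_uncons.
rewrite /lebesgue_step /pushforward -comp_preimage.
rewrite (_ : _ \o _ = id); last by apply/funext => x /=; exact: tuple_consK.
by rewrite preimage_id product_measure1E// lte_mul_pinfty// ge0_fin_numE.
Qed.

HB.instance Definition _ := Measure_isSigmaFinite.Build _ _ _ lebesgue_step
  lebesgue_step_sigma_finite.

End step.

(** n-fold product of the Lebesgue measure of the line, on the Borel sets. *)
Fixpoint borel_lebesgue (n : nat) :
    {sigma_finite_measure set (n.-tuple T) -> \bar R} :=
  if n is n'.+1 then lebesgue_step (borel_lebesgue n')
  else \d_([tuple] : 0.-tuple T).

End borel_lebesgue.

Section Rn.
Context (R : realType) (n : nat).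

(** R^n with the sigma-algebra of all Lebesgue measurable sets, i.e. the
    Caratheodory sets of the outer measure induced by [borel_lebesgue]. *)
Definition Rn : Type :=
  caratheodory_type (mu_ext (@borel_lebesgue R n)).
HB.instance Definition _ := Measurable.on Rn.

Definition lebesgue_Rn : set Rn -> \bar R :=
  @completed_measure_extension _ _ _ (@borel_lebesgue R n).
HB.instance Definition _ := Measure.on lebesgue_Rn.

(** Coordinates and the Euclidean norm are spelled out: the norm of the library
    on vectors is the sup norm. *)
Definition coord (x : Rn) (i : 'I_n) : R := tnth (x : n.-tuple R) i.
Definition mkRn (f : 'I_n -> R) : Rn := [tuple f i | i < n].
Definition subRn (x y : Rn) : Rn := mkRn (fun i => coord x i - coord y i).
Definition scaleRn (a : R) (x : Rn) : Rn := mkRn (fun i => a * coord x i).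
Definition dotRn (x y : Rn) : R := \sum_(i < n) coord x i * coord y i.
Definition normRn (x : Rn) : R := Num.sqrt (dotRn x x).

Definition ballRn (x : Rn) (r : R) : set Rn := [set y | normRn (subRn y x) < r].

Definition cmeasurable (f : Rn -> R[i]) : Prop :=
  measurable_fun setT (fun x => complex.Re (f x)) /\
  measurable_fun setT (fun x => complex.Im (f x)).

Definition cintegrable (f : Rn -> R[i]) : Prop :=
  lebesgue_Rn.-integrable setT (fun x => (complex.Re (f x))%:E) /\
  lebesgue_Rn.-integrable setT (fun x => (complex.Im (f x))%:E).

Definition cintegral (f : Rn -> R[i]) : R[i] :=
  Complex (\int[lebesgue_Rn]_x complex.Re (f x))
          (\int[lebesgue_Rn]_x complex.Im (f x)).

Definition cutoff (f : Rn -> R[i]) (A : set Rn) : Rn -> R[i] :=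
  fun x => if x \in A then f x else 0.

Definition cis (t : R) : R[i] := Complex (cos t) (sin t).

(** Inverse of the Fourier transform normalized with exp(-2 i pi x.xi). With
    exp(-i x.xi) instead, the operators below would be the same family up to
    rescaling r by 2 pi. *)
Definition inverse_fourier (m : Rn -> R) (x : Rn) : R[i] :=
  cintegral (fun xi => (m xi)%:C%C * cis (2 * pi * dotRn x xi)).

Definition BR_symbol (delta : R) (xi : Rn) : R :=
  Num.max 0 (1 - normRn xi ^+ 2) `^ delta.

(** The kernel B^delta; its symbol is bounded with compact support, so the
    inversion integral converges absolutely. *)
Definition BR_kernel (delta : R) : Rn -> R[i] :=
  inverse_fourier (BR_symbol delta).

Definition BR_kernel_dilated (delta r : R) (x : Rn) : R[i] :=
  (r ^- n)%:C%C * BR_kernel delta (scaleRn r^-1 x).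

Definition BR_integrand (delta r : R) (f : Rn -> R[i]) (x y : Rn) : R[i] :=
  BR_kernel_dilated delta r (subRn x y) * f y.

Definition Bochner_Riesz (delta r : R) (f : Rn -> R[i]) (x : Rn) : R[i] :=
  cintegral (BR_integrand delta r f x).

Local Open Scope ereal_scope.

Definition rearrangement (f : Rn -> R[i]) (t : R) : \bar R :=
  ereal_inf [set m%:E | m in [set m : R |
    (0 < m)%R /\ lebesgue_Rn [set x | (m < Normc.normc (f x))%R] <= t%:E]].

Definition lorentz_norm (p q : R) (f : Rn -> R[i]) : \bar R :=
  (\int[@lebesgue_measure R]_(t in `]0%R, +oo[)
     (((t `^ p^-1)%:E * rearrangement f t) `^ q * (t^-1)%:E)) `^ q^-1.

Definition lorentz_morrey_norm (p q lambda : R) (f : Rn -> R[i]) : \bar R :=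
  ereal_sup [set (z.2 `^ (- (lambda / p)))%:E *
                 lorentz_norm p q (cutoff f (ballRn z.1 z.2))
            | z in [set z : Rn * R | (0 < z.2)%R]].

Definition lorentz_morrey (p q lambda : R) : set (Rn -> R[i]) :=
  [set f | cmeasurable f /\ lorentz_morrey_norm p q lambda f < +oo].

End Rn.

(* Main.v *)
(** Rotating the frequency variable reduces the kernel of [Bochner_Riesz] to the
    cosine transform of [(1 - t ^ 2) ^ a] on [0, 1] with [a = delta + (n - 1) / 2],
    which is [O(|x| ^ (- a - 1))]. Since [a + 1 > n], the kernel is dominated by an
    integrable product [k] of functions of one coordinate.

    Let [h = |f|]. The rearrangement on a ball [B] of [x |-> \int k(y) h(x - y) dy]
    is bounded at [t] by [t^-1 \int k(y) W(y, t) dy], where [W(y, t)] is the integral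
    over [0, t] of the rearrangement of [h(. - y)] on [B]: this is a weak-type
    estimate for the layer cake representation of [h]. Jensen's inequality in [y] and
    Hardy's inequality in [t] (here [p > 1]) bound the Lorentz norm on [B] by the
    supremum over [y] of the Lorentz norms of [h(. - y)] on [B], that is, of [h] on
    the translated balls, which have the same radius. *)
Require Import Defs.
From HB Require Import structures.
From mathcomp Require Import all_boot all_order all_algebra.
From mathcomp Require Import ring lra complex.
From mathcomp Require Import all_classical all_reals all_analysis.
From mathcomp Require Import measurable_realfun.
Set Implicit Arguments.
Unset Strict Implicit.
Unset Printing Implicit Defensive.
Import Order.TTheory GRing.Theory Num.Theory.
Import numFieldNormedType.Exports.
Local Open Scope classical_set_scope.
Local Open Scope ring_scope.

(** * Integral inequalities *)

(** Averaging the rearrangement over [0, t] restores enough convexity, at the price of Hardy's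
    factor [(1 - p^-1)^-1]. The final constant is this factor times [2 * kappa]: [kappa] bounds the
    integral of the kernel majorant, and 2 pays for estimating real and imaginary parts separately.
    The second obstacle is measurability. The function f is measurable for the completed
    sigma-algebra only, whereas Tonelli's theorem in (x, y) asks that h(x - y) be measurable for a
    product sigma-algebra. Hence f is replaced, off a null set, by Borel functions; all estimates
    are done with the Borel measure and carried back through the measures of level sets. The same
    bound shows that the convolution integral converges almost everywhere: divergence on a set of
    positive measure would make the bound infinite on a whole interval of values of t. *)

Section nonneg_integrals.
Local Open Scope ereal_scope.
Context (R : realType).

(** The integral of a nonnegative function is a supremum over the simple functions below it, and
    this family grows with the function. It allows comparing integrands in [t] built from
    rearrangements without proving them measurable. *)
Lemma le_integral_nonmeasurable d (T : measurableType d)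
    (mu : {measure set T -> \bar R}) (D : set T) (f g : T -> \bar R) :
  (forall x, D x -> 0 <= f x) -> (forall x, D x -> f x <= g x) ->
  \int[mu]_(x in D) f x <= \int[mu]_(x in D) g x.
Proof.
move=> f0 fg; have g0 x : D x -> 0 <= g x.
  by move=> Dx; exact: le_trans (f0 _ Dx) (fg _ Dx).
rewrite !ge0_integralE//; apply: le_ereal_sup => _ [h hf <-]; exists h => //.
move=> x; apply: (le_trans (hf x)); rewrite /patch.
by case: ifPn => // /set_mem; exact: fg.
Qed.

Lemma jensen_poweR d (T : measurableType d) (mu : {measure set T -> \bar R})
    (D : set T) (k g : T -> \bar R) (M q : R) :
  measurable D -> (0 < M)%R -> (1 <= q)%R ->
  measurable_fun D k -> measurable_fun D g ->
  (forall x, D x -> 0 <= k x) -> (forall x, D x -> 0 <= g x) ->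
  \int[mu]_(x in D) k x <= M%:E ->
  (\int[mu]_(x in D) (k x * g x)) `^ q <=
    (M `^ (q - 1))%:E * \int[mu]_(x in D) (k x * g x `^ q).
Proof.
move=> mD M0 q1 mk mg k0 g0 kM.
have q0 : (0 < q)%R by exact: lt_le_trans q1.
have mgq : measurable_fun D (fun x => g x `^ q).
  exact: (measurableT_comp (measurable_poweR q) mg).
set I := \int[mu]_(x in D) (k x * g x).
set J := \int[mu]_(x in D) (k x * g x `^ q).
have I0 : 0 <= I by apply: integral_ge0 => x Dx; rewrite mule_ge0 ?k0 ?g0.
have J0 : 0 <= J by apply: integral_ge0 => x Dx; rewrite mule_ge0 ?poweR_ge0 ?k0.
have [qe|qn1] := eqVneq q 1%R.
  rewrite qe subrr powRr0 mul1e poweRe1// /J qe.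
  by rewrite le_eqVlt; apply/orP; left; apply/eqP/eq_integral => x /set_mem Dx;
    rewrite poweRe1 ?g0.
have qgt1 : (1 < q)%R by rewrite lt_neqAle eq_sym qn1.
have qm0 : (0 < q - 1)%R by rewrite subr_gt0.
have [Joo|Jnoo] := eqVneq J +oo.
  by rewrite Joo gt0_muley ?leey// lte_fin powR_gt0.
have Jfin : J \is a fin_num by rewrite ge0_fin_numE// lt_neqAle Jnoo leey.
(* Young's inequality with a free scale [a], to be optimized afterwards. *)
have young (a : R) : (0 < a)%R ->
    (a `^ (q - 1))%:E * I <= (q^-1)%:E * J + ((1 - q^-1) * a `^ q * M)%:E.
  move=> a0; have c0 : (0 <= (1 - q^-1) * a `^ q)%R.
    by rewrite mulr_ge0 ?powR_ge0// subr_ge0 invf_le1.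
  rewrite /I -ge0_integralZl//; last 3 first.
  - exact: emeasurable_funM.
  - by move=> x Dx; rewrite mule_ge0 ?k0 ?g0.
  - by rewrite lee_fin powR_ge0.
  apply: (@le_trans _ _ (\int[mu]_(x in D) ((q^-1)%:E * (k x * g x `^ q) +
      ((1 - q^-1) * a `^ q)%:E * k x))); last first.
    rewrite ge0_integralD//; last 4 first.
    - by move=> x Dx; rewrite !mule_ge0 ?k0 ?poweR_ge0 ?lee_fin ?invr_ge0 ?ltW.
    - by apply: measurable_funeM; exact: emeasurable_funM.
    - by move=> x Dx; rewrite mule_ge0 ?k0// lee_fin.
    - exact: measurable_funeM.
    rewrite !ge0_integralZl//; last 3 first.
    - exact: emeasurable_funM.
    - by move=> x Dx; rewrite mule_ge0 ?k0 ?poweR_ge0.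
    - by rewrite lee_fin invr_ge0 ltW.
    by apply: leeD => //; rewrite [leRHS]EFinM; apply: lee_wpmul2l; rewrite ?lee_fin.
  apply: ge0_le_integral => //.
  - by move=> x Dx; rewrite !mule_ge0 ?k0 ?g0// lee_fin powR_ge0.
  - by apply: measurable_funeM; exact: emeasurable_funM.
  - apply: emeasurable_funD; apply: measurable_funeM => //.
    exact: emeasurable_funM.
  move=> x Dx.
  rewrite (muleC (k x) (g x)) muleA (muleC (k x)) [X in _ <= X + _]muleA.
  rewrite -ge0_muleDl ?k0//; last first.
    by rewrite mule_ge0 ?poweR_ge0// lee_fin invr_ge0 ltW.
  apply: lee_wpmul2r; first exact: k0.
  have := g0 _ Dx; case: (g x) => [u| |]//; last first.
    move=> _; rewrite poweRyr ?gt_eqF// gt0_muley ?lte_fin ?powR_gt0//.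
    by rewrite gt0_muley ?lte_fin ?invr_gt0.
  rewrite lee_fin => u0; rewrite poweR_EFin -!EFinM -EFinD lee_fin mulrC.
  have q'0 : (0 < q / (q - 1))%R by rewrite divr_gt0.
  have := @conjugate_powR _ u (a `^ (q - 1))%R q (q / (q - 1))%R u0 (powR_ge0 _ _) q0 q'0.
  have -> : ((a `^ (q - 1)) `^ (q / (q - 1)) = a `^ q)%R.
    by rewrite -powRrM; congr (_ `^ _)%R; field; rewrite gt_eqF.
  move=> /(_ _)/le_trans; apply; first by field; rewrite !gt_eqF.
  by rewrite le_eqVlt; apply/orP; left; apply/eqP; field; rewrite !gt_eqF.
(* The scale 1 in Young's inequality already shows that [I] is finite once [J] is, so the rest is
   real arithmetic. *)
have Ifin : I \is a fin_num.
  rewrite ge0_fin_numE//; have := young 1%R ltr01.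
  rewrite powR1 mul1e mulr1 => /le_lt_trans; apply.
  by rewrite -(fineK Jfin) -EFinM -EFinD ltry.
move: young; rewrite -(fineK Ifin) -(fineK Jfin).
have {}I0 : (0 <= fine I)%R by exact: fine_ge0.
have {}J0 : (0 <= fine J)%R by exact: fine_ge0.
move: (fine I) (fine J) I0 J0 => u v u0 v0.
rewrite poweR_EFin -EFinM lee_fin.
move: u0; rewrite le_eqVlt => /predU1P[<- _|u0 yg].
  by rewrite powR0 ?gt_eqF// mulr_ge0// powR_ge0.
(* The optimal scale is the mean [u / M]: then the last term of Young's inequality is [1 - q^-1]
   times the left-hand side [X] and can be absorbed. *)
have := yg (u / M)%R (divr_gt0 u0 M0).
rewrite -!EFinM -EFinD lee_fin.
set X := ((u / M) `^ (q - 1) * u)%R.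
have uM : (0 <= u / M)%R by rewrite divr_ge0 ?ltW.
have -> : ((1 - q^-1) * (u / M) `^ q * M = (1 - q^-1) * X)%R.
  rewrite /X -(mulr_powRB1 uM q0); field.
  by rewrite !gt_eqF.
move=> Xv; have {}Xv : (X <= v)%R.
  have : (q^-1 * X <= q^-1 * v)%R by rewrite mulrBl mul1r in Xv; lra.
  by rewrite ler_pM2l// invr_gt0.
rewrite (_ : (u `^ q = M `^ (q - 1) * X)%R) ?ler_wpM2l ?powR_ge0//.
rewrite /X mulrA -powRM ?(ltW M0)// mulrCA divff ?gt_eqF// mulr1.
by rewrite mulrC mulr_powRB1 ?ltW.
Qed.

End nonneg_integrals.

(** * Rearrangements and a weak-type estimate for superpositions of sets *)

Section weak_type.
Local Open Scope ereal_scope.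
Context (R : realType).

Lemma measurable_ltr_set d (T : measurableType d) (f g : T -> R) :
  measurable_fun setT f -> measurable_fun setT g ->
  measurable [set x | (f x < g x)%R].
Proof.
move=> mf mg; rewrite (_ : [set x | _] = setT `&` [set x | (f x)%:E < (g x)%:E]).
  by apply: measurable_lte => //; exact/measurable_EFinP.
by apply/seteqP; split => x /=; rewrite lte_fin// => -[].
Qed.

(** The argument is a distribution function rather than a function, so passing from the completed to
    the Borel measure, or to a translate, only requires equal measures of level sets. *)
Definition rearr (d : R -> \bar R) (t : R) : \bar R :=
  ereal_inf [set m%:E | m in [set m : R | (0 < m)%R /\ d m <= t%:E]].

Lemma rearr_ge0 (d : R -> \bar R) (t : R) : 0 <= rearr d t.
Proof. by apply: le_ereal_inf_tmp => _ [m [m0 _] <-]; rewrite lee_fin ltW. Qed.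

(** By monotonicity no level beyond an admissible [m] belongs to the set, which thus lies in []0,
    m]]. Hardy's inequality is applied to the left-hand side, whose measurability in [t] comes from
    Tonelli's theorem; this inequality returns to the rearrangement. *)
Lemma lebesgue_superlevel_le_rearr (d : R -> \bar R) (t : R) :
  (forall a b, (0 < a)%R -> (a <= b)%R -> d b <= d a) ->
  measurable [set m : R | (0 < m)%R /\ t%:E < d m] ->
  lebesgue_measure [set m : R | (0 < m)%R /\ t%:E < d m] <= rearr d t.
Proof.
move=> nid ms; apply: le_ereal_inf_tmp => _ [m [m0 dm] <-].
apply: (@le_trans _ _ (lebesgue_measure (`]0%R, m] : set R))).
  apply: le_measure; rewrite ?inE//= => x [x0 tx].
  rewrite /= in_itv/= x0 leNgt; apply/negP => mx.
  by have := lt_le_trans tx (le_trans (nid _ _ m0 (ltW mx)) dm); rewrite ltxx.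
by rewrite lebesgue_measure_itv/= lte_fin m0 -EFinB subr0.
Qed.

(* Split the integral over [y] according to whether the section of [S] at [y]
   has measure above or below [t]: the first part is bounded by a constant, the
   second one has a small integral, and Chebyshev's inequality applies. *)
Lemma weak_type_section dX dY (X : measurableType dX) (Y : measurableType dY)
    (mu : {sigma_finite_measure set X -> \bar R})
    (nu : {sigma_finite_measure set Y -> \bar R})
    (k : Y -> \bar R) (S : set (X * Y)) (t m : R) :
  measurable_fun setT k -> (forall y, 0 <= k y) -> measurable S -> (0 < t)%R ->
  \int[nu]_y (k y * mine t%:E (mu (ysection S y))) < (t * m)%:E ->
  mu [set x | m%:E < \int[nu]_y (k y * (\1_S (x, y))%:E)] <= t%:E.
Proof.
move=> mk k0 mS t0 hm.
pose d y := mu (ysection S y).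
have md : measurable_fun setT d by exact: measurable_fun_ysection.
pose A := [set y | t%:E < d y].
have mA : measurable A.
  by rewrite -[A]setTI; apply: emeasurable_fun_o_infty.
have mCA : measurable (~` A) by exact: measurableC.
have mkS : measurable_fun setT (fun z : X * Y => k z.2 * (\1_S z)%:E).
  apply: emeasurable_funM; first exact: measurableT_comp.
  by apply/measurable_EFinP; exact: measurable_indic.
pose kS := (fun z : X * Y => k z.2 * (\1_S z)%:E * (\1_(~` A) z.2)%:E).
have mkSA : measurable_fun setT kS.
  apply: emeasurable_funM => //; apply/measurable_EFinP.
  by apply: measurableT_comp => //; exact: measurable_indic.
have kS0 z : 0 <= kS z by rewrite !mule_ge0 ?lee_fin.
have mkA : measurable_fun setT (fun y => k y * (\1_A y)%:E).
  by apply: emeasurable_funM => //; apply/measurable_EFinP; exact: measurable_indic.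
pose C := \int[nu]_y (k y * (\1_A y)%:E).
pose G x := \int[nu]_y kS (x, y).
have mG : measurable_fun setT G by exact: measurable_fun_fubini_tonelli_F.
have C0 : 0 <= C by apply: integral_ge0 => y _; rewrite mule_ge0 ?lee_fin.
have G0 x : 0 <= G x by exact: integral_ge0.
have PhiCG x : \int[nu]_y (k y * (\1_S (x, y))%:E) <= C + G x.
  rewrite -ge0_integralD//; last 2 first.
  - by move=> y _; rewrite mule_ge0 ?lee_fin.
  - exact: measurableT_comp mkSA (pair1_measurable x).
  apply: le_integral_nonmeasurable => y _.
    by rewrite mule_ge0 ?lee_fin.
  rewrite /kS/= indicC/=; case: (boolP (y \in A)) => yA.
    rewrite (indicE _ A) yA/= mule1 mule0 adde0.
    by rewrite indicE; case: (_ \in _); rewrite ?mule1 ?mule0.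
  by rewrite (indicE _ A) (negbTE yA)/= mule0 add0e mule1.
(* The minimum equals [t] on [A] and the measure of the section off [A], so the hypothesis controls
   exactly the two parts of the splitting. *)
have intG : t%:E * C + \int[mu]_x G x =
    \int[nu]_y (k y * mine t%:E (mu (ysection S y))).
  rewrite (fubini_tonelli kS)// -ge0_integralZl//; last 2 first.
  - by move=> y _; rewrite mule_ge0 ?lee_fin.
  - by rewrite lee_fin ltW.
  rewrite -ge0_integralD//; last 4 first.
  - by move=> y _; rewrite !mule_ge0 ?lee_fin// ltW.
  - exact: measurable_funeM.
  - by move=> y _; exact: integral_ge0.
  - exact: measurable_fun_fubini_tonelli_G.
  apply: eq_integral => y _.
  have -> : \int[mu]_x kS (x, y) = k y * (\1_(~` A) y)%:E * d y.
    rewrite /kS/=; under eq_integral do rewrite muleAC.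
    rewrite ge0_integralZl//; last 2 first.
    - by apply/measurable_EFinP; apply: measurableT_comp (pair2_measurable y);
        exact: measurable_indic.
    - by rewrite mule_ge0 ?lee_fin.
    congr (_ * _); rewrite /d -[X in mu X]setIT -integral_indic//; last first.
      exact: measurable_ysection.
    by apply: eq_integral => x _; rewrite !indicE mem_ysection.
  rewrite indicC/=; case: (boolP (y \in A)) => yA.
    rewrite (indicE _ A) yA/= mule1 mule0 mul0e adde0 muleC; congr (_ * _).
    by apply/esym/min_idPl/ltW; move: yA; rewrite inE.
  rewrite (indicE _ A) (negbTE yA)/= !mule0 add0e mule1; congr (_ * _).
  by apply/esym/min_idPr; move: yA; rewrite notin_setE /A/= => /negP; rewrite -leNgt.
have Cfin : C \is a fin_num.
  rewrite ge0_fin_numE// ltey; apply/eqP => Coo; move: hm.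
  rewrite -intG Coo gt0_muley ?lte_fin// addye// gt_eqF//.
  by rewrite (lt_le_trans _ (integral_ge0 _ _)) ?ltNyr.
have Gfin : \int[mu]_x G x \is a fin_num.
  rewrite ge0_fin_numE ?integral_ge0// ltey; apply/eqP => Goo; move: hm.
  by rewrite -intG Goo addey// -(fineK Cfin) -EFinM.
set c := fine C; have c0 : (0 <= c)%R by exact: fine_ge0.
set V := fine (\int[mu]_x G x).
have V0 : (0 <= V)%R by rewrite fine_ge0// integral_ge0.
have tcV : (t * c + V < t * m)%R.
  by rewrite -lte_fin EFinD EFinM /c /V !fineK// intG.
(* Where the full integral exceeds [m], the part [G] is at least [m - c]; Chebyshev's inequality is
   used at that level, and [t * c + V < t * m] is what makes the outcome at most [t]. *)
have cm : (0 < m - c)%R.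
  by rewrite subr_gt0 -(ltr_pM2l t0); apply: le_lt_trans tcV; rewrite lerDl.
have := @le_integral_abse _ _ _ mu setT measurableT G (m - c)%R mG cm.
rewrite setTI; under [X in _ <= X]eq_integral do rewrite gee0_abs//.
move=> GV; apply: (@le_trans _ _ (mu [set x | (m - c)%:E <= `|G x|])).
  apply: le_measure; rewrite ?inE/=.
  - rewrite -[X in measurable X]setTI; apply: emeasurable_fun_o_infty => //.
    apply: (measurable_fun_fubini_tonelli_F
      (fun z : X * Y => k z.2 * (\1_S z)%:E)).
    + by [].
    + by move=> z; rewrite mule_ge0 ?lee_fin.
  - rewrite -[X in measurable X]setTI; apply: emeasurable_fun_c_infty => //.
    exact: measurableT_comp.
  move=> x /= mx; rewrite gee0_abs//.
  have := le_trans (ltW mx) (PhiCG x).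
  by rewrite -(fineK Cfin) -/c EFinB leeBlDl.
rewrite -(@lee_pmul2l _ (m - c)%:E)//.
apply: (le_trans GV); rewrite -(fineK Gfin) -EFinM lee_fin -/V; lra.
Qed.

End weak_type.

(** * Power weights and Hardy's inequality *)

Section power_integrals.
Local Open Scope ereal_scope.
Context (R : realType).
Notation mu := (@lebesgue_measure R).

Lemma ge0_integral_bigcup_le d (T : measurableType d)
    (m : {measure set T -> \bar R}) (F : (set T)^nat) (f : T -> \bar R) B :
  {homo F : i j / (i <= j)%N >-> (i <= j)%O} ->
  (forall i, measurable (F i)) -> (forall i, measurable_fun (F i) f) ->
  (forall i x, F i x -> 0 <= f x) -> (forall i, \int[m]_(x in F i) f x <= B) ->
  \int[m]_(x in \bigcup_i F i) f x <= B.
Proof.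
move=> ndF mF mf f0 fB.
apply: (cvge_le _ (ge0_nondecreasing_set_cvg_integral ndF mF mf f0)).
exact: nearW.
Qed.

Lemma integral_powR_itvcc (u v a : R) : (0 < u)%R -> (u < v)%R -> (a != 0)%R ->
  \int[mu]_(x in `[u, v]) (x `^ (a - 1))%:E = ((v `^ a - u `^ a) / a)%:E.
Proof.
move=> u0 uv a0; pose F x := (x `^ a / a)%R : R.
have dF (x : R) : (0 < x)%R -> is_derive x 1%R F (x `^ (a - 1))%R.
  move=> x0; have := is_deriveM (is_derive1_powR a x0) (is_derive_cst (a^-1)%R x 1%R).
  move/is_derive_eq; apply.
  by rewrite scaler0 add0r /= /GRing.scale/= mulrA mulVf ?mul1r.
rewrite (@continuous_FTC2 _ _ F)//.
- by rewrite /F -EFinB mulrBl.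
- apply: derivable_within_continuous => x; rewrite in_itv/= => /andP[ux _].
  by apply: ex_derive; apply: is_derive1_powR; exact: lt_le_trans ux.
- have dF' (x : R) : (0 < x)%R -> {for x, continuous F}.
    move=> x0; apply: differentiable_continuous; apply/derivable1_diffP.
    by apply: ex_derive; exact: dF.
  split.
  + move=> x; rewrite in_itv/= => /andP[ux _]; apply: ex_derive.
    by apply: dF; exact: lt_trans ux.
  + by apply: cvg_at_right_filter; exact: dF'.
  + by apply: cvg_at_left_filter; apply: dF'; exact: lt_trans uv.
- move=> x; rewrite in_itv/= => /andP[ux _]; rewrite derive1E.
  by apply: derive_val; apply: dF; exact: lt_trans ux.
Qed.

Lemma measurable_powR_EFin (D : set R) (a : R) :
  measurable_fun D (fun x : R => (x `^ a)%:E).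
Proof. by apply: measurable_funTS; apply/measurable_EFinP; exact: measurable_powR. Qed.

Lemma integral_powR_near0_le (t a : R) : (0 < t)%R -> (0 < a)%R ->
  \int[mu]_(x in `]0%R, t[) (x `^ (a - 1))%:E <= (t `^ a / a)%:E.
Proof.
(* The shift by 2 keeps every interval nondegenerate, the first one included, as
   [integral_powR_itvcc] demands. *)
move=> t0 a0; pose F (i : nat) := `[(t / (i.+2)%:R)%R, t]%classic : set R.
apply: (@le_trans _ _ (\int[mu]_(x in \bigcup_i F i) (x `^ (a - 1))%:E)).
  apply: ge0_subset_integral => //.
  - by apply: bigcupT_measurable => i; exact: measurable_itv.
  - exact: measurable_powR_EFin.
  - by move=> x _; rewrite lee_fin powR_ge0.
  move=> x; rewrite /= in_itv/= => /andP[x0 xt].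
  exists (Num.truncn (t / x)) => //; rewrite /F/= in_itv/= (ltW xt) andbT.
  rewrite ler_pdivrMr// mulrC -ler_pdivrMr// ltW//.
  by rewrite (lt_le_trans (truncnS_gt _))// ler_nat.
apply: ge0_integral_bigcup_le.
- move=> i j ij; apply/subsetPset => x; rewrite /F/= !in_itv/= => /andP[ix ->].
  rewrite andbT (le_trans _ ix)// ler_pM2l// lef_pV2 ?posrE// ler_nat.
  by rewrite !ltnS.
- by move=> i; exact: measurable_itv.
- by move=> i; exact: measurable_powR_EFin.
- by move=> i x _; rewrite lee_fin powR_ge0.
move=> i; rewrite integral_powR_itvcc ?gt_eqF ?divr_gt0//; last first.
  by rewrite ltr_pdivrMr// ltr_pMr// ltr1n.
by rewrite lee_fin ler_pM2r ?invr_gt0// lerBlDr lerDl powR_ge0.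
Qed.

Lemma integral_powR_nearoo_le (s b : R) : (0 < s)%R -> (0 < b)%R ->
  \int[mu]_(x in `[s, +oo[) (x `^ (- b - 1))%:E <= (s `^ (- b) / b)%:E.
Proof.
move=> s0 b0; pose F (i : nat) := `[s, (s + i.+1%:R)%R]%classic : set R.
apply: (@le_trans _ _ (\int[mu]_(x in \bigcup_i F i) (x `^ (- b - 1))%:E)).
  apply: ge0_subset_integral => //.
  - by apply: bigcupT_measurable => i; exact: measurable_itv.
  - exact: measurable_powR_EFin.
  - by move=> x _; rewrite lee_fin powR_ge0.
  move=> x; rewrite /= in_itv/= andbT => sx.
  exists (Num.truncn (x - s)) => //; rewrite /F/= in_itv/= sx/=.
  by rewrite -lerBlDl ltW// truncnS_gt.
apply: ge0_integral_bigcup_le.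
- move=> i j ij; apply/subsetPset => x; rewrite /F/= !in_itv/= => /andP[-> xi].
  by rewrite (le_trans xi)// lerD2l ler_nat ltnS.
- by move=> i; exact: measurable_itv.
- by move=> i; exact: measurable_powR_EFin.
- by move=> i x _; rewrite lee_fin powR_ge0.
move=> i; rewrite integral_powR_itvcc ?oppr_eq0 ?gt_eqF ?ltrDl//.
by rewrite lee_fin invrN mulrN -mulNr opprB ler_pM2r ?invr_gt0// lerBlDr lerDl powR_ge0.
Qed.

Lemma integral_mul_indic d (T : measurableType d) (m : {measure set T -> \bar R})
    (D : set T) (f : T -> \bar R) :
  \int[m]_(x in D) f x = \int[m]_x (f x * (\1_D x)%:E).
Proof.
rewrite integral_mkcond; apply: eq_integral => x _; rewrite /patch indicE.
by case: (x \in D); rewrite ?mule1 ?mule0.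
Qed.

(** Tonelli's theorem for the region under the graph of [d] cut at height [t]: vertical slices have
    length [mine t%:E (d m)], horizontal ones are superlevel sets. The truncated distribution
    function of the weak-type estimate becomes an integral of a rearrangement over []0, t[]. *)
Lemma integral_min_superlevel (d : R -> \bar R) (t : R) : (0 < t)%R ->
  measurable_fun setT d -> (forall m, 0 <= d m) ->
  \int[mu]_(m in `]0%R, +oo[) mine t%:E (d m) =
  \int[mu]_(s in `]0%R, t[) mu [set m | (0 < m)%R /\ s%:E < d m].
Proof.
move=> t0 md d0.
pose S : set (measurableTypeR R * measurableTypeR R) :=
  [set z | ((0 < z.2)%R /\ z.1%:E < d z.2) /\ (0 < z.1 < t)%R].
have mS : measurable S.
  apply: measurableI.
    apply: measurableI.
      exact: measurable_ltr_set.
    rewrite -[X in measurable X]setTI; apply: measurable_lte => //.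
    - by apply/measurable_EFinP; exact: measurable_fst.
    - exact: (measurableT_comp md measurable_snd).
  rewrite -[X in measurable X]setTI.
  have := @measurable_fst _ _ (measurableTypeR R) (measurableTypeR R) measurableT.
  move=> /(_ `]0%R, t[%classic (measurable_itv _)).
  by congr (measurable _); apply/seteqP; split => z/=; rewrite in_itv.
pose f := fun z : measurableTypeR R * measurableTypeR R => (\1_S z)%:E : \bar R.
have mf : measurable_fun setT f.
  by apply/measurable_EFinP; exact: measurable_indic.
have f0 z : 0 <= f z by rewrite lee_fin.
transitivity (\int[mu]_m \int[mu]_s f (s, m)).
  rewrite integral_mkcond; apply: eq_integral => m _; rewrite /patch.
  have [|m0] := ifPn.
    rewrite inE/= in_itv/= andbT => m0.
    transitivity (mu (ysection S m)).
      rewrite (_ : ysection S m = [set s | (0 < s < t)%R /\ s%:E < d m]); last first.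
        apply/seteqP; split => s; rewrite ysectionE/= /S/=; tauto.
      have := d0 m; case dm : (d m) => [r| |]//= r0.
      - rewrite (_ : [set _ | _] = `]0%R, (Num.min t r)[%classic); last first.
          apply/seteqP; split => s /=; rewrite in_itv/= lt_min lte_fin.
            by move=> [/andP[-> ->] ->].
          by move=> /and3P[-> -> ->].
        rewrite lebesgue_measure_itv/= lte_fin -EFin_min lt_min t0/=.
        move: r0; rewrite lee_fin le_eqVlt => /predU1P[<-|->].
          by rewrite ltxx min_r// ltW.
        by rewrite oppr0 adde0.
      - rewrite (_ : [set _ | _] = `]0%R, t[%classic); last first.
          apply/seteqP; split => s /=; rewrite in_itv/=; first by case.
          by move=> ?; split; rewrite ?ltry.
        by rewrite lebesgue_measure_itv/= lte_fin t0 oppr0 adde0 min_l ?leey.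
    rewrite -[X in mu X]setIT -integral_indic//; last exact: measurable_ysection.
    by apply: eq_integral => s _; rewrite /f !indicE mem_ysection.
  rewrite integral0_eq// => s _; rewrite /f indicE memNset// => -[[/= m1 _] _].
  by move/negP: m0; apply; rewrite inE/= in_itv/= m1.
rewrite -(fubini_tonelli f)// [RHS]integral_mkcond.
apply: eq_integral => s _; rewrite /patch.
have [|s0] := ifPn.
  rewrite inE/= in_itv/= => s0t.
  transitivity (mu (xsection S s)).
    rewrite -[X in mu X]setIT -integral_indic//; last exact: measurable_xsection.
    by apply: eq_integral => m _; rewrite /f !indicE mem_xsection.
  congr (mu _); apply/seteqP; split => m; rewrite xsectionE/= /S/=; tauto.
rewrite integral0_eq// => m _; rewrite /f indicE memNset// => -[_ /= s0t].
by move/negP: s0; apply; rewrite inE/= in_itv/= s0t.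
Qed.

(** With [e = 1 - p^-1], Jensen's inequality on []0, t[] is used with the density [s]^ (e -
    1)[, which cancels the weight]s [^ p^-1] and has mass at most [t]^ e / e[. Exchanging the
    integrals then leaves that of]t [^ (- e - 1)] over [t > s]. Jensen gives [e^-1] to the power
    [q - 1], the exchange the last factor [e^-1]. *)
Lemma hardy_inequality (w : R -> \bar R) (p q : R) :
  measurable_fun setT w -> (forall s, 0 <= w s) -> (1 < p)%R -> (1 <= q)%R ->
  \int[mu]_(t in `]0%R, +oo[)
    (((t `^ p^-1)%:E * ((t^-1)%:E * \int[mu]_(s in `]0%R, t[) w s)) `^ q * (t^-1)%:E)
  <= ((1 - p^-1)^-1 `^ q)%:E *
     \int[mu]_(s in `]0%R, +oo[) (((s `^ p^-1)%:E * w s) `^ q * (s^-1)%:E).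
Proof.
move=> mw w0 p1 q1.
have p0 : (0 < p)%R by exact: lt_trans p1.
have q0 : (0 < q)%R by exact: lt_le_trans q1.
set e := (1 - p^-1)%R.
have e0 : (0 < e)%R by rewrite subr_gt0 invf_lt1.
pose G s := ((s `^ p^-1)%:E * w s) `^ q.
have mG : measurable_fun setT G.
  apply: (measurableT_comp (measurable_poweR q)); apply: emeasurable_funM => //.
  exact: measurable_powR_EFin.
have G0 s : 0 <= G s by exact: poweR_ge0.
pose D : set (measurableTypeR R * measurableTypeR R) :=
  [set z | (0 < z.2 < z.1)%R].
have mD : measurable D.
  rewrite (_ : D = [set z | (0 < z.2)%R] `&` [set z | (z.2 < z.1)%R]).
    by apply: measurableI; exact: measurable_ltr_set.
  by apply/seteqP; split => z /=; [move=> /andP[]|move=> [? ?]; apply/andP].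
(* The constraint [0 < s < t] is moved into the integrand, so that both integrals run over the whole
   line and can be exchanged. *)
pose h := fun z : measurableTypeR R * measurableTypeR R =>
  (z.1 `^ (- e - 1))%:E * (\1_D z)%:E * ((z.2 `^ (e - 1))%:E * G z.2).
have mh : measurable_fun setT h.
  apply: emeasurable_funM.
    apply: emeasurable_funM; apply/measurable_EFinP.
      exact: (measurableT_comp (@measurable_powR R _) measurable_fst).
    exact: measurable_indic.
  apply: emeasurable_funM.
    apply/measurable_EFinP.
    exact: (measurableT_comp (@measurable_powR R _) measurable_snd).
  exact: (measurableT_comp mG measurable_snd).
have h0 z : 0 <= h z by rewrite /h !mule_ge0 ?lee_fin ?powR_ge0 ?poweR_ge0.
have key t : (0 < t)%R ->
    ((t `^ p^-1)%:E * ((t^-1)%:E * \int[mu]_(s in `]0%R, t[) w s)) `^ q * (t^-1)%:E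
    <= (e^-1 `^ (q - 1))%:E * \int[mu]_s h (t, s).
  move=> t0; have M0 : (0 < t `^ e / e)%R by rewrite divr_gt0 ?powR_gt0.
  have int0 : 0 <= \int[mu]_(s in `]0%R, t[) w s by exact: integral_ge0.
  have := @jensen_poweR _ _ _ mu `]0%R, t[%classic (fun s => (s `^ (e - 1))%:E)
    (fun s => (s `^ p^-1)%:E * w s) (t `^ e / e)%R q (measurable_itv _) M0 q1.
  have mg : measurable_fun `]0%R, t[ (fun s : R => (s `^ p^-1)%:E * w s).
    apply: measurable_funTS; apply: emeasurable_funM => //.
    exact: measurable_powR_EFin.
  have mk : measurable_fun `]0%R, t[ (fun s : R => (s `^ (e - 1))%:E).
    exact: measurable_powR_EFin.
  move=> /(_ mk mg).
  have k0 (s : R) : `]0%R, t[%classic s -> 0 <= (s `^ (e - 1))%:E.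
    by move=> _; rewrite lee_fin powR_ge0.
  have g0 (s : R) : `]0%R, t[%classic s -> 0 <= (s `^ p^-1)%:E * w s.
    by move=> _; rewrite mule_ge0// lee_fin powR_ge0.
  move=> /(_ k0 g0 (integral_powR_near0_le t0 e0)).
  rewrite (_ : \int[mu]_(x in `]0%R, t[) _ = \int[mu]_(s in `]0%R, t[) w s); last first.
    apply: eq_integral => s; rewrite inE/= in_itv/= => /andP[s0 _].
    rewrite muleA -EFinM -powRD ?(gt_eqF s0) ?implybT//.
    by rewrite (_ : e - 1 + p^-1 = 0)%R ?powRr0 ?mul1e// /e; ring.
  set X := \int[mu]_(s in _) w s.
  set Y := \int[mu]_(x in `]0%R, t[) (_ * _ `^ q) => XY.
  rewrite muleA -EFinM poweRM//; last by rewrite lee_fin mulr_ge0 ?powR_ge0 ?invr_ge0 ?ltW.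
  rewrite poweR_EFin muleAC -EFinM.
  have hY : \int[mu]_s h (t, s) = (t `^ (- e - 1))%:E * Y.
    rewrite /Y [in RHS]integral_mul_indic -ge0_integralZl//; last 3 first.
    - apply: emeasurable_funM; last by apply/measurable_EFinP; exact: measurable_indic.
      by apply: emeasurable_funM => //; exact: measurable_powR_EFin.
    - by move=> s _; rewrite !mule_ge0 ?lee_fin ?powR_ge0 ?poweR_ge0.
    - by rewrite lee_fin powR_ge0.
    apply: eq_integral => s _; rewrite /h/= -muleA; congr (_ * _); rewrite muleC.
    by congr (_ * _); rewrite !indicE; congr ((_ _)%:R)%:E;
      apply/idP/idP; rewrite !inE/= in_itv.
  rewrite hY muleA -EFinM.
  apply: (@le_trans _ _ (((t `^ p^-1 / t) `^ q / t)%:E *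
      (((t `^ e / e) `^ (q - 1))%:E * Y))).
    apply: lee_wpmul2l; last exact: XY.
    by rewrite lee_fin mulr_ge0 ?powR_ge0 ?invr_ge0 ?ltW.
  rewrite muleA -EFinM le_eqVlt; apply/orP; left; apply/eqP; congr (_%:E * _).
  have tN : (t^-1 = t `^ (- 1))%R by rewrite powR_inv1 ?ltW.
  rewrite tN -powRD ?(gt_eqF t0) ?implybT// -powRrM.
  rewrite powRM ?powR_ge0 ?invr_ge0 ?ltW// -powRrM.
  rewrite mulrA -!powRD ?(gt_eqF t0) ?implybT// mulrC.
  by congr (_ * _ `^ _)%R; rewrite /e; ring.
apply: (@le_trans _ _ (\int[mu]_(t in `]0%R, +oo[)
    ((e^-1 `^ (q - 1))%:E * \int[mu]_s h (t, s)))).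
  apply: le_integral_nonmeasurable => t; rewrite /= in_itv/= andbT => t0.
    by rewrite mule_ge0 ?poweR_ge0// lee_fin invr_ge0 ltW.
  exact: key.
have mF : measurable_fun setT (fun t => \int[mu]_s h (t, s)).
  exact: measurable_fun_fubini_tonelli_F.
apply: (@le_trans _ _ (\int[mu]_t ((e^-1 `^ (q - 1))%:E * \int[mu]_s h (t, s)))).
  apply: ge0_subset_integral => //; first exact: measurable_funeM.
  by move=> t _; rewrite mule_ge0 ?lee_fin ?powR_ge0// integral_ge0.
rewrite ge0_integralZl//; last 2 first.
- by move=> t _; exact: integral_ge0.
- by rewrite lee_fin powR_ge0.
rewrite (fubini_tonelli h)// -(@mulr_powRB1 _ (e^-1)%R q)//; last by rewrite invr_ge0 ltW.
rewrite mulrC EFinM -muleA; apply: lee_wpmul2l; first by rewrite lee_fin powR_ge0.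
rewrite -ge0_integralZl//; last 3 first.
- apply: (eq_measurable_fun (fun s => G s * (s `^ (- 1))%:E)).
    by move=> s; rewrite inE/= in_itv/= andbT => s0; rewrite powR_inv1 ?ltW.
  apply: emeasurable_funM; last exact: measurable_powR_EFin.
  exact: measurable_funTS.
- move=> s; rewrite /= in_itv/= andbT => s0.
  by rewrite mule_ge0 ?poweR_ge0// lee_fin invr_ge0 ltW.
- by rewrite lee_fin invr_ge0 ltW.
rewrite [leRHS]integral_mul_indic; apply: le_integral_nonmeasurable => s _.
  exact: integral_ge0.
rewrite /h/= indicE; case: (boolP (s \in _)); last first.
  move=> s0; rewrite mule0 integral0_eq// => t _.
  rewrite indicE memNset ?mule0 ?mul0e// /D/= => /andP[s1 _].
  by move/negP: s0; apply; rewrite inE/= in_itv/= s1.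
rewrite inE/= in_itv/= andbT => s0; rewrite mule1.
rewrite ge0_integralZr//; last 3 first.
- apply: emeasurable_funM; first exact: measurable_powR_EFin.
  apply/measurable_EFinP; apply: (measurableT_comp _ (pair2_measurable s)).
  exact: measurable_indic.
- by move=> t _; rewrite mule_ge0 ?lee_fin ?powR_ge0.
- by rewrite mule_ge0 ?poweR_ge0// lee_fin powR_ge0.
apply: (@le_trans _ _ ((s `^ (- e) / e)%:E * ((s `^ (e - 1))%:E * G s))).
  apply: lee_wpmul2r; first by rewrite mule_ge0 ?poweR_ge0// lee_fin powR_ge0.
  apply: le_trans (integral_powR_nearoo_le s0 e0).
  rewrite [leRHS]integral_mul_indic; apply: le_integral_nonmeasurable => t _.
    by rewrite mule_ge0 ?lee_fin ?powR_ge0.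
  apply: lee_wpmul2l; first by rewrite lee_fin powR_ge0.
  rewrite lee_fin !indicE; case: (boolP ((t, s) \in D)) => [|_]; last by rewrite ler0n.
  by rewrite inE /D/= => /andP[_ st]; rewrite mem_set//= in_itv/= ltW.
rewrite muleA -EFinM (_ : _ * _ = e^-1 * s^-1)%R ?EFinM; last first.
  rewrite mulrAC -powRD ?(gt_eqF s0) ?implybT// (_ : - e + (e - 1) = - 1)%R; last by ring.
  by rewrite powR_inv1 ?ltW// mulrC.
by rewrite -muleA (muleC (s^-1)%:E).
Qed.

End power_integrals.

(** * Lebesgue measure on tuples *)

Section line.
Local Open Scope ereal_scope.
Context (R : realType).
Notation mu := (@lebesgue_measure R).

(** Lebesgue measure is determined by half-open intervals, and its pushforward under the translation
    gives them the same length. The dilation below is treated alike, with the pushforward multiplied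
    by [a]. *)
Lemma ge0_integral_translate (a : R) (f : R -> \bar R) :
  measurable_fun setT f -> (forall x, 0 <= f x) ->
  \int[mu]_x f (x + a)%R = \int[mu]_x f x.
Proof.
move=> mf f0; pose phi := fun x : measurableTypeR R => (x + a)%R : measurableTypeR R.
have mphi : measurable_fun setT phi by exact: measurable_funD.
transitivity (\int[pushforward mu phi]_x f x).
  by rewrite ge0_integral_pushforward.
apply: eq_measure_integral => A mA _; apply/esym/lebesgue_measure_unique => //.
move=> _ [[u v] _ <-]; rewrite [RHS](_ : _ = mu (phi @^-1` `]u, v]))//.
rewrite (_ : phi @^-1` _ = `](u - a)%R, (v - a)%R]%classic).
  rewrite !lebesgue_measure_itv/= !lte_fin ltrD2r; case: ifPn => // _.
  by rewrite -!EFinD; congr (_%:E); ring.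
by apply/seteqP; split => x; rewrite /= !in_itv/= /phi ltrBlDr lerBrDr.
Qed.

Lemma ge0_integral_dilate (a : R) (f : R -> \bar R) : (0 < a)%R ->
  measurable_fun setT f -> (forall x, 0 <= f x) ->
  \int[mu]_x f (a * x)%R = (a^-1)%:E * \int[mu]_x f x.
Proof.
move=> a0 mf f0; pose phi := fun x : measurableTypeR R => (a * x)%R : measurableTypeR R.
have mphi : measurable_fun setT phi by exact: measurable_funM.
have a1 : (0 <= a)%R by exact: ltW.
transitivity ((a^-1)%:E * (a%:E * \int[pushforward mu phi]_x f x)).
  by rewrite muleA -EFinM mulVf ?gt_eqF// mul1e ge0_integral_pushforward.
congr (_ * _).
rewrite -(ge0_integral_mscale _ measurableT (NngNum a1))//.
apply: eq_measure_integral => A mA _; apply/esym/lebesgue_measure_unique => //.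
move=> _ [[u v] _ <-]; rewrite [RHS](_ : _ = a%:E * mu (phi @^-1` `]u, v]))//.
rewrite (_ : phi @^-1` _ = `](a^-1 * u)%R, (a^-1 * v)%R]%classic).
  rewrite !lebesgue_measure_itv/= !lte_fin ltr_pM2l ?invr_gt0//.
  case: ifPn => _; last by rewrite mule0.
  by rewrite -!EFinD -EFinM; congr (_%:E); field; rewrite gt_eqF.
apply/seteqP; split => x; rewrite /= !in_itv/= /phi.
  by rewrite ltr_pdivrMl// ler_pdivlMl.
by rewrite ltr_pdivrMl// ler_pdivlMl.
Qed.

End line.

(** * Tonelli's theorem by coordinates and invariance under isometries *)

Section tuples.
Local Open Scope ereal_scope.
Context (R : realType).
Notation T := (measurableTypeR R).
Notation lam := (@borel_lebesgue R _).

Definition tadd n (x y : n.-tuple T) : n.-tuple T :=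
  [tuple (tnth x i + tnth y i)%R | i < n].
Definition tscale n (a : R) (x : n.-tuple T) : n.-tuple T :=
  [tuple (a * tnth x i)%R | i < n].
Definition tdot n (x y : n.-tuple T) : R :=
  (\sum_(i < n) tnth x i * tnth y i)%R.

Lemma tnth_tadd n (x y : n.-tuple T) i :
  tnth (tadd x y) i = (tnth x i + tnth y i)%R.
Proof. by rewrite tnth_mktuple. Qed.

Lemma tnth_tscale n a (x : n.-tuple T) i : tnth (tscale a x) i = (a * tnth x i)%R.
Proof. by rewrite tnth_mktuple. Qed.

Definition tnthE := (tnth_tadd, tnth_tscale).

Lemma taddC n : commutative (@tadd n).
Proof. by move=> x y; apply: eq_from_tnth => i; rewrite !tnthE addrC. Qed.

Lemma tnth_cons0 n (x : T * n.-tuple T) : tnth (tuple_cons x) ord0 = x.1.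
Proof. by []. Qed.

Lemma tnth_consS n (x : T * n.-tuple T) i :
  tnth (tuple_cons x) (lift ord0 i) = tnth x.2 i.
Proof. by case: x => a x; rewrite !(tnth_nth a). Qed.

Lemma tadd_cons n (a b : T) (x y : n.-tuple T) :
  tadd (tuple_cons (a, x)) (tuple_cons (b, y)) = tuple_cons ((a + b)%R, tadd x y).
Proof.
apply: eq_from_tnth => i; case: (unliftP ord0 i) => [j|] ->;
  by rewrite !tnthE ?tnth_consS ?tnth_cons0//= tnthE.
Qed.

Lemma tscale_cons n (a b : T) (x : n.-tuple T) :
  tscale a (tuple_cons (b, x)) = tuple_cons ((a * b)%R, tscale a x).
Proof.
apply: eq_from_tnth => i; case: (unliftP ord0 i) => [j|] ->;
  by rewrite !tnthE ?tnth_consS ?tnth_cons0//= tnthE.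
Qed.

Lemma measurable_mktuple d (X : measurableType d) n (f : X -> 'I_n -> R) :
  (forall i, measurable_fun setT (f ^~ i)) ->
  measurable_fun setT (fun x => [tuple f x i | i < n] : n.-tuple T).
Proof.
move=> mf; apply/measurable_fun_tnthP => i.
apply: (eq_measurable_fun (f ^~ i)) => [x _|]; last exact: mf.
by rewrite /= tnth_mktuple.
Qed.

Lemma measurable_fun_tnth d (X : measurableType d) n (f : X -> n.-tuple T) i :
  measurable_fun setT f -> measurable_fun setT (fun x => tnth (f x) i : T).
Proof. by move=> mf; exact: (measurableT_comp (measurable_tnth i) mf). Qed.

Lemma measurable_tadd d (X : measurableType d) n (f g : X -> n.-tuple T) :
  measurable_fun setT f -> measurable_fun setT g ->
  measurable_fun setT (fun x => tadd (f x) (g x)).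
Proof.
move=> mf mg; apply: measurable_mktuple => i.
by apply: measurable_funD; exact: measurable_fun_tnth.
Qed.

Lemma measurable_tscale d (X : measurableType d) n a (f : X -> n.-tuple T) :
  measurable_fun setT f -> measurable_fun setT (fun x => tscale a (f x)).
Proof.
move=> mf; apply: measurable_mktuple => i.
by apply: measurable_funM => //; exact: measurable_fun_tnth.
Qed.

Lemma measurable_tdot d (X : measurableType d) n (f g : X -> n.-tuple T) :
  measurable_fun setT f -> measurable_fun setT g ->
  measurable_fun setT (fun x => tdot (f x) (g x) : T).
Proof.
move=> mf mg; apply: measurable_sum => i.
by apply: measurable_funM; exact: measurable_fun_tnth.
Qed.

(** By construction the measure in dimension [n.+1] is the image of a product under [tuple_cons], so
    this is Tonelli's theorem. It drives the inductions on the dimension. *)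
Lemma ge0_integral_borel_lebesgueS n (f : n.+1.-tuple T -> \bar R) :
  measurable_fun setT f -> (forall x, 0 <= f x) ->
  \int[borel_lebesgue R n.+1]_x f x =
  \int[lebesgue_measure]_t \int[borel_lebesgue R n]_y f (tuple_cons (t, y)).
Proof.
move=> mf f0.
transitivity (\int[pushforward (@lebesgue_measure R \x borel_lebesgue R n)
    (@tuple_cons R n)]_x f x) => //.
rewrite ge0_integral_pushforward//; last exact: measurable_tuple_cons.
rewrite preimage_setT (fubini_tonelli1 (f \o @tuple_cons R n))//; last first.
  by move=> z; exact: f0.
by apply: measurableT_comp => //; exact: measurable_tuple_cons.
Qed.

Lemma measurable_integral_cons n (f : n.+1.-tuple T -> \bar R) :
  measurable_fun setT f -> (forall x, 0 <= f x) ->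
  measurable_fun setT
    (fun t : T => \int[borel_lebesgue R n]_y f (tuple_cons (t, y))).
Proof.
move=> mf f0; apply: (measurable_fun_fubini_tonelli_F (f \o @tuple_cons R n)); last first.
  by move=> z; exact: f0.
by apply: measurableT_comp => //; exact: measurable_tuple_cons.
Qed.

Lemma measurable_fun_consr n (t : T) (f : n.+1.-tuple T -> \bar R) :
  measurable_fun setT f -> measurable_fun setT (fun y => f (tuple_cons (t, y))).
Proof.
move=> mf; apply: (measurableT_comp mf).
apply: (measurableT_comp (@measurable_tuple_cons R n)).
exact: pair1_measurable.
Qed.

Lemma ge0_integral_tadd n (a : n.-tuple T) (f : n.-tuple T -> \bar R) :
  measurable_fun setT f -> (forall x, 0 <= f x) ->
  \int[borel_lebesgue R n]_x f (tadd x a) = \int[borel_lebesgue R n]_x f x.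
Proof.
elim: n a f => [a f _ _|n IH a f mf f0].
  by apply: eq_integral => x _; rewrite (tuple0 x) (tuple0 (tadd _ _)).
have mfa : measurable_fun setT (fun x => f (tadd x a)).
  by apply: (measurableT_comp mf); exact: measurable_tadd.
rewrite (ge0_integral_borel_lebesgueS mf f0).
rewrite (ge0_integral_borel_lebesgueS mfa (fun x => f0 _)) {mfa}.
have -> : a = tuple_cons (tuple_uncons a).
  by rewrite /tuple_cons /tuple_uncons/=; exact: tuple_eta.
case: (tuple_uncons a) => a0 a1.
rewrite -[RHS](ge0_integral_translate a0 (measurable_integral_cons mf f0)
  (fun t => integral_ge0 _ (fun y _ => f0 _))).
apply: eq_integral => t _.
under eq_integral do rewrite tadd_cons.
by apply: (IH _ (fun y => f (tuple_cons ((t + a0)%R, y)))) => //;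
  exact: measurable_fun_consr.
Qed.

Lemma ge0_integral_tscale n (a : R) (f : n.-tuple T -> \bar R) : (0 < a)%R ->
  measurable_fun setT f -> (forall x, 0 <= f x) ->
  \int[borel_lebesgue R n]_x f (tscale a x) =
  (a ^- n)%:E * \int[borel_lebesgue R n]_x f x.
Proof.
move=> a0; elim: n f => [f _ _|n IH f mf f0].
  rewrite expr0 invr1 mul1e.
  by apply: eq_integral => x _; rewrite (tuple0 x) (tuple0 (tscale _ _)).
have mfa : measurable_fun setT (fun x => f (tscale a x)).
  by apply: (measurableT_comp mf); exact: measurable_tscale.
rewrite (ge0_integral_borel_lebesgueS mf f0).
rewrite (ge0_integral_borel_lebesgueS mfa (fun x => f0 _)).
under eq_integral => t _.
  under eq_integral do rewrite tscale_cons.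
  rewrite (IH (fun y => f (tuple_cons ((a * t)%R, y))))//; last first.
    exact: measurable_fun_consr.
  over.
have mcons : measurable_fun setT
    (fun t : T => \int[borel_lebesgue R n]_y f (tuple_cons ((a * t)%R, y))).
  apply: (measurableT_comp (measurable_integral_cons mf f0)).
  exact: measurable_funM.
have an0 : 0 <= (a ^- n)%:E by rewrite lee_fin invr_ge0 exprn_ge0// ltW.
rewrite (ge0_integralZl _ measurableT mcons (fun t _ => integral_ge0 _ (fun y _ => f0 _)) an0).
rewrite (ge0_integral_dilate a0 (measurable_integral_cons mf f0)); last first.
  by move=> t; exact: integral_ge0.
by rewrite muleA -EFinM exprSr invfM.
Qed.

(** In dimension 0 the measure is a Dirac mass and the empty product is 1. The formula serves for
    the Gaussian, for the indicator of a cube, and for the majorant of the kernel. *)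
Lemma integral_tensor n (phi : R -> R) (c : R) :
  measurable_fun setT phi -> (forall t, 0 <= phi t)%R ->
  \int[lebesgue_measure]_t (phi t)%:E = c%:E ->
  \int[borel_lebesgue R n]_x (\prod_(i < n) phi (tnth x i))%:E = (c ^+ n)%:E.
Proof.
move=> mphi phi0 phic; have c0 : (0 <= c)%R.
  by rewrite -lee_fin -phic; apply: integral_ge0 => t _; rewrite lee_fin.
have mprod k : measurable_fun setT
    (fun x : k.-tuple T => (\prod_(i < k) phi (tnth x i))%:E).
  apply/measurable_EFinP; apply: measurable_prod => i _.
  by apply: (measurableT_comp mphi); exact: measurable_fun_tnth.
have prod0 k (x : k.-tuple T) : 0 <= (\prod_(i < k) phi (tnth x i))%:E.
  by rewrite lee_fin prodr_ge0.
elim: n => [|n IH].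
  under eq_integral do rewrite big_ord0.
  rewrite integral_cst// mul1e expr0.
  transitivity (\d_([tuple] : 0.-tuple T) [set: 0.-tuple T] : \bar R) => //.
  by rewrite diracE in_setT.
rewrite ge0_integral_borel_lebesgueS//.
have prodS t (y : n.-tuple T) :
    (\prod_(i < n.+1) phi (tnth (tuple_cons (t, y)) i))%:E =
    (phi t)%:E * (\prod_(i < n) phi (tnth y i))%:E.
  by rewrite big_ord_recl EFinM; under eq_bigr do rewrite tnth_consS.
transitivity (\int[lebesgue_measure]_t ((c ^+ n)%:E * (phi t)%:E)).
  apply: eq_integral => t _; under eq_integral do rewrite prodS.
  by rewrite [RHS]muleC -IH; apply: ge0_integralZl;
    [|exact: mprod|move=> y _; exact: prod0|rewrite lee_fin].
rewrite ge0_integralZl//; last 3 first.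
- exact/measurable_EFinP.
- by move=> t _; rewrite lee_fin.
- by rewrite lee_fin exprn_ge0.
by rewrite phic -EFinM exprSr.
Qed.

(* Uniqueness of Haar measure: the double integral of [f (H x) * g (H x + y)],
   [g] the Gaussian, is computed in the two possible orders. *)
Lemma ge0_integral_isometry_opp n (H : n.-tuple T -> n.-tuple T)
    (f : n.-tuple T -> \bar R) :
  measurable_fun setT H ->
  (forall x y, H (tadd x y) = tadd (H x) (H y)) ->
  (forall a x, H (tscale a x) = tscale a (H x)) ->
  involutive H -> (forall x, tdot (H x) (H x) = tdot x x) ->
  measurable_fun setT f -> (forall x, 0 <= f x) ->
  \int[borel_lebesgue R n]_x f (H x) =
  \int[borel_lebesgue R n]_x f (tscale (-1) x).
Proof.
move=> mH HD HZ HK Hiso mf f0.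
pose g (x : n.-tuple T) := (expR (- tdot x x))%:E.
have mg : measurable_fun setT g.
  apply/measurable_EFinP; apply: (measurableT_comp (@measurable_expR R)).
  by apply: measurableT_comp => //; exact: measurable_tdot.
have g0 x : 0 <= g x by rewrite lee_fin expR_ge0.
have intg : \int[borel_lebesgue R n]_x g x = (Num.sqrt pi ^+ n)%:E.
  rewrite -(@integral_tensor n gauss_fun)//; last 3 first.
  - exact: measurable_gauss_fun.
  - exact: gauss_fun_ge0.
  - exact: integralT_gauss.
  apply: eq_integral => x _; rewrite /g /gauss_fun -expR_sum; congr (expR _)%:E.
  by rewrite /tdot -sumrN; apply: eq_bigr => i _; rewrite expr2.
have gH x : g (H x) = g x by rewrite /g Hiso.
clearbody g.
have mopp : measurable_fun setT (fun x : n.-tuple T => f (tscale (-1) x)).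
  by apply: (measurableT_comp mf); exact: measurable_tscale.
have mfH : measurable_fun setT (f \o H) by exact: measurableT_comp.
have sp : (0 < Num.sqrt pi ^+ n :> R)%R by rewrite exprn_gt0// sqrtr_gt0 pi_gt0.
(* The integral of the Gaussian is positive and finite, so it can be cancelled even when the
   integrals of [f] are infinite. *)
suff fE : (Num.sqrt pi ^+ n)%:E * \int[borel_lebesgue R n]_x f (H x) =
    (Num.sqrt pi ^+ n)%:E * \int[borel_lebesgue R n]_x f (tscale (-1) x).
  apply/eqP; rewrite eq_le -(@lee_pmul2l _ (Num.sqrt pi ^+ n)%:E)// fE lexx.
  by rewrite -(@lee_pmul2l _ (Num.sqrt pi ^+ n)%:E)// fE lexx.
rewrite -{1}intg -ge0_integralZl//; last exact: integral_ge0.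
transitivity (\int[borel_lebesgue R n]_x \int[borel_lebesgue R n]_y
    (f (H x) * g (tadd (H x) y))).
  apply: eq_integral => x _; rewrite ge0_integralZl//; last first.
    by apply: (measurableT_comp mg); exact: measurable_tadd.
  rewrite muleC; congr (_ * _); under [RHS]eq_integral do rewrite taddC.
  exact/esym/ge0_integral_tadd.
rewrite (fubini_tonelli (fun z => f (H z.1) * g (tadd (H z.1) z.2)))//; last 2 first.
- apply: emeasurable_funM.
    by apply: (measurableT_comp mfH).
  apply: (measurableT_comp mg); apply: measurable_tadd => //.
  exact: measurableT_comp.
- by move=> z; rewrite mule_ge0.
(* Translating [x] by [- H y] turns [H x] into [H x - y], since [H] is an additive involution, and
   frees the Gaussian of [y]. The remaining integral of [f (H x - y)] in [y] is where the opposite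
   sign comes from. *)
transitivity (\int[borel_lebesgue R n]_y \int[borel_lebesgue R n]_x
    (f (tadd (H x) (tscale (-1) y)) * g x)).
  apply: eq_integral => y _.
  rewrite -[LHS](ge0_integral_tadd (tscale (-1) (H y)))//; last 2 first.
  - apply: emeasurable_funM => //.
    by apply: (measurableT_comp mg); exact: measurable_tadd.
  - by move=> x; rewrite mule_ge0.
  apply: eq_integral => x _ /=; rewrite HD HZ HK; congr (_ * _).
  rewrite -(gH x); congr g; by apply: eq_from_tnth => i; rewrite !tnthE mulN1r subrK.
rewrite (fubini_tonelli (fun z => f (tadd (H z.2) (tscale (-1) z.1)) * g z.2))//; last 2 first.
- apply: emeasurable_funM; last exact: measurableT_comp.
  apply: (measurableT_comp mf); apply: measurable_tadd.
    exact: measurableT_comp.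
  exact: measurable_tscale.
- by move=> z; rewrite mule_ge0.
transitivity (\int[borel_lebesgue R n]_x (g x *
    \int[borel_lebesgue R n]_y f (tscale (-1) y))).
  apply: eq_integral => x _; under eq_integral do rewrite muleC.
  rewrite /= ge0_integralZl//; last first.
    apply: (measurableT_comp mf); apply: measurable_tadd => //.
    exact: measurable_tscale.
  rewrite -[in RHS](ge0_integral_tadd (tscale (-1) (H x)) mopp)//.
  congr (_ * _); apply: eq_integral => y _; congr f.
  by apply: eq_from_tnth => i; rewrite !tnthE; ring.
by rewrite ge0_integralZr ?intg// integral_ge0.
Qed.

(** The integral of the reflected function does not depend on [H]; comparing [H] with the identity
    removes the sign. *)
Lemma ge0_integral_isometry n (H : n.-tuple T -> n.-tuple T)
    (f : n.-tuple T -> \bar R) :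
  measurable_fun setT H ->
  (forall x y, H (tadd x y) = tadd (H x) (H y)) ->
  (forall a x, H (tscale a x) = tscale a (H x)) ->
  involutive H -> (forall x, tdot (H x) (H x) = tdot x x) ->
  measurable_fun setT f -> (forall x, 0 <= f x) ->
  \int[borel_lebesgue R n]_x f (H x) = \int[borel_lebesgue R n]_x f x.
Proof.
move=> mH HD HZ HK Hiso mf f0; rewrite ge0_integral_isometry_opp//.
by rewrite -(@ge0_integral_isometry_opp _ id).
Qed.

End tuples.

(** * Decay of one-dimensional oscillatory integrals *)

Section oscillatory.
Context (R : realType).
Notation mu := (@lebesgue_measure R).
Implicit Types (a c s t : R) (f F : R -> R).

Lemma within_continuousM (A : set R) f g :
  {within A, continuous f} -> {within A, continuous g} ->
  {within A, continuous (fun t => f t * g t)}.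
Proof. by move=> cf cg t; apply: cvgM; [exact: cf|exact: cg]. Qed.

Lemma within_continuous_cst_mul (A : set R) a f :
  {within A, continuous f} -> {within A, continuous (fun t => a * f t)}.
Proof. by move=> cf t; apply: cvgM; [exact: cvg_cst|exact: cf]. Qed.

Lemma is_derive_cos_scale s t : is_derive t 1 (fun t => cos (s * t)) (- s * sin (s * t)).
Proof.
have ds : is_derive t 1 (fun t : R => s * t) s.
  by have := is_deriveZ s (is_derive_id t 1); rewrite /GRing.scale/= mulr1.
have := @is_derive1_comp _ (@cos R) (fun t => s * t) t _ _ (is_derive_cos _) ds.
by move/is_derive_eq; apply; rewrite mulNr mulrC mulNr.
Qed.

Lemma is_derive_sin_scale s t : is_derive t 1 (fun t => sin (s * t)) (s * cos (s * t)).
Proof.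
have ds : is_derive t 1 (fun t : R => s * t) s.
  by have := is_deriveZ s (is_derive_id t 1); rewrite /GRing.scale/= mulr1.
have := @is_derive1_comp _ (@sin R) (fun t => s * t) t _ _ (is_derive_sin _) ds.
by move/is_derive_eq; apply; rewrite mulrC.
Qed.

Lemma continuous_is_derive f df t : is_derive t 1 f df -> {for t, continuous f}.
Proof.
by move=> d; apply: differentiable_continuous; apply/derivable1_diffP; exact: ex_derive.
Qed.

Lemma continuous_cos_scale s : continuous (fun t => cos (s * t)).
Proof. by move=> t; exact: continuous_is_derive (is_derive_cos_scale s t). Qed.

Lemma continuous_sin_scale s : continuous (fun t => sin (s * t)).
Proof. by move=> t; exact: continuous_is_derive (is_derive_sin_scale s t). Qed.

Lemma within_mul_cos c s f : {within `[0, c], continuous f} ->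
  {within `[0, c], continuous (fun t => f t * cos (s * t))}.
Proof.
move=> cf; apply: within_continuousM => //.
by apply: continuous_subspaceT; exact: continuous_cos_scale.
Qed.

Lemma within_mul_sin c s f : {within `[0, c], continuous f} ->
  {within `[0, c], continuous (fun t => f t * sin (s * t))}.
Proof.
move=> cf; apply: within_continuousM => //.
by apply: continuous_subspaceT; exact: continuous_sin_scale.
Qed.

Lemma integrable_itvcc (u v : R) f : {within `[u, v], continuous f} ->
  mu.-integrable `[u, v] (EFin \o f).
Proof.
by move=> cf; apply: continuous_compact_integrable => //; exact: segment_compact.
Qed.

Lemma derivable_oo_is_derive F f c : 0 < c ->
  {within `[0, c], continuous F} ->
  (forall t, 0 < t < c -> is_derive t 1 F (f t)) ->
  derivable_oo_LRcontinuous F 0 c /\ {in `]0, c[, F^`()%classic =1 f}.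
Proof.
move=> c0 /(continuous_within_itvP _ c0)[_ F0 Fc] dF; split.
  by split=> // t; rewrite in_itv/= => /dF d; exact: ex_derive.
by move=> t; rewrite in_itv/= => /dF d; rewrite derive1E; exact: derive_val.
Qed.

Lemma integration_by_parts_is_derive (F f G g : R -> R) c : 0 < c ->
  {within `[0, c], continuous f} -> {within `[0, c], continuous F} ->
  (forall t, 0 < t < c -> is_derive t 1 F (f t)) ->
  continuous g -> (forall t, is_derive t 1 G (g t)) ->
  \int[mu]_(t in `[0, c]) (F t * g t) =
  F c * G c - F 0 * G 0 - \int[mu]_(t in `[0, c]) (f t * G t).
Proof.
move=> c0 cf cF dF cg dG.
have [dF1 dF2] := derivable_oo_is_derive c0 cF dF.
have cG : {within `[0, c], continuous G}.
  by apply: continuous_subspaceT => t; exact: continuous_is_derive (dG t).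
have [dG1 dG2] := derivable_oo_is_derive c0 cG (fun t _ => dG t).
by apply: Rintegration_by_parts => //; exact: continuous_subspaceT.
Qed.

Section by_parts.
Context (F f : R -> R) (c s : R).
Context (c0 : 0 < c) (s0 : 0 < s).
Context (cf : {within `[0, c], continuous f}).
Context (cF : {within `[0, c], continuous F}).
Context (dF : forall t, 0 < t < c -> is_derive t 1 F (f t)).

Lemma by_parts_cos :
  \int[mu]_(t in `[0, c]) (F t * cos (s * t)) =
  F c * sin (s * c) / s - s^-1 * \int[mu]_(t in `[0, c]) (f t * sin (s * t)).
Proof.
have dG t : is_derive t 1 (fun t => s^-1 * sin (s * t)) (cos (s * t)).
  have := is_deriveZ s^-1 (is_derive_sin_scale s t).
  by move/is_derive_eq; apply; rewrite /GRing.scale/= mulrA mulVf ?gt_eqF ?mul1r.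
rewrite (integration_by_parts_is_derive c0 cf cF dF (@continuous_cos_scale s) dG).
rewrite mulr0 sin0 !mulr0 subr0 -RintegralZl//; last first.
  exact/integrable_itvcc/within_mul_sin.
congr (_ - _); first by rewrite mulrA mulrAC.
by apply: eq_Rintegral => t _; rewrite mulrCA.
Qed.

Lemma by_parts_sin :
  \int[mu]_(t in `[0, c]) (F t * sin (s * t)) =
  (F 0 - F c * cos (s * c)) / s +
  s^-1 * \int[mu]_(t in `[0, c]) (f t * cos (s * t)).
Proof.
have dG t : is_derive t 1 (fun t => - s^-1 * cos (s * t)) (sin (s * t)).
  have := is_deriveZ (- s^-1) (is_derive_cos_scale s t).
  move/is_derive_eq; apply.
  by rewrite /GRing.scale/= mulNr mulNr mulrN opprK mulrA mulVf ?gt_eqF ?mul1r.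
rewrite (integration_by_parts_is_derive c0 cf cF dF (@continuous_sin_scale s) dG).
rewrite mulr0 cos0 mulr1 -RintegralZl//; last first.
  exact/integrable_itvcc/within_mul_cos.
rewrite (_ : \int[mu]_(t in `[0, c]) (f t * (- s^-1 * cos (s * t))) =
  - \int[mu]_(t in `[0, c]) (s^-1 * (f t * cos (s * t)))); last first.
  rewrite -[RHS]mulN1r -RintegralZl//; last first.
    by apply: integrable_itvcc; apply: within_continuous_cst_mul; exact: within_mul_cos.
  by apply: eq_Rintegral => t _; ring.
by rewrite opprK; congr (_ + _); ring.
Qed.

Lemma Rintegral_derive : \int[mu]_(t in `[0, c]) f t = F c - F 0.
Proof.
have [dF1 dF2] := derivable_oo_is_derive c0 cF dF.
by rewrite /Rintegral (continuous_FTC2 c0 cf dF1 dF2).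
Qed.

(* The integral of the derivative against an oscillating factor is bounded by
   the variation of [F], which is at most [M] by monotonicity. *)
Lemma monotone_osc_bound (M : R) :
  (forall t, 0 <= t <= c -> 0 <= F t <= M) ->
  (forall t, 0 <= t <= c -> 0 <= f t) \/ (forall t, 0 <= t <= c -> f t <= 0) ->
  `|\int[mu]_(t in `[0, c]) (F t * cos (s * t))| <= 3 * M / s /\
  `|\int[mu]_(t in `[0, c]) (F t * sin (s * t))| <= 3 * M / s.
Proof.
move=> FM mono.
have bd (h : R -> R) : (forall t, `|h t| <= 1) -> continuous h ->
    `|\int[mu]_(t in `[0, c]) (f t * h t)| <= M.
  move=> h1 ch; have cfh : {within `[0, c], continuous (fun t => f t * h t)}.
    by apply: within_continuousM => //; exact: continuous_subspaceT.
  apply: (le_trans (le_normr_Rintegral _ _)) => //; first exact: integrable_itvcc.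
  apply: (@le_trans _ _ (\int[mu]_(t in `[0, c]) `|f t|)).
    apply: le_Rintegral => //.
    - by apply: integrable_norm; exact: integrable_itvcc.
    - by apply: integrable_norm; exact: integrable_itvcc.
    - by move=> t _; rewrite normrM ler_piMr.
  have F0 : 0 <= F 0 <= M by apply: FM; rewrite lexx ltW.
  have Fc : 0 <= F c <= M by apply: FM; rewrite lexx ltW.
  case: mono => fs.
    rewrite (_ : \int[mu]_(t in `[0, c]) `|f t| = \int[mu]_(t in `[0, c]) f t).
      by rewrite Rintegral_derive; lra.
    by apply: eq_Rintegral => t; rewrite inE/= in_itv/= => /fs/ger0_norm.
  rewrite (_ : \int[mu]_(t in `[0, c]) `|f t| = - \int[mu]_(t in `[0, c]) f t).
    by rewrite Rintegral_derive; lra.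
  rewrite -mulN1r -RintegralZl//; last exact: integrable_itvcc.
  by apply: eq_Rintegral => t; rewrite inE/= in_itv/= mulN1r => /fs/ler0_norm.
have F0 : 0 <= F 0 <= M by apply: FM; rewrite lexx ltW.
have Fc : 0 <= F c <= M by apply: FM; rewrite lexx ltW.
have M0 : 0 <= M by lra.
have abscos t : `|cos t| <= 1 by rewrite ler_norml cos_geN1 cos_le1.
have abssin t : `|sin t| <= 1 by rewrite ler_norml sin_geN1 sin_le1.
(* The constant 3 covers the worse of the two cases: the sine has boundary terms at both ends, at
   most [2 * M], besides the variation [M]. *)
split.
  rewrite by_parts_cos (mulrC s^-1) -mulrBl normrM (gtr0_norm (_ : 0 < s^-1)) ?invr_gt0//.
  rewrite ler_pM2r ?invr_gt0// (le_trans (ler_normB _ _))//.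
  have -> : 3 * M = M + 2 * M by ring.
  apply: lerD; last first.
    by apply: (le_trans (bd _ _ _)) => //; [exact: continuous_sin_scale|lra].
  by rewrite normrM ger0_norm; [rewrite (le_trans (ler_piMr _ _))//; lra|lra].
rewrite by_parts_sin (mulrC s^-1) -mulrDl normrM (gtr0_norm (_ : 0 < s^-1)) ?invr_gt0//.
rewrite ler_pM2r ?invr_gt0// (le_trans (ler_normD _ _))//.
have -> : 3 * M = 2 * M + M by ring.
apply: lerD; last exact: (bd _ _ (@continuous_cos_scale s)).
rewrite (le_trans (ler_normB _ _))// (_ : 2 * M = M + M); last by ring.
apply: lerD; first by rewrite ger0_norm; lra.
by rewrite normrM ger0_norm; [rewrite (le_trans (ler_piMr _ _))//; lra|lra].
Qed.

End by_parts.

Lemma continuous_powR_max a : 0 < a -> continuous (fun x : R => Num.max 0 x `^ a).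
Proof.
move=> a0 x; have [x0|x0|<-] := ltgtP 0 x.
- apply: (@continuous_is_derive _ (a * x `^ (a - 1))).
  apply: (near_eq_is_derive _ (is_derive1_powR a x0)).
  near=> y; rewrite max_r//; apply: ltW; near: y; exact: lt_nbhsr.
- apply: (@continuous_is_derive _ 0).
  apply: (near_eq_is_derive _ (is_derive_cst 0 x 1)).
  near=> y; rewrite max_l ?powR0 ?gt_eqF//; apply: ltW; near: y; exact: lt_nbhsl.
- rewrite /continuous_at maxxx powR0 ?gt_eqF//.
  apply/cvgrPdist_lt => e e0; near=> y.
  rewrite sub0r normrN ger0_norm ?powR_ge0//.
  have -> : e = (e `^ a^-1) `^ a by rewrite -powRrM mulVf ?gt_eqF// powRr1 ?ltW.
  rewrite gt0_ltr_powR ?nnegrE ?powR_ge0 ?le_max ?lexx//.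
  rewrite gt_max powR_gt0//=; near: y.
  by apply: lt_nbhsl; rewrite powR_gt0.
Unshelve. all: by end_near. Qed.

(** Up to a constant and a shift of the exponent, this is what remains of the multiplier after
    integration over all coordinates but one. *)
Definition br_profile a t : R := Num.max 0 (1 - t ^+ 2) `^ a.

Lemma br_profile_ge0 a t : 0 <= br_profile a t.
Proof. exact: powR_ge0. Qed.

Lemma br_profileE a t : 0 <= t < 1 -> br_profile a t = (1 - t ^+ 2) `^ a.
Proof.
by move=> /andP[t0 t1]; rewrite /br_profile max_r// subr_ge0 expr_le1// ltW.
Qed.

Lemma br_profile1 a : a != 0 -> br_profile a 1 = 0.
Proof. by move=> a0; rewrite /br_profile expr1n subrr maxxx powR0. Qed.

Lemma continuous_br_profile a : 0 < a -> continuous (br_profile a).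
Proof.
move=> a0 t; apply: (@continuous_comp _ _ _ (fun t => 1 - t ^+ 2)
  (fun x => Num.max 0 x `^ a)); last exact: continuous_powR_max.
by apply: cvgB; [exact: cvg_cst|exact: exprn_continuous].
Qed.

Lemma is_derive_br_profile a t : 0 <= t < 1 ->
  is_derive t 1 (br_profile a) (- (2 * a * (t * br_profile (a - 1) t))).
Proof.
move=> t01; have /andP[t0 t1] := t01.
have u0 : 0 < 1 - t ^+ 2 by rewrite subr_gt0 expr_lt1.
have du : is_derive t 1 (fun t : R => 1 - t ^+ 2) (- (2 * t)).
  have := is_deriveB (is_derive_cst (1 : R) t 1) (is_deriveX 2 (is_derive_id t 1)).
  move/is_derive_eq; apply.
  by rewrite sub0r /GRing.scale/= mulr1 expr1.
have dp : is_derive t 1 (fun t : R => (1 - t ^+ 2) `^ a)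
    (- (2 * a * (t * br_profile (a - 1) t))).
  apply: (is_derive_eq (@is_derive1_comp _ (fun x => x `^ a)
    (fun t => 1 - t ^+ 2) t _ _ (is_derive1_powR a u0) du)).
  by rewrite br_profileE//; ring.
apply: near_eq_is_derive dp.
near=> x; rewrite /br_profile max_r//= ltW//; near: x.
have := @continuous_is_derive _ _ t du.
by move/cvgr_gt; apply.
Unshelve. all: by end_near. Qed.

(* At the endpoint [c = 1] the factor [br_profile a] must vanish continuously. *)
Lemma within_br_profile a c : 0 <= c <= 1 -> (c < 1) || (0 < a) ->
  {within `[0, c], continuous (br_profile a)}.
Proof.
move=> /andP[c0 _] /orP[c1|a0]; last first.
  by apply: continuous_subspaceT; exact: continuous_br_profile.
apply: derivable_within_continuous => t; rewrite in_itv/= => /andP[t0 tc].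
by apply: ex_derive; apply: is_derive_br_profile; rewrite t0 (le_lt_trans tc).
Qed.

Lemma within_mul_id c f : {within `[0, c], continuous f} ->
  {within `[0, c], continuous (fun t => t * f t)}.
Proof.
move=> cf; apply: within_continuousM => //.
by apply: continuous_subspaceT => t; exact: cvg_id.
Qed.

(** The product rule produces [t ^+ 2 * br_profile (a - 1) t]; writing [t ^+ 2] as 1 minus
    [1 - t ^+ 2] expresses it through the profiles of exponents [a] and [a - 1], so that integration
    by parts stays within two families of integrals. *)
Lemma is_derive_mul_br_profile a t : 0 <= t < 1 ->
  is_derive t 1 (fun t => t * br_profile a t)
    ((1 + 2 * a) * br_profile a t - 2 * a * br_profile (a - 1) t).
Proof.
move=> t01; have /andP[t0 t1] := t01.
have u0 : 0 < 1 - t ^+ 2 by rewrite subr_gt0 expr_lt1.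
have := is_deriveM (is_derive_id t 1) (is_derive_br_profile a t01).
move/is_derive_eq; apply; rewrite /GRing.scale/= !br_profileE//.
have -> : (1 - t ^+ 2) `^ a = (1 - t ^+ 2) * (1 - t ^+ 2) `^ (a - 1).
  by rewrite -[X in X * _]powRr1 ?ltW// -powRD ?(gt_eqF u0) ?implybT// subrKC.
by ring.
Qed.

Section profile_by_parts.
Context (a c s : R).
Context (c0 : 0 < c) (c1 : c <= 1) (s0 : 0 < s).
Context (ca : (c < 1) || (1 < a)).

Let c01 : 0 <= c <= 1. Proof. by rewrite ltW. Qed.
Let ca0 : (c < 1) || (0 < a).
Proof. by case/orP: ca => [->//|/(lt_trans ltr01)->]; rewrite orbT. Qed.
Let ca1 : (c < 1) || (0 < a - 1). Proof. by rewrite subr_gt0. Qed.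
Let tc1 t : 0 < t < c -> 0 <= t < 1.
Proof. by move=> /andP[t0 tc]; rewrite ltW//= (lt_le_trans tc). Qed.

(** Together with the sine version this gains a factor [1 / s] for each unit of exponent. The
    condition [ca] makes the profile of exponent [a - 1] continuous up to [c]: either [c] stays
    below the singular point 1, or [a - 1] is positive. *)
Lemma profile_by_parts_cos :
  \int[mu]_(t in `[0, c]) (br_profile a t * cos (s * t)) =
  br_profile a c * sin (s * c) / s + 2 * a / s *
    \int[mu]_(t in `[0, c]) (t * br_profile (a - 1) t * sin (s * t)).
Proof.
have cf : {within `[0, c], continuous (fun t => - (2 * a) * (t * br_profile (a - 1) t))}.
  by apply/within_continuous_cst_mul/within_mul_id/within_br_profile.
have dF t : 0 < t < c -> is_derive t 1 (br_profile a)
    (- (2 * a) * (t * br_profile (a - 1) t)).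
  by move=> /tc1/(is_derive_br_profile a)/is_derive_eq; apply; ring.
rewrite (by_parts_cos c0 s0 cf (within_br_profile c01 ca0) dF).
rewrite -mulrN; congr (_ + _); rewrite (mulrC (2 * a)) -mulrA; congr (_ * _).
rewrite -[LHS]mulN1r -!RintegralZl//.
- by apply: eq_Rintegral => t _; ring.
- by apply: integrable_itvcc; exact: within_mul_sin.
- apply: integrable_itvcc; apply: within_mul_sin; apply: within_mul_id.
  exact: within_br_profile.
Qed.

Lemma profile_by_parts_sin :
  \int[mu]_(t in `[0, c]) (t * br_profile a t * sin (s * t)) =
  - (c * br_profile a c * cos (s * c) / s) +
  ((1 + 2 * a) * \int[mu]_(t in `[0, c]) (br_profile a t * cos (s * t)) -
   2 * a * \int[mu]_(t in `[0, c]) (br_profile (a - 1) t * cos (s * t))) / s.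
Proof.
have ia : mu.-integrable `[0, c] (EFin \o (fun t => br_profile a t * cos (s * t))).
  by apply/integrable_itvcc/within_mul_cos/within_br_profile.
have ia1 : mu.-integrable `[0, c] (EFin \o (fun t => br_profile (a - 1) t * cos (s * t))).
  by apply/integrable_itvcc/within_mul_cos/within_br_profile.
have cf : {within `[0, c], continuous (fun t =>
    (1 + 2 * a) * br_profile a t - 2 * a * br_profile (a - 1) t)}.
  by apply: within_continuousB; apply/within_continuous_cst_mul/within_br_profile.
have dF t : 0 < t < c -> is_derive t 1 (fun t => t * br_profile a t)
    ((1 + 2 * a) * br_profile a t - 2 * a * br_profile (a - 1) t).
  by move=> /tc1; exact: is_derive_mul_br_profile.
have cF : {within `[0, c], continuous (fun t => t * br_profile a t)}.
  exact/within_mul_id/within_br_profile.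
rewrite (by_parts_sin c0 s0 cf cF dF).
rewrite mul0r sub0r mulNr; congr (_ + _); rewrite mulrC; congr (_ / _).
rewrite -!RintegralZl// -RintegralB//.
- by apply: eq_Rintegral => t _; ring.
- apply: integrable_itvcc; apply: within_continuous_cst_mul.
  by apply: within_mul_cos; exact: within_br_profile.
- apply: integrable_itvcc; apply: within_continuous_cst_mul.
  by apply: within_mul_cos; exact: within_br_profile.
Qed.

End profile_by_parts.

Lemma Rintegral_tail_le c B f : 0 <= c <= 1 -> {within `[0, 1], continuous f} ->
  (forall t, c < t <= 1 -> `|f t| <= B) ->
  `|\int[mu]_(t in `[0, 1]) f t| <=
  `|\int[mu]_(t in `[0, c]) f t| + B * (1 - c).
Proof.
move=> /andP[c0 c1] cf fB; have itf := integrable_itvcc cf.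
have /(congr1 (fun x => x + \int[mu]_(t in `[0, c]) f t)) :=
  @Rintegral_itvB _ f (BLeft 0) (BRight 1) c itf c0 c1.
rewrite subrK addrC => ->; rewrite (le_trans (ler_normD _ _))// lerD2l.
have itc : mu.-integrable `]c, 1] (EFin \o f).
  apply: integrableS itf => //; apply: subset_itv; rewrite bnd_simp//.
apply: (le_trans (le_normr_Rintegral _ itc)) => //.
apply: (@le_trans _ _ (\int[mu]_(t in `]c, 1]) B)).
  apply: le_Rintegral => //; first exact: integrable_norm.
  - apply: (@integrableS _ _ _ mu `[c, 1]) => //.
      by apply: subset_itv; rewrite bnd_simp.
    by apply: integrable_itvcc; apply: continuous_subspaceT => t; exact: cvg_cst.
rewrite Rintegral_cst//= lebesgue_measure_itv/= lte_fin.
by move: c1; rewrite le_eqVlt => /predU1P[->|->]; rewrite ?ltxx/= ?subrr ?mulr0.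
Qed.

Definition profile_cos a s := \int[mu]_(t in `[0, 1]) (br_profile a t * cos (s * t)).
Definition profile_sin a s :=
  \int[mu]_(t in `[0, 1]) (t * br_profile a t * sin (s * t)).

(* Cut the integrals at distance [1 / s] of the endpoint. *)
Lemma profile_decay_small a s : 0 < a <= 1 -> 2 <= s ->
  `|profile_cos a s| <= 20 * s `^ (- a - 1) /\
  `|profile_sin a s| <= 20 * s `^ (- a - 1).
Proof.
move=> /andP[a0 a1] s2; set X := s `^ (- a - 1).
have s0 : 0 < s by exact: lt_le_trans s2.
have sV0 : 0 < s^-1 by rewrite invr_gt0.
have sV2 : s^-1 <= 2^-1 by rewrite lef_pV2 ?posrE.
pose c := 1 - s^-1.
have c0 : 0 < c by rewrite /c; lra.
have c1 : c < 1 by rewrite /c; lra.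
have ca : (c < 1) || (1 < a) by rewrite c1.
have ca1 : (c < 1) || (1 < a - 1) by rewrite c1.
have c01 : 0 <= c <= 1 by rewrite !ltW.
have X0 : 0 < X by rewrite powR_gt0.
have XE : s `^ (- a) / s = X.
  by rewrite -[X in _ / X]powRr1 ?ltW// -powRN -powRD ?(gt_eqF s0) ?implybT.
have absc t : `|cos t| <= 1 by rewrite ler_norml cos_geN1 cos_le1.
have abss t : `|sin t| <= 1 by rewrite ler_norml sin_geN1 sin_le1.
have sVp b : s^-1 `^ b = s `^ (- b).
  by rewrite -[s^-1](powR_inv1 (ltW s0)) -powRrM mulN1r.
have tailw t : c <= t <= 1 -> br_profile a t <= 2 * s `^ (- a).
  move=> /andP[ct t1].
  have : Num.max 0 (1 - t ^+ 2) <= 2 * s^-1.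
    rewrite ge_max mulr_ge0 ?(ltW sV0)//=.
    by rewrite /c in ct; have := sqr_ge0 (t - 1); nra.
  move=> /(ge0_ler_powR (ltW a0)); rewrite !nnegrE le_max lexx/=.
  move=> /(_ isT (mulr_ge0 _ (ltW sV0))) => /(_ (ler0n _ _))/le_trans; apply.
  rewrite powRM ?(ltW sV0)// ler_pM ?powR_ge0 ?ler1_powR ?ler1n//.
  by rewrite sVp.
(* The exponent [a - 1] is at most 0, so the profile is largest where [1 - t ^+ 2] is smallest, and
   up to [c] that quantity is at least [s^-1]. *)
have headw t : 0 <= t <= c -> br_profile (a - 1) t <= s `^ (1 - a).
  move=> /andP[t0 tc]; rewrite br_profileE; last by rewrite t0 (le_lt_trans tc).
  have h : s^-1 <= 1 - t ^+ 2 by rewrite /c in tc; nra.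
  have u0 : 0 < 1 - t ^+ 2 by exact: lt_le_trans h.
  rewrite (_ : a - 1 = - (1 - a)); last by ring.
  have -> : s `^ (1 - a) = (s^-1 `^ (1 - a))^-1 by rewrite sVp powRN invrK.
  rewrite powRN lef_pV2 ?posrE ?powR_gt0//.
  apply: ge0_ler_powR h; first by rewrite subr_ge0.
  - by rewrite nnegrE ltW.
  - by rewrite nnegrE ltW.
have wle1 b t : 0 <= b -> 0 <= t <= c -> br_profile b t <= 1.
  move=> b0 /andP[t0 tc]; rewrite br_profileE; last by rewrite t0 (le_lt_trans tc).
  have t1 : t < 1 by exact: le_lt_trans c1.
  rewrite [leRHS](_ : 1 = 1 `^ b); last by rewrite powR1.
  apply: ge0_ler_powR => //; last by rewrite gerBl sqr_ge0.
    by rewrite nnegrE subr_ge0 expr_le1// ltW.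
  by rewrite nnegrE.
have wmono b t : 0 <= t <= c -> br_profile b t <= br_profile (b - 1) t.
  move=> /andP[t0 tc]; have t1 : t < 1 by exact: le_lt_trans c1.
  rewrite !br_profileE ?t0//; apply: ger_powR; last by rewrite gerBl.
  by rewrite gerBl sqr_ge0 andbT subr_gt0 expr_lt1.
have tc1 t : 0 < t < c -> 0 <= t < 1.
  by move=> /andP[t0 tc]; rewrite ltW//= (lt_trans tc).
have sa0 : 0 <= s `^ (1 - a) by exact: powR_ge0.
have saE : s `^ (1 - a) / s = s `^ (- a).
  rewrite -[X in _ / X]powRr1 ?ltW// -powRN -powRD ?(gt_eqF s0) ?implybT//.
  by congr (_ `^ _); ring.
have cc1 : forall b : R, (c < 1) || (0 < b) by move=> b; rewrite c1.
have [_ I1] : `|\int[mu]_(t in `[0, c]) (t * br_profile (a - 1) t * cos (s * t))| <=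
      3 * s `^ (1 - a) / s /\
    `|\int[mu]_(t in `[0, c]) (t * br_profile (a - 1) t * sin (s * t))| <=
      3 * s `^ (1 - a) / s.
  apply: (@monotone_osc_bound _ (fun t => (1 + 2 * (a - 1)) * br_profile (a - 1) t -
      2 * (a - 1) * br_profile (a - 1 - 1) t)) => //.
  - by apply: within_continuousB; apply/within_continuous_cst_mul/within_br_profile.
  - exact/within_mul_id/within_br_profile.
  - by move=> t /tc1; exact: is_derive_mul_br_profile.
  - move=> t /[dup] tc /andP[t0 t1]; have := headw _ tc; have := br_profile_ge0 (a - 1) t.
    by move=> h0 h1; rewrite mulr_ge0//= (le_trans _ h1)// ler_piMl//; lra.
  (* The derivative is [br_profile (a - 1) t] plus [2 * (1 - a)] times the difference of the
     profiles of exponents [a - 2] and [a - 1], and both terms are nonnegative. *)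
  - left=> t tc; have := wmono (a - 1) _ tc; have := br_profile_ge0 (a - 1) t.
    move=> h0; rewrite -subr_ge0 => /(mulr_ge0 (_ : 0 <= 1 - a)).
    by rewrite subr_ge0 => /(_ a1); lra.
have [I2 _] : `|\int[mu]_(t in `[0, c]) (br_profile a t * cos (s * t))| <= 3 * 1 / s /\
    `|\int[mu]_(t in `[0, c]) (br_profile a t * sin (s * t))| <= 3 * 1 / s.
  apply: (@monotone_osc_bound _ (fun t => - (2 * a) * (t * br_profile (a - 1) t))) => //.
  - by apply/within_continuous_cst_mul/within_mul_id/within_br_profile.
  - exact: within_br_profile.
  - by move=> t /tc1/(is_derive_br_profile a)/is_derive_eq; apply; ring.
  - by move=> t tc; rewrite br_profile_ge0 wle1 ?(ltW a0).
  - right=> t /andP[t0 _]; rewrite mulNr oppr_le0 !mulr_ge0 ?br_profile_ge0//; lra.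
have [I3 _] : `|\int[mu]_(t in `[0, c]) (br_profile (a - 1) t * cos (s * t))| <=
      3 * s `^ (1 - a) / s /\
    `|\int[mu]_(t in `[0, c]) (br_profile (a - 1) t * sin (s * t))| <=
      3 * s `^ (1 - a) / s.
  apply: (@monotone_osc_bound _ (fun t =>
    - (2 * (a - 1)) * (t * br_profile (a - 1 - 1) t))) => //.
  - by apply/within_continuous_cst_mul/within_mul_id/within_br_profile.
  - exact: within_br_profile.
  - by move=> t /tc1/(is_derive_br_profile (a - 1))/is_derive_eq; apply; ring.
  - by move=> t tc; rewrite br_profile_ge0 headw.
  - left=> t /andP[t0 _]; rewrite !mulr_ge0 ?br_profile_ge0//; lra.
rewrite -mulrA saE in I1 I3.
have wc := tailw c; have {}wc : br_profile a c <= 2 * s `^ (- a).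
  by apply: wc; rewrite lexx ltW.
have wc0 := br_profile_ge0 a c.
have sX : s^-1 * s^-1 <= X.
  rewrite -[s^-1](powR_inv1 (ltW s0)) -powRD ?(gt_eqF s0) ?implybT//.
  by rewrite /X; apply: ler_powR; clear -s2 a1; lra.
have cX : 1 - c = s^-1 by rewrite /c; ring.
(* Tail, boundary term at [c] and remaining integral contribute 2 + 2 + 6 multiples of [X] for the
   cosine and 2 + 2 + 15 for the sine; 20 covers both. *)
split.
  apply: (le_trans (@Rintegral_tail_le c (2 * s `^ (- a)) _ c01 _ _)).
  - by apply: within_mul_cos; apply: continuous_subspaceT; exact: continuous_br_profile.
  - move=> t /andP[ct t1]; rewrite normrM ger0_norm ?br_profile_ge0//.
    by rewrite (le_trans (ler_piMr _ _)) ?br_profile_ge0// tailw// (ltW ct).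
  rewrite cX -mulrA XE (profile_by_parts_cos c0 (ltW c1) s0 ca).
  move: XE I1 wc wc0; move: (\int[mu]_(t in _) _) (br_profile a c) (s `^ (- a)) (X) X0.
  move=> J1 w Z X' X0 XE I1 wc wc0.
  have h1 : `|w * sin (s * c) / s| <= 2 * X'.
    rewrite -XE mulrA normrM (gtr0_norm sV0) ler_pM2r// normrM (ger0_norm wc0).
    by rewrite (le_trans (ler_piMr _ _)).
  have h2 : `|2 * a / s * J1| <= 6 * X'.
    rewrite -XE normrM ger0_norm; last by rewrite !mulr_ge0// ltW.
    rewrite (_ : 6 * (Z / s) = 2 / s * (3 * Z)); last by ring.
    apply: ler_pM => //; first by rewrite !mulr_ge0// ltW.
    by rewrite ler_pM2r//; clear -a1; lra.
  have := ler_normD (w * sin (s * c) / s) (2 * a / s * J1).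
  by clear -h1 h2 X0; lra.
apply: (le_trans (@Rintegral_tail_le c (2 * s `^ (- a)) _ c01 _ _)).
- apply: within_mul_sin; apply: within_mul_id.
  by apply: continuous_subspaceT; exact: continuous_br_profile.
- move=> t /andP[ct t1]; have t0 : 0 <= t by exact: ltW (lt_trans c0 ct).
  rewrite normrM ger0_norm ?mulr_ge0 ?br_profile_ge0//.
  rewrite (le_trans (ler_piMr _ _)) ?mulr_ge0 ?br_profile_ge0//.
  by rewrite (le_trans (ler_piMl _ _)) ?br_profile_ge0// tailw// (ltW ct).
rewrite cX -mulrA XE (profile_by_parts_sin c0 (ltW c1) s0 ca).
set J2 := \int[mu]_(t in `[0, c]) (br_profile a t * cos (s * t)) in I2 *.
set J3 := \int[mu]_(t in `[0, c]) (br_profile (a - 1) t * cos (s * t)) in I3 *.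
move: XE I2 I3 wc wc0 sX.
move: J2 J3 (br_profile a c) (s `^ (- a)) (X) X0 => J2 J3 w Z X' X0 XE I2 I3 wc wc0 sX.
have h1 : `|- (c * w * cos (s * c) / s)| <= 2 * X'.
  rewrite normrN -XE mulrA normrM (gtr0_norm sV0) ler_pM2r// normrM.
  rewrite ger0_norm ?mulr_ge0 ?(ltW c0)// (le_trans (ler_piMr _ _)) ?mulr_ge0 ?(ltW c0)//.
  by rewrite (le_trans (ler_piMl _ _))// ltW.
have h2 : `|((1 + 2 * a) * J2 - 2 * a * J3) / s| <= 15 * X'.
  rewrite normrM (gtr0_norm sV0).
  apply: (@le_trans _ _ ((9 / s + 6 * Z) / s)); last first.
    by rewrite mulrDl -[X in _ + X <= _]mulrA XE -mulrA; clear -sX; lra.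
  rewrite ler_pM2r// (le_trans (ler_normB _ _))//; apply: lerD.
    rewrite normrM ger0_norm; last by clear -a0; lra.
    rewrite (_ : 9 / s = 3 * (3 * 1 / s)); last by ring.
    by apply: ler_pM => //; clear -a0 a1; lra.
  rewrite normrM ger0_norm; last by clear -a0; lra.
  rewrite (_ : 6 * _ = 2 * (3 * Z)); last by ring.
  by apply: ler_pM => //; clear -a0 a1; lra.
have := ler_normD (- (c * w * cos (s * c) / s))
  (((1 + 2 * a) * J2 - 2 * a * J3) / s).
by clear -h1 h2 X0; lra.
Qed.

(** Induction on an integer bound of [a]. For [a > 1] one integrates by parts on the whole of
    [0, 1], where the boundary terms vanish, and the decay for [a - 1] gains one power of [s]. Both
    transforms are carried along because each step expresses one by the other. *)
Lemma profile_decay a : 0 < a -> exists2 M : R, 0 <= M & forall s, 2 <= s ->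
  `|profile_cos a s| <= M * s `^ (- a - 1) /\
  `|profile_sin a s| <= M * s `^ (- a - 1).
Proof.
have [N] : exists N : nat, a <= N.+1%:R.
  by exists (Num.truncn a); rewrite ltW// truncnS_gt.
elim: N a => [|N IH] a aN a0.
  by exists 20 => // s s2; apply: profile_decay_small; rewrite ?a0.
have [a1|a1] := leP a 1.
  by exists 20 => // s s2; apply: profile_decay_small; rewrite ?a0.
have [|//|M M0 IHM] := IH (a - 1); first by rewrite lerBlDr natr1.
  by rewrite subr_gt0.
(* The cosine transform needs only [2 * a * M]; the sine transform uses this new bound with
   coefficient [1 + 2 * a], together with the induction hypothesis. *)
exists ((1 + 2 * a) * (2 * a * M) + 2 * a * M).
  by rewrite addr_ge0 ?mulr_ge0//; lra.
move=> s s2; have s0 : 0 < s by exact: lt_le_trans s2.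
have sV0 : 0 < s^-1 by rewrite invr_gt0.
have [] := IHM s s2; rewrite (_ : - (a - 1) - 1 = - a); last by ring.
move=> IC IS; set Y := s `^ (- a) in IC IS.
have Y0 : 0 <= Y by exact: powR_ge0.
have -> : s `^ (- a - 1) = Y / s.
  by rewrite /Y -[X in _ / X]powRr1 ?ltW// -powRN -powRD ?(gt_eqF s0) ?implybT.
have CE : profile_cos a s = 2 * a / s * profile_sin (a - 1) s.
  rewrite /profile_cos (profile_by_parts_cos ltr01 (lexx _) s0) ?a1 ?orbT//.
  by rewrite br_profile1 ?(gt_eqF a0)// !mul0r add0r.
have SE : profile_sin a s =
    ((1 + 2 * a) * profile_cos a s - 2 * a * profile_cos (a - 1) s) / s.
  rewrite /profile_sin (profile_by_parts_sin ltr01 (lexx _) s0) ?a1 ?orbT//.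
  by rewrite br_profile1 ?(gt_eqF a0)// mulr0 !mul0r oppr0 add0r.
move: CE SE IC IS; move: (profile_cos a s) (profile_sin a s).
move: (profile_cos (a - 1) s) (profile_sin (a - 1) s); move: Y Y0 => Y Y0.
move=> C' S' C S CE SE IC IS.
have aM : 0 <= 2 * a * M by rewrite !mulr_ge0// ltW.
have a2 : 0 <= 1 + 2 * a by rewrite addr_ge0// mulr_ge0// ltW.
have Ys : 0 <= Y / s by rewrite mulr_ge0// ltW.
have Ys1 : Y / s <= Y by rewrite ler_piMr// invf_le1// (le_trans _ s2)// ler1n.
have hC : `|C| <= 2 * a * M * (Y / s).
  have as0 : 0 <= 2 * a / s by rewrite !mulr_ge0// ltW.
  rewrite CE normrM (ger0_norm as0).
  rewrite (_ : 2 * a * M * (Y / s) = 2 * a / s * (M * Y)); last by ring.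
  exact: ler_wpM2l.
split.
  apply: (le_trans hC); apply: ler_wpM2r => //.
  by rewrite lerDr; exact: mulr_ge0.
have a20 : 0 <= 2 * a by rewrite mulr_ge0// ltW.
rewrite SE normrM (gtr0_norm sV0) mulrA (ler_pM2r sV0).
apply: (le_trans (ler_normB _ _)); rewrite [leRHS]mulrDl; apply: lerD.
  rewrite normrM (ger0_norm a2) -mulrA; apply: ler_wpM2l => //.
  by apply: (le_trans hC); exact: ler_wpM2l.
by rewrite normrM (ger0_norm a20) -mulrA; exact: ler_wpM2l.
Qed.

End oscillatory.

(** * The Bochner-Riesz kernel *)

Section kernel.
Context (R : realType).
Notation T := (measurableTypeR R).
Notation leb := (@lebesgue_measure R).

Lemma tdotC n (x y : n.-tuple T) : tdot x y = tdot y x.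
Proof. by apply: eq_bigr => i _; rewrite mulrC. Qed.

Lemma tdotDr n (x y z : n.-tuple T) : tdot x (tadd y z) = tdot x y + tdot x z.
Proof. by rewrite -big_split; apply: eq_bigr => i _; rewrite !tnthE mulrDr. Qed.

Lemma tdotZr n a (x y : n.-tuple T) : tdot x (tscale a y) = a * tdot x y.
Proof. by rewrite /tdot mulr_sumr; apply: eq_bigr => i _; rewrite !tnthE mulrCA. Qed.

Lemma tdotDl n (x y z : n.-tuple T) : tdot (tadd y z) x = tdot y x + tdot z x.
Proof. by rewrite !(tdotC _ x) tdotDr. Qed.

Lemma tdotZl n a (x y : n.-tuple T) : tdot (tscale a y) x = a * tdot y x.
Proof. by rewrite !(tdotC _ x) tdotZr. Qed.

Lemma tdot_ge0 n (x : n.-tuple T) : 0 <= tdot x x.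
Proof. by apply: sumr_ge0 => i _; rewrite -expr2 sqr_ge0. Qed.

Lemma tnth_sqr_le_tdot n (x : n.-tuple T) i : tnth x i ^+ 2 <= tdot x x.
Proof.
rewrite /tdot (bigD1 i)//= -expr2 lerDl; apply: sumr_ge0 => j _.
by rewrite -expr2 sqr_ge0.
Qed.

Lemma tdot_cons n (t : T) (y : n.-tuple T) :
  tdot (tuple_cons (t, y)) (tuple_cons (t, y)) = t ^+ 2 + tdot y y.
Proof.
rewrite /tdot big_ord_recl expr2; congr (_ + _).
by apply: eq_bigr => i _; rewrite !tnth_consS.
Qed.

Lemma integral_isometry n (H : n.-tuple T -> n.-tuple T) (f : n.-tuple T -> \bar R) :
  measurable_fun setT H ->
  (forall x y, H (tadd x y) = tadd (H x) (H y)) ->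
  (forall a x, H (tscale a x) = tscale a (H x)) ->
  involutive H -> (forall x, tdot (H x) (H x) = tdot x x) ->
  measurable_fun setT f ->
  (\int[borel_lebesgue R n]_x f (H x) = \int[borel_lebesgue R n]_x f x)%E.
Proof.
move=> mH HD HZ HK Hiso mf; rewrite integralE [RHS]integralE.
rewrite -[fun x => f (H x)]/(f \o H) funepos_comp funeneg_comp; congr (_ - _)%E.
- exact: (ge0_integral_isometry mH HD HZ HK Hiso (measurable_funepos mf)).
- exact: (ge0_integral_isometry mH HD HZ HK Hiso (measurable_funeneg mf)).
Qed.

(** Householder reflection. A single one moves a given vector onto the first axis, and being a
    linear involution it fits the invariance lemma. *)
Definition reflect n (v x : n.-tuple T) : n.-tuple T :=
  tadd x (tscale (- (2 / tdot v v * tdot v x)) v).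

(* With [1 / 0 = 0], reflection along [v = 0] is the identity. *)
Lemma reflect_coef n (v : n.-tuple T) :
  (2 / tdot v v) * (2 / tdot v v) * tdot v v = 2 * (2 / tdot v v).
Proof.
have [->|v0] := eqVneq (tdot v v) 0; first by rewrite invr0 !mulr0.
by field.
Qed.

Lemma reflect_isometry n (v x : n.-tuple T) :
  tdot (reflect v x) (reflect v x) = tdot x x.
Proof.
rewrite /reflect !(tdotDl, tdotDr, tdotZl, tdotZr) (tdotC x v).
have := reflect_coef v; move: (2 / tdot v v) => k.
move: (tdot v v) (tdot v x) (tdot x x) => w u z kw; apply/eqP; rewrite -subr_eq0; apply/eqP.
transitivity ((k * k * w - 2 * k) * u ^+ 2); first by ring.
by rewrite kw subrr mul0r.
Qed.

Lemma reflectK n (v : n.-tuple T) : involutive (reflect v).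
Proof.
move=> x; apply: eq_from_tnth => i; rewrite !tnthE tdotDr tdotZr.
have := reflect_coef v; move: (2 / tdot v v) => k.
move: (tdot v v) (tdot v x) => w u kw.
apply/eqP; rewrite -subr_eq0; apply/eqP.
transitivity ((k * k * w - 2 * k) * u * tnth v i); first by ring.
by rewrite kw subrr !mul0r.
Qed.

Lemma reflectD n (v x y : n.-tuple T) :
  reflect v (tadd x y) = tadd (reflect v x) (reflect v y).
Proof. by apply: eq_from_tnth => i; rewrite !tnthE tdotDr; ring. Qed.

Lemma reflectZ n (v : n.-tuple T) a x : reflect v (tscale a x) = tscale a (reflect v x).
Proof. by apply: eq_from_tnth => i; rewrite !tnthE tdotZr; ring. Qed.

Lemma measurable_reflect n (v : n.-tuple T) : measurable_fun setT (reflect v).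
Proof.
apply: measurable_tadd => //; apply: measurable_mktuple => i.
apply: measurable_funM => //; apply: measurableT_comp => //.
by apply: measurable_funM => //; exact: measurable_tdot.
Qed.

Definition tnorm n (x : n.-tuple T) : R := Num.sqrt (tdot x x).

Lemma sqr_tnorm n (x : n.-tuple T) : tnorm x ^+ 2 = tdot x x.
Proof. by rewrite sqr_sqrtr// tdot_ge0. Qed.

Definition tfirst n (a : R) : n.+1.-tuple T := [tuple (if i == ord0 then a else 0) | i < n.+1].

Lemma tdot_tfirst n a (x : n.+1.-tuple T) : tdot x (tfirst n a) = tnth x ord0 * a.
Proof.
rewrite /tdot big_ord_recl tnth_mktuple eqxx big1 ?addr0// => i _.
by rewrite tnth_mktuple mulr0.
Qed.

(** The vector [v] is [x] minus [tnorm x] times the first basis vector, so the reflection exchanges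
    these two vectors of equal length. If [v = 0], then [x] already lies on the axis and the
    reflection is the identity. *)
Lemma exists_reflection n (x : n.+1.-tuple T) :
  exists v, forall y, tdot x (reflect v y) = tnorm x * tnth y ord0.
Proof.
pose v := tadd x (tfirst n (- tnorm x)); exists v => y.
have vy : tdot v y = tdot x y - tnorm x * tnth y ord0.
  by rewrite tdotDl (tdotC _ y) (tdotC _ y) tdot_tfirst (tdotC y); ring.
have vx : tdot v x = tdot x x - tnorm x * tnth x ord0.
  by rewrite tdotDl (tdotC (tfirst _ _)) tdot_tfirst; ring.
have vv : tdot v v = 2 * tdot v x.
  rewrite vx /v !(tdotDl, tdotDr) (tdotC (tfirst _ _) x) !tdot_tfirst.
  by rewrite tnth_mktuple eqxx -!sqr_tnorm; ring.
rewrite /reflect tdotDr tdotZr (tdotC x v).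
have [v0|v0] := eqVneq (tdot v v) 0.
  have vi i : tnth v i = 0.
    apply/eqP; rewrite -sqrf_eq0 eq_le sqr_ge0 andbT -v0.
    exact: tnth_sqr_le_tdot.
  have -> : tdot v x = 0 by rewrite /tdot big1// => i _; rewrite vi mul0r.
  rewrite mulr0 addr0; have : tdot v y = 0.
    by rewrite /tdot big1// => i _; rewrite vi mul0r.
  by rewrite vy => /eqP; rewrite subr_eq0 => /eqP.
have -> : tdot x y = tdot v y + tnorm x * tnth y ord0 by rewrite vy; ring.
have -> : tdot v x = tdot v v / 2 by rewrite vv; field.
by field.
Qed.

Definition tsymbol n (d : R) (x : n.-tuple T) : R := Num.max 0 (1 - tdot x x) `^ d.

Lemma tsymbol_ge0 n (d : R) (x : n.-tuple T) : 0 <= tsymbol d x.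
Proof. exact: powR_ge0. Qed.

Lemma measurable_tsymbol n (d : R) : measurable_fun setT (@tsymbol n d).
Proof.
apply: (measurableT_comp (@measurable_powR R d)).
by apply: measurable_maxr => //; apply: measurable_funB => //; exact: measurable_tdot.
Qed.

(** The symbol is at most 1 and supported in the unit ball, hence in a cube, whose volume
    [integral_tensor] provides. *)
Lemma tsymbol_le_prod n (d : R) (x : n.-tuple T) : 0 < d ->
  tsymbol d x <= \prod_(i < n) \1_(`[-1, 1]%classic : set R) (tnth x i).
Proof.
move=> d0; have [x1|x1] := ltP (tdot x x) 1; last first.
  rewrite /tsymbol max_l ?subr_le0// powR0 ?gt_eqF//.
  by apply: prodr_ge0 => i _; rewrite indicE ler0n.
rewrite big1 => [|i _]; last first.
  rewrite indicE mem_set//= in_itv/= -ler_norml -(@expr_le1 _ 2)// real_normK ?num_real//.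
  by rewrite (le_trans (tnth_sqr_le_tdot _ _))// ltW.
rewrite /tsymbol [leRHS](_ : 1 = 1 `^ d); last by rewrite powR1.
apply: ge0_ler_powR.
- exact: ltW.
- by rewrite nnegrE le_max lexx.
- by rewrite nnegrE.
- by rewrite ge_max ler01 gerBl tdot_ge0.
Qed.

Lemma integral_tsymbol_lty n (d : R) : 0 < d ->
  (\int[borel_lebesgue R n]_x (tsymbol d x)%:E < +oo)%E.
Proof.
move=> d0; have i2 : (\int[leb]_t (\1_(`[-1, 1]%classic : set R) t)%:E = 2%:E)%E.
  rewrite integral_indic//= setIT lebesgue_measure_itv/= lte_fin ifT; last lra.
  by rewrite -EFinB; congr (_%:E); ring.
apply: (@le_lt_trans _ _ ((2 : R) ^+ n)%:E); last exact: ltry.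
have mi : measurable_fun setT (\1_(`[-1, 1]%classic : set R) : R -> R).
  exact: measurable_indic.
have i0 (t : R) : 0 <= \1_(`[-1, 1]%classic : set R) t :> R by rewrite indicE ler0n.
rewrite -(integral_tensor n mi i0 i2).
by apply: le_integral_nonmeasurable => x _;
  rewrite lee_fin ?tsymbol_ge0 ?tsymbol_le_prod.
Qed.

Lemma tsymbol_cons n (d : R) (t : T) (y : n.-tuple T) : 0 < d -> `|t| < 1 ->
  tsymbol d (tuple_cons (t, y)) =
  (1 - t ^+ 2) `^ d * tsymbol d (tscale (Num.sqrt (1 - t ^+ 2))^-1 y).
Proof.
move=> d0 t1; have u0 : 0 < 1 - t ^+ 2.
  by rewrite subr_gt0 -real_normK ?num_real// expr_lt1.
rewrite /tsymbol tdot_cons tdotZl tdotZr -powRM ?(ltW u0)//; last first.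
  by rewrite le_max lexx.
congr (_ `^ _); rewrite maxr_pMr ?(ltW u0)// mulr0; congr Num.max.
have -> : (Num.sqrt (1 - t ^+ 2))^-1 * ((Num.sqrt (1 - t ^+ 2))^-1 * tdot y y) =
    (Num.sqrt (1 - t ^+ 2) ^+ 2)^-1 * tdot y y.
  by rewrite expr2 invfM mulrA.
by rewrite sqr_sqrtr ?(ltW u0)//; field; rewrite gt_eqF.
Qed.

(** At height [t] the unit ball has a section of radius [Num.sqrt (1 - t ^+ 2)]. Rescaling it to
    radius 1 extracts the power [d] from the symbol and the power [n / 2] from the volume, whence
    the exponent of the profile. *)
Lemma integral_tsymbol_slice n (d : R) (t : R) : 0 < d ->
  (\int[borel_lebesgue R n]_y (tsymbol d (tuple_cons (t : T, y)))%:E =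
  (br_profile (d + n%:R / 2) t)%:E * \int[borel_lebesgue R n]_y (tsymbol d y)%:E)%E.
Proof.
move=> d0; have a0 : 0 < d + n%:R / 2 :> R by rewrite ltr_wpDr// divr_ge0.
have ms k : measurable_fun setT (fun y : k.-tuple T => (tsymbol d y)%:E).
  by apply/measurable_EFinP; exact: measurable_tsymbol.
have [t1|t1] := ltP `|t| 1; last first.
  have t2 : 1 <= t ^+ 2 by rewrite -real_normK ?num_real// expr_ge1.
  rewrite /br_profile max_l ?subr_le0// powR0 ?gt_eqF// mul0e.
  rewrite integral0_eq// => y _; rewrite /tsymbol max_l ?powR0 ?gt_eqF//.
  by rewrite subr_le0 tdot_cons (le_trans t2)// lerDl tdot_ge0.
have u0 : 0 < 1 - t ^+ 2.
  by rewrite subr_gt0 -real_normK ?num_real// expr_lt1.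
have su0 : 0 < Num.sqrt (1 - t ^+ 2) by rewrite sqrtr_gt0.
set s := Num.sqrt (1 - t ^+ 2) in su0 *.
have sV0 : 0 < s^-1 by rewrite invr_gt0.
have ts0 (y : n.-tuple T) : (0 <= (tsymbol d y)%:E)%E by rewrite lee_fin tsymbol_ge0.
have tE := ge0_integral_tscale sV0 (ms n) ts0.
transitivity (((1 - t ^+ 2) `^ d)%:E * ((s^-1 ^- n)%:E *
    \int[borel_lebesgue R n]_y (tsymbol d y)%:E))%E.
  rewrite -tE -ge0_integralZl//.
  - by apply: eq_integral => y _; rewrite tsymbol_cons// EFinM.
  - by apply: (measurableT_comp (ms n)); exact: measurable_tscale.
  - by rewrite lee_fin powR_ge0.
rewrite muleA -EFinM; congr (_%:E * _)%E.
rewrite /br_profile max_r ?(ltW u0)// powRD ?(gt_eqF u0) ?implybT//; congr (_ * _).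
have sE : s = (1 - t ^+ 2) `^ 2^-1 by rewrite powR12_sqrt// ltW.
have -> : s^-1 ^- n = s `^ n%:R by rewrite powR_mulrn ?(ltW su0)// exprVn invrK.
rewrite sE -powRrM.
by congr (_ `^ _); rewrite mulrC.
Qed.

Lemma br_profileN (a t : R) : br_profile a (- t) = br_profile a t.
Proof. by rewrite /br_profile sqrrN. Qed.

Lemma integral_br_profile_even (a : R) (h : R -> R) : 0 < a -> continuous h ->
  (forall t, 0 <= h t) -> (forall t, h (- t) = h t) ->
  (\int[leb]_t (br_profile a t * h t)%:E =
   (2 * \int[leb]_(t in `[0%R, 1%R]) (br_profile a t * h t))%:E)%E.
Proof.
move=> a0 ch h0 hN; have cw := @continuous_br_profile _ _ a0.
have cwh : continuous (fun t => br_profile a t * h t).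
  by move=> t; apply: cvgM; [exact: cw|exact: ch].
rewrite ge0_symfun_integralT//; last 2 first.
- by move=> t; rewrite mulr_ge0// br_profile_ge0.
- by move=> t /=; rewrite br_profileN hN.
rewrite [RHS]EFinM; congr (_ * _)%E.
have ifin := integrable_itvcc (continuous_subspaceT (A := `[0, 1]%classic : set R) cwh).
rewrite /Rintegral fineK; last exact: integrable_fin_num.
rewrite [LHS]integral_mkcond [RHS]integral_mkcond; apply: eq_integral => t _.
rewrite /patch; have [t0|t0] := ltP t 0.
  by rewrite !memNset//= ?in_itv/= leNgt t0.
rewrite (mem_set (A := [set x | 0 <= x]))//.
have [t1|t1] := leP t 1; first by rewrite mem_set//= in_itv/= t0.
rewrite [in RHS]memNset/=; last by rewrite in_itv/= t0/= leNgt t1.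
rewrite /br_profile max_l ?powR0 ?gt_eqF ?mul0r//.
by rewrite subr_le0 expr_ge1// ltW.
Qed.

Lemma integral_tsymbol_first n (d : R) (h : R -> R) : 0 < d -> continuous h ->
  (forall t, 0 <= h t) -> (forall t, h (- t) = h t) ->
  (\int[borel_lebesgue R n.+1]_x (tsymbol d x * h (tnth x ord0))%:E =
  (2 * fine (\int[borel_lebesgue R n]_y (tsymbol d y)%:E) *
   \int[leb]_(t in `[0%R, 1%R]) (br_profile (d + n%:R / 2) t * h t))%:E)%E.
Proof.
move=> d0 ch h0 hN; have a0 : 0 < d + n%:R / 2 :> R by rewrite ltr_wpDr// divr_ge0.
have mh : measurable_fun setT h by exact: continuous_measurable_fun.
rewrite ge0_integral_borel_lebesgueS; last 2 first.
- apply/measurable_EFinP; apply: measurable_funM; first exact: measurable_tsymbol.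
  by apply: (measurableT_comp mh); exact: measurable_tnth.
- by move=> x; rewrite lee_fin mulr_ge0// tsymbol_ge0.
set c := (\int[borel_lebesgue R n]_y (tsymbol d y)%:E)%E.
have c0 : (0 <= c)%E by apply: integral_ge0 => y _; rewrite lee_fin tsymbol_ge0.
have cE : c = (fine c)%:E by rewrite fineK// ge0_fin_numE// integral_tsymbol_lty.
transitivity (\int[leb]_t ((fine c)%:E * (br_profile (d + n%:R / 2) t * h t)%:E))%E.
  apply: eq_integral => t _; rewrite EFinM muleCA muleA -cE -/c.
  rewrite /c -integral_tsymbol_slice// -ge0_integralZr//; last 3 first.
  - by apply: (measurable_fun_consr t (f := fun x => (tsymbol d x)%:E)%E);
      apply/measurable_EFinP; exact: measurable_tsymbol.
  - by move=> y _; rewrite lee_fin tsymbol_ge0.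
  - by rewrite lee_fin.
rewrite ge0_integralZl//; last 3 first.
- apply/measurable_EFinP; apply: measurable_funM => //.
  by apply: continuous_measurable_fun; exact: continuous_br_profile.
- by move=> t _; rewrite lee_fin mulr_ge0// br_profile_ge0.
- by rewrite lee_fin fine_ge0.
by rewrite integral_br_profile_even// -EFinM; congr (_%:E); ring.
Qed.

(** The slicing formula is available for nonnegative functions only. It is applied to [1 + cos] and
    to 1, and the two finite results are subtracted. *)
Lemma integral_tsymbol_cos n (d s : R) : 0 < d ->
  (\int[borel_lebesgue R n.+1]_x (tsymbol d x * cos (s * tnth x ord0))%:E =
  (2 * fine (\int[borel_lebesgue R n]_y (tsymbol d y)%:E) *
   profile_cos (d + n%:R / 2) s)%:E)%E.
Proof.
move=> d0; have a0 : 0 < d + n%:R / 2 :> R by rewrite ltr_wpDr// divr_ge0.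
set a := d + _ in a0 *.
have c1 : continuous (fun t : R => 1 + cos (s * t)).
  by move=> t; apply: cvgD; [exact: cvg_cst|exact: continuous_cos_scale].
have c2 : continuous (fun t : R => 1 : R) by move=> t; exact: cvg_cst.
have h1 (t : R) : 0 <= 1 + cos (s * t) by have := cos_geN1 (s * t); lra.
have h1N (t : R) : 1 + cos (s * - t) = 1 + cos (s * t) by rewrite mulrN cosN.
have E1 := @integral_tsymbol_first n d _ d0 c1 h1 h1N.
have E2 := @integral_tsymbol_first n d _ d0 c2 (fun t => ler01) (fun t => erefl).
have mt := @measurable_tsymbol n.+1 d.
have mc : measurable_fun setT (fun x : n.+1.-tuple T => cos (s * tnth x ord0)).
  have mcos : measurable_fun setT (fun t : R => cos (s * t)).
    by apply: continuous_measurable_fun; exact: continuous_cos_scale.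
  by apply: (measurableT_comp mcos); exact: measurable_tnth.
have i1 : (borel_lebesgue R n.+1).-integrable setT
    (fun x => (tsymbol d x * (1 + cos (s * tnth x ord0)))%:E).
  apply/integrableP; split.
    by apply/measurable_EFinP; apply: measurable_funM => //; exact: measurable_funD.
  under eq_integral do rewrite gee0_abs ?lee_fin ?mulr_ge0 ?tsymbol_ge0//.
  by rewrite E1 ltry.
have i2 : (borel_lebesgue R n.+1).-integrable setT
    (fun x => (tsymbol d x * 1)%:E).
  apply/integrableP; split.
    by apply/measurable_EFinP; exact: measurable_funM.
  under eq_integral do rewrite gee0_abs ?lee_fin ?mulr_ge0 ?tsymbol_ge0//.
  by rewrite E2 ltry.
have cw := @continuous_br_profile _ _ a0.
transitivity (\int[borel_lebesgue R n.+1]_x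
   ((tsymbol d x * (1 + cos (s * tnth x ord0)))%:E - (tsymbol d x * 1)%:E))%E.
  by apply: eq_integral => x _; rewrite -EFinB; congr (_%:E); ring.
rewrite integralB//= E1 E2 -EFinB -mulrBr; congr (_ * _)%:E.
have cc (g : R -> R) : continuous g -> leb.-integrable `[0, 1]%classic
    (EFin \o (fun t => br_profile a t * g t)).
  move=> cg; apply: integrable_itvcc; apply: continuous_subspaceT => t.
  by apply: cvgM; [exact: cw|exact: cg].
rewrite -RintegralB//; [|exact: cc|exact: cc].
by apply: eq_Rintegral => t _; ring.
Qed.

(* By rotation invariance [x] may be replaced by [tnorm x] times the first basis vector. *)
Lemma integral_tsymbol_fourier_cos n (d : R) (x : n.+1.-tuple T) : 0 < d ->
  (\int[borel_lebesgue R n.+1]_y (tsymbol d y * cos (2 * pi * tdot x y))%:E =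
  (2 * fine (\int[borel_lebesgue R n]_y (tsymbol d y)%:E) *
   profile_cos (d + n%:R / 2) (2 * pi * tnorm x))%:E)%E.
Proof.
move=> d0; have [v vP] := exists_reflection x.
rewrite -integral_tsymbol_cos//.
have mf : measurable_fun setT
    (fun y : n.+1.-tuple T => (tsymbol d y * cos (2 * pi * tdot x y))%:E).
  apply/measurable_EFinP; apply: measurable_funM; first exact: measurable_tsymbol.
  have mcos : measurable_fun setT (fun t : R => cos (2 * pi * t)).
    by apply: continuous_measurable_fun; exact: continuous_cos_scale.
  by apply: (measurableT_comp mcos); exact: measurable_tdot.
rewrite -(integral_isometry (measurable_reflect v) (reflectD v) (reflectZ v)
  (@reflectK _ v) (reflect_isometry v) mf).
apply: eq_integral => y _; rewrite vP mulrA; congr (_ * _)%:E.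
by rewrite /tsymbol reflect_isometry.
Qed.

(** The integrand is integrable and odd, and the measure is invariant under the central symmetry.
    Consequently the kernel is real. *)
Lemma integral_tsymbol_fourier_sin n (d : R) (x : n.-tuple T) : 0 < d ->
  (\int[borel_lebesgue R n]_y (tsymbol d y * sin (2 * pi * tdot x y))%:E = 0)%E.
Proof.
move=> d0.
have mf : measurable_fun setT
    (fun y : n.-tuple T => (tsymbol d y * sin (2 * pi * tdot x y))%:E).
  apply/measurable_EFinP; apply: measurable_funM; first exact: measurable_tsymbol.
  have msin : measurable_fun setT (fun t : R => sin (2 * pi * t)).
    by apply: continuous_measurable_fun; exact: continuous_sin_scale.
  by apply: (measurableT_comp msin); exact: measurable_tdot.
set f := fun y : n.-tuple T => _ in mf *.
have fi : (borel_lebesgue R n).-integrable setT f.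
  apply/integrableP; split => //.
  apply: le_lt_trans (integral_tsymbol_lty n d0).
  apply: le_integral_nonmeasurable => y _ //.
  rewrite /f lee_fin normrM ger0_norm ?tsymbol_ge0// ler_piMr ?tsymbol_ge0//.
  by rewrite ler_norml sin_geN1 sin_le1.
have fN : (\int[borel_lebesgue R n]_y f y = - \int[borel_lebesgue R n]_y f y)%E.
  rewrite -{1}(@integral_isometry _ (tscale (-1)) f)//.
  - rewrite -integralN; last exact: integrable_add_def.
    apply: eq_integral => y _; rewrite /f /tsymbol tdotZl !tdotZr -EFinN.
    by congr (_%:E); rewrite !mulN1r opprK mulrN sinN mulrN.
  - exact: measurable_tscale.
  - by move=> u v; apply: eq_from_tnth => i; rewrite !tnthE; ring.
  - by move=> a v; apply: eq_from_tnth => i; rewrite !tnthE; ring.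
  - by move=> v; apply: eq_from_tnth => i; rewrite !tnthE; ring.
  - by move=> v; rewrite tdotZl tdotZr; ring.
move: fN; rewrite -(fineK (integrable_fin_num measurableT fi)) -EFinN => -[fN].
by congr (_%:E); lra.
Qed.

End kernel.

(** Tonelli's theorem gives measurability for the positive and negative parts, and the difference is
    measurable even at points where the integral diverges, so no integrability is assumed. *)
Lemma measurable_param_integral d1 d2 (X : measurableType d1) (Y : measurableType d2)
    (R : realType) (mu : {sigma_finite_measure set Y -> \bar R}) (f : X * Y -> R) :
  measurable_fun setT f ->
  measurable_fun setT (fun x => \int[mu]_y (f (x, y))%:E)%E.
Proof.
move=> mf; have mfE : measurable_fun setT (EFin \o f) by exact/measurable_EFinP.
rewrite (_ : (fun x => _) = fun x => (\int[mu]_y (EFin \o f)^\+ (x, y) -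
    \int[mu]_y (EFin \o f)^\- (x, y))%E); last first.
  apply/funext => x; rewrite integralE; congr (_ - _)%E.
    by apply: eq_integral => y _; rewrite !funeposE.
  by apply: eq_integral => y _; rewrite !funenegE.
apply: emeasurable_funB.
- by apply: measurable_fun_fubini_tonelli_F => //; exact: measurable_funepos.
- by apply: measurable_fun_fubini_tonelli_F => //; exact: measurable_funeneg.
Qed.

(** * Decay of the kernel and its integrable majorant *)

Section kernel_majorant.
Context (R : realType).
Notation T := (measurableTypeR R).
Notation leb := (@lebesgue_measure R).

Lemma powRN_le (x y a : R) : 0 < x -> x <= y -> 0 <= a -> y `^ (- a) <= x `^ (- a).
Proof.
move=> x0 xy a0; have y0 : 0 < y by exact: lt_le_trans xy.
rewrite !powRN lef_pV2 ?posrE ?powR_gt0//.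
by apply: ge0_ler_powR => //; rewrite nnegrE ltW.
Qed.

Lemma norm_profile_cos_le1 (a s : R) : 0 < a -> `|profile_cos a s| <= 1.
Proof.
move=> a0; have cw := @continuous_br_profile _ _ a0.
have ci (g : R -> R) : continuous g -> leb.-integrable `[0, 1]%classic
    (EFin \o (fun t => br_profile a t * g t)).
  move=> cg; apply: integrable_itvcc; apply: continuous_subspaceT => t.
  by apply: cvgM; [exact: cw|exact: cg].
have i1 := ci _ (@continuous_cos_scale _ s).
apply: le_trans (le_normr_Rintegral _ i1) _ => //.
apply: (@le_trans _ _ (\int[leb]_(t in `[0%R, 1%R]) (1 : R))).
  apply: le_Rintegral => //.
  - exact: (integrable_norm i1).
  - by apply: integrable_itvcc; apply: continuous_subspaceT => t; exact: cvg_cst.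
  move=> t /=; rewrite in_itv/= => /andP[t0 t1]; rewrite normrM.
  rewrite mulr_ile1 ?normr_ge0//; last by rewrite ler_norml cos_geN1 cos_le1.
  rewrite ger0_norm ?br_profile_ge0// /br_profile max_r ?subr_ge0 ?expr_le1//.
  rewrite [leRHS](_ : 1 = 1 `^ a); last by rewrite powR1.
  apply: ge0_ler_powR; rewrite ?nnegrE ?subr_ge0 ?expr_le1 ?(ltW a0)//.
  by rewrite gerBl sqr_ge0.
rewrite Rintegral_cst//= lebesgue_measure_itv/= lte_fin ltr01 oppr0 adde0/=.
by rewrite mul1r.
Qed.

Definition tsymbol_transform n (d : R) (x : n.-tuple T) : R :=
  fine (\int[borel_lebesgue R n]_y (tsymbol d y * cos (2 * pi * tdot x y))%:E)%E.

Lemma measurable_tsymbol_transform n (d : R) :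
  measurable_fun setT (@tsymbol_transform n d).
Proof.
apply: measurableT_comp => //.
apply: (@measurable_param_integral _ _ _ _ R (borel_lebesgue R n)
  (fun z : n.-tuple T * n.-tuple T => tsymbol d z.2 * cos (2 * pi * tdot z.1 z.2))).
apply: measurable_funM.
  exact: (measurableT_comp (@measurable_tsymbol _ n d) measurable_snd).
have mcos : measurable_fun setT (fun t : R => cos (2 * pi * t)).
  by apply: continuous_measurable_fun; exact: continuous_cos_scale.
apply: (measurableT_comp mcos).
by apply: measurable_tdot; [exact: measurable_fst|exact: measurable_snd].
Qed.

Lemma tsymbol_transform_decay n (d : R) : 0 < d -> exists2 M : R, 0 < M &
  forall x : n.+1.-tuple T, `|tsymbol_transform d x| <=
    M * (1 + tnorm x) `^ (- (d + n%:R / 2 + 1)).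
Proof.
move=> d0; have a0 : 0 < d + n%:R / 2 :> R by rewrite ltr_wpDr// divr_ge0.
set c := 2 * fine (\int[borel_lebesgue R n]_y (tsymbol d y)%:E)%E.
have c0 : 0 <= c.
  by rewrite mulr_ge0// fine_ge0// integral_ge0// => y _; rewrite lee_fin tsymbol_ge0.
have [M M0 MP] := profile_decay a0; set a := d + _ in a0 MP *.
exists (c * (M + 2 `^ (a + 1)) + 1) => [|x].
  by rewrite ltr_wpDl// mulr_ge0// addr_ge0// powR_ge0.
rewrite /tsymbol_transform integral_tsymbol_fourier_cos// -/c -/a.
rewrite -[fine _]/(c * profile_cos a (2 * pi * tnorm x)).
have x0 : 0 <= tnorm x by exact: sqrtr_ge0.
have x1 : 0 < 1 + tnorm x by rewrite ltr_pwDl.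
set P := _ `^ (- (a + 1)); have P0 : 0 <= P by exact: powR_ge0.
rewrite normrM ger0_norm// [leRHS]mulrDl mul1r.
apply: (@le_trans _ _ (c * (M + 2 `^ (a + 1)) * P)); last by rewrite lerDl.
rewrite -(mulrA c); apply: ler_wpM2l => //; rewrite [leRHS]mulrDl.
have pi1 : 1 <= pi :> R by apply: le_trans (pi_ge2 R); lra.
(* In the first case [1 + tnorm x <= 2 * pi * tnorm x], because [pi >= 1]; in the second [tnorm x]
   is below 1, so the weight is bounded from below and the trivial bound suffices. *)
have [s2|s2] := leP 2 (2 * pi * tnorm x).
  apply: (@le_trans _ _ (M * P)); last by rewrite lerDl mulr_ge0// powR_ge0.
  apply: le_trans (MP _ s2).1 _; apply: ler_wpM2l => //.
  rewrite /P -opprD; apply: powRN_le => //; last by rewrite addr_ge0// ltW.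
  have : 1 * tnorm x <= pi * tnorm x by apply: ler_wpM2r.
  lra.
apply: (@le_trans _ _ (2 `^ (a + 1) * P)); last by rewrite lerDr mulr_ge0.
apply: (le_trans (norm_profile_cos_le1 _ a0)).
rewrite [leLHS](_ : 1 = 2 `^ (a + 1) * 2 `^ (- (a + 1))); last first.
  by rewrite powRN mulfV// gt_eqF// powR_gt0.
apply: ler_wpM2l; first exact: powR_ge0.
apply: powRN_le => //; last by rewrite addr_ge0// ltW.
have : 1 * tnorm x <= pi * tnorm x by apply: ler_wpM2r.
lra.
Qed.

Lemma integral_powRN_lty (b : R) : 1 < b -> exists c : R,
  (\int[leb]_t ((1 + `|t|) `^ (- b))%:E = c%:E)%E.
Proof.
move=> b1; have b0 : 0 <= b by rewrite ltW// (lt_trans _ b1).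
have t0 (t : R) : 0 < 1 + `|t| by rewrite ltr_pwDl.
have ct : continuous (fun t : R => (1 + `|t|) `^ (- b)).
  rewrite (_ : (fun t => _) = fun t => (Num.max 0 (1 + `|t|) `^ b)^-1); last first.
    by apply/funext => t; rewrite powRN max_r// ltW.
  move=> t; apply: cvgV; first by rewrite max_r ?(ltW (t0 t))// gt_eqF// powR_gt0.
  apply: (@continuous_comp _ _ _ (fun t : R => 1 + `|t|) (fun x => Num.max 0 x `^ b)).
    by apply: cvgD; [exact: cvg_cst|exact: norm_continuous].
  by apply: continuous_powR_max; exact: lt_trans b1.
have f0 (t : R) : (0 <= ((1 + `|t|) `^ (- b))%:E)%E by rewrite lee_fin powR_ge0.
suff foo : (\int[leb]_t ((1 + `|t|) `^ (- b))%:E < +oo)%E.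
  exists (fine (\int[leb]_t ((1 + `|t|) `^ (- b))%:E)%E).
  by rewrite fineK// ge0_fin_numE// integral_ge0.
rewrite ge0_symfun_integralT//; last first.
  by move=> t /=; rewrite normrN.
rewrite lte_mul_pinfty//.
have -> : [set t : R | 0 <= t] = `[0, 1[%classic `|` `[1, +oo[%classic :> set R.
  apply/seteqP; split => t /=; rewrite !in_itv/= andbT.
    by move=> t1; have [?|?] := ltP t 1; [left; apply/andP|right].
  by move=> [/andP[]//|]; exact: le_trans.
rewrite ge0_integral_setU//=; last 2 first.
  by apply/measurable_EFinP; apply: measurable_funTS; exact: continuous_measurable_fun.
  apply/disj_set2P; apply/seteqP; split => t //=.
  by rewrite !in_itv/= andbT ltNge => -[/andP[_ /negbTE ->]].
rewrite lte_add_pinfty//.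
  apply: (@le_lt_trans _ _ (\int[leb]_(t in `[0%R, 1%R[) (cst 1%:E) t)%E).
    apply: le_integral_nonmeasurable => t _ //; rewrite lee_fin.
    rewrite [leRHS](_ : 1 = 1 `^ (- b)); last by rewrite powR1.
    by apply: powRN_le => //; rewrite lerDl.
  rewrite integral_cst//= lebesgue_measure_itv/= lte_fin ltr01 oppr0 adde0 mule1.
  exact: ltry.
apply: (@le_lt_trans _ _ (1 `^ (- (b - 1)) / (b - 1))%:E); last exact: ltry.
have := @integral_powR_nearoo_le R 1 (b - 1) ltr01.
rewrite subr_gt0 => /(_ b1); apply: le_trans.
apply: le_integral_nonmeasurable => t //=; rewrite in_itv/= andbT lee_fin => t1.
rewrite (_ : - (b - 1) - 1 = - b); last by ring.
have t00 : 0 < t by exact: lt_le_trans t1.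
by apply: powRN_le => //; rewrite gtr0_norm// lerDr.
Qed.

(** The decay exponent is shared equally among the coordinates, each of which is at most the norm in
    absolute value. The integral of the product then factorizes and no polar coordinates are
    needed. *)
Lemma tsymbol_transform_majorant n (d r : R) : 0 < d -> n%:R / 2 < d -> 0 < r ->
  exists (k : n.+1.-tuple T -> R) (kappa : R),
  [/\ measurable_fun setT k, forall x, 0 <= k x, 0 < kappa,
    (\int[borel_lebesgue R n.+1]_x (k x)%:E <= kappa%:E)%E &
    forall x, `|r ^- n.+1 * tsymbol_transform d (tscale r^-1 x)| <= k x].
Proof.
move=> d0 nd r0; have [M M0 MP] := tsymbol_transform_decay n d0.
set a := d + n%:R / 2 + 1 in MP.
(* The critical index enters here: [n / 2 < d] says exactly that the decay exponent exceeds the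
   dimension [n.+1]. *)
have a1 : n.+1%:R < a by rewrite /a -natr1; lra.
pose b := a / n.+1%:R; have b1 : 1 < b by rewrite ltr_pdivlMr// mul1r.
pose phi (t : R) := (1 + `|t|) `^ (- b).
have phi0 t : 0 <= phi t by exact: powR_ge0.
have mphi : measurable_fun setT phi.
  by apply: (measurableT_comp (measurable_powR _)); exact: measurable_funD.
have [c cE] := integral_powRN_lty b1.
pose g (x : n.+1.-tuple T) := \prod_(i < n.+1) phi (tnth x i).
have mg : measurable_fun setT g.
  apply: measurable_prod => i _; apply: (measurableT_comp mphi).
  exact: measurable_tnth.
have g0 x : 0 <= g x by exact: prodr_ge0.
have gP x : (1 + tnorm x) `^ (- a) <= g x.
  have -> : - a = - b * n.+1%:R by rewrite /b mulNr divfK.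
  rewrite powRrM powR_mulrn ?powR_ge0// -[X in _ ^+ X](card_ord n.+1).
  rewrite -prodr_const; apply: ler_prod => i _; rewrite powR_ge0/=.
  apply: powRN_le; last by rewrite (le_trans _ (ltW b1)).
  - by rewrite ltr_pwDl.
  - rewrite lerD2l -(@ler_pXn2r _ 2) ?nnegrE ?sqrtr_ge0//.
    by rewrite sqr_tnorm real_normK ?num_real// tnth_sqr_le_tdot.
have rV0 : 0 < r^-1 by rewrite invr_gt0.
have mgr : measurable_fun setT (fun x : n.+1.-tuple T => g (tscale r^-1 x)).
  by apply: (measurableT_comp mg); exact: measurable_tscale.
(* Substituting the dilation cancels [r ^- n.+1], so [kappa] does not involve [r]; the added 1
   ensures [0 < kappa]. *)
exists (fun x => r ^- n.+1 * M * g (tscale r^-1 x)), (M * c ^+ n.+1 + 1).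
have rn0 : 0 <= r ^- n.+1 by rewrite invr_ge0 exprn_ge0// ltW.
have c0 : 0 <= c.
  by rewrite -lee_fin -cE integral_ge0// => t _; rewrite lee_fin powR_ge0.
split.
- exact: measurable_funM.
- by move=> x; rewrite !mulr_ge0// ltW.
- by rewrite ltr_wpDl// mulr_ge0 ?exprn_ge0// ltW.
- under eq_integral do rewrite EFinM.
  rewrite ge0_integralZl//; last 3 first.
  - exact/measurable_EFinP.
  - by move=> x _; rewrite lee_fin.
  - by rewrite lee_fin mulr_ge0// ltW.
  rewrite (ge0_integral_tscale (f := fun x => (g x)%:E))//; last exact/measurable_EFinP.
  rewrite (integral_tensor n.+1 mphi phi0 cE) -!EFinM lee_fin.
  rewrite [leLHS](_ : _ = M * c ^+ n.+1) ?lerDl//.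
  rewrite exprVn invrK; field.
  by rewrite expf_neq0// gt_eqF.
- move=> x; rewrite normrM ger0_norm// -mulrA; apply: ler_wpM2l => //.
  apply: le_trans (MP _) _; apply: ler_wpM2l; first exact: ltW.
  exact: gP.
Qed.

End kernel_majorant.

(** * Borel representatives *)

Section completion.
Local Open Scope ereal_scope.
Context d (T : measurableType d) (R : realType).
Context (mu : {sigma_finite_measure set T -> \bar R}).
Notation cT := (caratheodory_type (mu_ext mu)).
Notation cmu := (@completed_measure_extension _ _ _ mu).

Lemma measurable_completion (A : set T) : measurable A -> measurable (A : set cT).
Proof. exact: caratheodory_measurable_mu_ext. Qed.

Lemma completionE (A : set T) : measurable A -> cmu A = mu A.
Proof. exact: measurable_mu_extE. Qed.

Lemma measurable_fun_completion d' (Y : measurableType d') (f : T -> Y) :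
  measurable_fun setT f -> measurable_fun setT (f : cT -> Y).
Proof.
move=> mf _ B mB; apply: measurable_completion.
exact: mf.
Qed.

(** The identity from the completed space to the Borel space is measurable and pushes the completed
    measure forward to [mu]. *)
Lemma ge0_integral_completion (f : T -> \bar R) :
  measurable_fun setT f -> (forall x, 0 <= f x) ->
  \int[cmu]_x f x = \int[mu]_x f x.
Proof.
move=> mf f0; have mid : measurable_fun setT (id : cT -> T).
  by apply: measurable_fun_completion; exact: measurable_id.
transitivity (\int[pushforward cmu (id : cT -> T)]_x f x).
  by rewrite (ge0_integral_pushforward mid).
by apply: eq_measure_integral => A mA _; exact: completionE.
Qed.

Lemma integral_completion (f : T -> \bar R) :
  measurable_fun setT f -> \int[cmu]_x f x = \int[mu]_x f x.
Proof.
move=> mf; rewrite integralE [RHS]integralE; congr (_ - _).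
  by apply: (@ge0_integral_completion (f^\+)) => //; exact: measurable_funepos.
by apply: (@ge0_integral_completion (f^\-)) => //; exact: measurable_funeneg.
Qed.

(** The outer measure is an infimum over countable measurable covers; intersecting the unions of
    covers that are optimal up to [n.+1%:R^-1] attains it. *)
Lemma completion_hull (E : set T) : cmu E < +oo ->
  exists B : set T, [/\ measurable B, E `<=` B & mu B = cmu E].
Proof.
move=> Eoo; have cover n : exists2 A : (set T)^nat, measurable_cover E A &
    \sum_(0 <= k <oo) mu (A k) < cmu E + n.+1%:R^-1%:E.
  have : cmu E \is a fin_num by rewrite ge0_fin_numE.
  have n0 : (0 < n.+1%:R^-1 :> R)%R by rewrite invr_gt0.
  by move/lb_ereal_inf_adherent => /(_ _ n0)[_/= [A EA] <-] ?; exists A.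
pose A n := projT1 (cid2 (cover n)).
have mA n : measurable_cover E (A n) by rewrite /A; case: cid2.
have muA n : \sum_(0 <= k <oo) mu (A n k) < cmu E + n.+1%:R^-1%:E.
  by rewrite /A; case: cid2.
pose F n := \bigcup_k A n k.
have mF n : measurable (F n).
  by apply: bigcupT_measurable => k; have [+ _] := mA n; apply.
have EF n : E `<=` F n by have [_] := mA n.
have muF n : mu (F n) <= \sum_(0 <= k <oo) mu (A n k).
  by apply: measure_sigma_subadditive => // k; have [+ _] := mA n; apply.
have mB : measurable (\bigcap_n F n) by exact: bigcapT_measurable.
exists (\bigcap_n F n); split => //; first by move=> x Ex n _; exact: EF.
apply/eqP; rewrite eq_le; apply/andP; split; last first.
  by rewrite -completionE// le_outer_measure// => x Ex n _; exact: EF.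
apply/lee_addgt0Pr => /= _/posnumP[e]; near \oo => n.
apply: (@le_trans _ _ (mu (F n))).
  by apply: le_measure; rewrite ?inE//; exact: bigcap_inf.
rewrite (le_trans (muF n))// (le_trans (ltW (muA n)))// leeD// lee_fin ltW//.
by near: n; apply: near_infty_natSinv_lt.
Unshelve. all: by end_near. Qed.

Lemma completion_measurable_ae (E : set T) : measurable (E : set cT) ->
  exists B N : set T, [/\ measurable B, measurable N, mu N = 0 &
    forall x, ~ N x -> (E x <-> B x)].
Proof.
move=> mE; have /sigma_finiteP[F [TF _ Ffin]] := sigma_finiteT mu.
have mF i : measurable (F i : set cT).
  by apply: measurable_completion; have [] := Ffin i.
have mEF i : measurable (E `&` F i : set cT) by exact: measurableI.
have EFoo i : cmu (E `&` F i) < +oo.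
  apply: (@le_lt_trans _ _ (cmu (F i))).
    by apply: le_outer_measure; exact: subIsetr.
  by have [mFi muFi] := Ffin i; rewrite completionE.
have hull i : exists BN : set T * set T, [/\ measurable BN.1, measurable BN.2,
    mu BN.2 = 0, E `&` F i `<=` BN.1 & BN.1 `\` (E `&` F i) `<=` BN.2].
  have [B [mB EB muB]] := completion_hull (EFoo i).
  (* Measurability of [E] is used here: additivity makes the excess of the finite-measure hull null,
     and a hull of that excess is a Borel null set. *)
  have muBE : cmu (B `\` (E `&` F i)) = 0.
    rewrite measureD//=; last 2 first.
    - exact: measurable_completion.
    - by rewrite completionE// muB.
    by rewrite setIidr// completionE// muB subee// ge0_fin_numE.
  have [|N [mN BN muN]] := @completion_hull (B `\` (E `&` F i)); first by rewrite muBE.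
  by exists (B, N); split => //=; rewrite muN.
pose H i := projT1 (cid (hull i)).
have HP i : [/\ measurable (H i).1, measurable (H i).2,
    mu (H i).2 = 0, E `&` F i `<=` (H i).1 & (H i).1 `\` (E `&` F i) `<=` (H i).2].
  by rewrite /H; case: cid.
exists (\bigcup_i (H i).1), (\bigcup_i (H i).2); split.
- by apply: bigcupT_measurable => i; have [] := HP i.
- by apply: bigcupT_measurable => i; have [] := HP i.
- apply/negligibleP.
    by apply: bigcupT_measurable => i; have [] := HP i.
  by apply: negligible_bigcup => i; exists (H i).2; have [_ ? ? _ _] := HP i; split.
move=> x Nx; split => [Ex|[i _ Hx]].
  have [i _ Fx] : (\bigcup_i F i) x by rewrite -TF.
  by exists i => //; have [_ _ _ + _] := HP i; apply.
have [_ _ _ _ HN] := HP i; apply: contrapT => Ex; apply: Nx; exists i => //.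
by apply: HN; split => // -[].
Qed.

(** Countably many superlevel sets, those at rational levels, determine a real function. Each is
    replaced by a Borel set, and the function is set to 0 on the union of the exceptional sets. *)
Lemma completion_measurable_fun_ae (f : T -> R) :
  measurable_fun setT (f : cT -> R) ->
  exists (g : T -> R) (N : set T), [/\ measurable_fun setT g, measurable N,
    mu N = 0 & forall x, ~ N x -> f x = g x].
Proof.
move=> mf; have lev (q : rat) : exists BN : set T * set T, [/\ measurable BN.1,
    measurable BN.2, mu BN.2 = 0 &
    forall x, ~ BN.2 x -> ((ratr q < f x)%R <-> BN.1 x)].
  have [|B [N [mB mN muN EB]]] := @completion_measurable_ae [set x | (ratr q < f x)%R].
    by rewrite -preimage_itvoy -[X in measurable X]setTI; exact: mf.
  by exists (B, N).
pose H q := projT1 (cid (lev q)).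
have HP q : [/\ measurable (H q).1, measurable (H q).2, mu (H q).2 = 0 &
    forall x, ~ (H q).2 x -> ((ratr q < f x)%R <-> (H q).1 x)].
  by rewrite /H; case: cid.
have mset (b : bool) : measurable [set _ : T | b].
  case: b; first by rewrite (_ : [set _ | _] = setT)//; apply/seteqP.
  by rewrite (_ : [set _ | _] = set0)//; apply/seteqP; split.
pose N := \bigcup_q (H q).2.
have mN : measurable N.
  by apply: bigcupT_measurable_rat => q; have [] := HP q.
exists (fun x => if x \in N then 0%R else f x), N; split => //.
- move=> _; apply: (measurability _ (RGenOInfty.measurableE R)) => //.
  move=> /= _ [_ [r ->] <-]; rewrite setTI preimage_itvoy.
  rewrite (_ : [set x | _] = (N `&` [set x | (r < 0)%R]) `|`
      ((\bigcup_(q : rat) ((H q).1 `&` [set x | (r <= ratr q)%R])) `\` N)).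
    apply: measurableU; first by apply: measurableI => //; exact: mset.
    apply: measurableD => //; apply: bigcupT_measurable_rat => q.
    apply: measurableI; first by have [] := HP q.
    exact: mset.
  apply/seteqP; split => x /=.
    case: ifPn => [|] xN.
      by left; split => //; exact: set_mem.
    move=> /rat_in_itvoo[q]; rewrite inE/= => /itvP rq; right.
    move: xN; rewrite notin_setE => xN; split => //; exists q => //.
    split; last by rewrite /= ltW// rq.
    by have [_ _ _ <-] := HP q; [rewrite rq|move=> Hx; apply: xN; exists q].
  move=> [[Nx r0]|[[q _ [Hx rq]] Nx]].
    by rewrite mem_set.
  rewrite memNset//; apply: (le_lt_trans rq).
  by have [_ _ _ ->] := HP q => // Hx'; apply: Nx; exists q.
- have : mu.-negligible (\bigcup_k (if unpickle k is Some q then (H q).2 else set0)).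
    apply: negligible_bigcup => k; case: (unpickle k) => [q|].
      by exists (H q).2; have [? ? ? _] := HP q; split.
    exact: negligible_set0.
  move=> /negligibleS NB; apply/negligibleP => //; apply: NB => x [q _ Hx].
  by exists (pickle q); [exact: I|rewrite pickleK].
by move=> x Nx; rewrite memNset.
Qed.

End completion.

(** * Convolution with a nonnegative kernel *)

(* The library declares [\x] sigma-finite, but its instance for subprobability
   measures hides that declaration. *)
Section sigma_finite_product.
Context (R : realType) d1 d2 (T1 : measurableType d1) (T2 : measurableType d2).
Context (m1 : {sigma_finite_measure set T1 -> \bar R})
  (m2 : {sigma_finite_measure set T2 -> \bar R}).

Definition sigma_finite_product : set (T1 * T2) -> \bar R := (m1 \x m2)%E.

HB.instance Definition _ := Measure.on sigma_finite_product.

Let sigma_finite_productP : sigma_finite setT sigma_finite_product.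
Proof.
have /sigma_finiteP[F [TF ndF finF]] := sigma_finiteT m1.
have /sigma_finiteP[G [TG ndG finG]] := sigma_finiteT m2.
exists (fun k => F k `*` G k) => [|k]; last first.
  have [mF Foo] := finF k; have [mG Goo] := finG k; split; first exact: measurableX.
  by rewrite /sigma_finite_product product_measure1E// lte_mul_pinfty// ge0_fin_numE.
apply/esym; rewrite -subTset => -[x y] _.
have [i _ Fx] : (\bigcup_k F k) x by rewrite -TF.
have [j _ Gy] : (\bigcup_k G k) y by rewrite -TG.
exists (maxn i j) => //; split.
  exact: (subsetPset _ _ (ndF _ _ (leq_maxl i j))).
exact: (subsetPset _ _ (ndG _ _ (leq_maxr i j))).
Qed.

HB.instance Definition _ := Measure_isSigmaFinite.Build _ _ _ sigma_finite_product
  sigma_finite_productP.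

End sigma_finite_product.

Section convolution.
Local Open Scope ereal_scope.
Context (R : realType) (n : nat).
Notation T := (n.-tuple (measurableTypeR R)).
Notation leb := (@lebesgue_measure R).
Notation lam := (@borel_lebesgue R n).

Definition tsub (x y : T) : T := tadd x (tscale (-1) y).

Lemma measurable_tsub d (X : measurableType d) (f g : X -> T) :
  measurable_fun setT f -> measurable_fun setT g ->
  measurable_fun setT (fun x => tsub (f x) (g x)).
Proof. by move=> mf mg; apply: measurable_tadd => //; exact: measurable_tscale. Qed.

Lemma ge0_integral_tsub (x : T) (f : T -> \bar R) :
  measurable_fun setT f -> (forall y, 0 <= f y) ->
  \int[lam]_y f (tsub x y) = \int[lam]_y f y.
Proof.
move=> mf f0; rewrite -[RHS](ge0_integral_tadd x mf f0).
rewrite -[RHS](@ge0_integral_isometry _ _ (tscale (-1)) (fun y => f (tadd y x)))//.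
- by apply: eq_integral => y _; rewrite /tsub taddC.
- exact: measurable_tscale.
- by move=> u v; apply: eq_from_tnth => i; rewrite !tnthE; ring.
- by move=> a v; apply: eq_from_tnth => i; rewrite !tnthE; ring.
- by move=> v; apply: eq_from_tnth => i; rewrite !tnthE; ring.
- by move=> v; rewrite tdotZl tdotZr; ring.
- by apply: (measurableT_comp mf); exact: measurable_tadd.
Qed.

Lemma le_poweR (e : R) (x y : \bar R) : (0 <= e)%R -> 0 <= x -> x <= y ->
  x `^ e <= y `^ e.
Proof.
by move=> e0 x0 xy; apply: gt0_ler_poweR => //; rewrite in_itv/= leey andbT// (le_trans x0).
Qed.

Context (h k : T -> R) (B : set T) (p q kappa A : R).
Context (mh : measurable_fun setT h) (h0 : forall x, (0 <= h x)%R).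
Context (mk : measurable_fun setT k) (k0 : forall x, (0 <= k x)%R).
Context (mB : measurable B) (p1 : (1 < p)%R) (q1 : (1 <= q)%R).
Context (kappa0 : (0 < kappa)%R) (A0 : (0 <= A)%R).
Context (intk : \int[lam]_y (k y)%:E <= kappa%:E).

(** Here the set [B] stays fixed and the function moves. The hypothesis [normd] asks for one bound
    [A] valid for all translates, which is how the Morrey norm will enter. *)
Let d (y : T) (m : R) := lam [set x | B x /\ (m < h (tsub x y))%R].

Context (normd : forall y,
  \int[leb]_(t in `]0%R, +oo[)
    (((t `^ p^-1)%:E * rearr (d y) t) `^ q * (t^-1)%:E) <= A%:E).

(** The translation is put on [h] and not on the kernel, so that this is a superposition of
    translates of [h] with weights [k y]. *)
Definition convolution_majorant (x : T) := \int[lam]_y (k y * h (tsub x y))%:E.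

(* Layer cake: integrating the indicator of [S] in the last variable gives back
   [h (tsub x y)] on [B], so that [weak_type_section] applies to [convolution_majorant]. *)
Let S : set (T * (T * measurableTypeR R)) :=
  [set z | B z.1 /\ (0 < z.2.2 /\ z.2.2 < h (tsub z.1 z.2.1))%R].

Let mS : measurable S.
Proof.
apply: measurableI.
  rewrite -[X in measurable X]setTI.
  exact: (@measurable_fst _ _ T (T * measurableTypeR R)%type measurableT B mB).
have m2 : measurable_fun setT (fun z : T * (T * measurableTypeR R) => z.2.2).
  exact: (measurableT_comp measurable_snd measurable_snd).
apply: measurableI; first exact: measurable_ltr_set.
apply: measurable_ltr_set => //; apply: (measurableT_comp mh).
apply: measurable_tsub; first exact: measurable_fst.
exact: (measurableT_comp measurable_fst measurable_snd).
Qed.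

Let ysectionS y m : ysection S (y, m) =
  if (0 < m)%R then [set x | B x /\ (m < h (tsub x y))%R] else set0.
Proof.
apply/seteqP; split => x; rewrite ysectionE/= /S/=.
  by move=> [Bx [-> ?]].
by case: ifPn => // m0 [].
Qed.

Let D z := lam (ysection S z).

Let mD : measurable_fun setT D.
Proof. exact: measurable_fun_ysection. Qed.

(* For [t > 0] this is the integral over [0, t] of the decreasing rearrangement of
   [x |-> h (tsub x y)] on [B]; the absolute value keeps the integrand nonnegative
   for all [t]. *)
Let W (y : T) (t : R) := \int[leb]_m mine `|t|%:E (D (y, m)).

Let mminD : measurable_fun setT (fun z : (T * measurableTypeR R) * measurableTypeR R =>
  mine `|z.1.2|%:E (D (z.1.1, z.2))).
Proof.
apply: measurable_mine.
  apply/measurable_EFinP; apply: measurableT_comp => //.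
  exact: (measurableT_comp measurable_snd measurable_fst).
apply: (measurableT_comp mD); apply: measurable_fun_pair => //.
exact: (measurableT_comp measurable_fst measurable_fst).
Qed.

Let minD0 (t : R) z : 0 <= mine `|t|%:E (D z).
Proof. by rewrite le_min lee_fin normr_ge0 measure_ge0. Qed.

Let mW : measurable_fun setT (fun z : T * measurableTypeR R => W z.1 z.2).
Proof.
by apply: (measurable_fun_fubini_tonelli_F (m2 := leb)
  (fun z : (T * measurableTypeR R) * measurableTypeR R =>
  mine `|z.1.2|%:E (D (z.1.1, z.2)))).
Qed.

Let W0 y t : 0 <= W y t. Proof. exact: integral_ge0. Qed.

(** The quotient of [W y t] by [t] is the averaged rearrangement of a translate, often written with
    two stars; it is superposed here with the weights [k y]. *)
Definition rearr_bound (t : R) := (t^-1)%:E * \int[lam]_y ((k y)%:E * W y t).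

Let dmono y a b : (0 < a)%R -> (a <= b)%R -> d y b <= d y a.
Proof.
move=> _ ab; apply: le_measure; rewrite ?inE.
- apply: measurableI => //; apply: measurable_ltr_set => //.
  by apply: (measurableT_comp mh); exact: measurable_tsub.
- apply: measurableI => //; apply: measurable_ltr_set => //.
  by apply: (measurableT_comp mh); exact: measurable_tsub.
by move=> x [Bx bx]; split => //; exact: le_lt_trans bx.
Qed.

Let Dd y m : (0 < m)%R -> D (y, m) = d y m.
Proof. by move=> m0; rewrite /D ysectionS m0. Qed.

Let hardyW y : \int[leb]_(t in `]0%R, +oo[)
    (((t `^ p^-1)%:E * ((t^-1)%:E * W y t)) `^ q * (t^-1)%:E) <=
  ((1 - p^-1)^-1 `^ q * A)%:E.
Proof.
have mDy : measurable_fun setT (fun m : measurableTypeR R => D (y, m)).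
  exact: (measurableT_comp mD (pair1_measurable y)).
pose w (s : R) := leb [set m | (0 < m)%R /\ s%:E < D (y, m)].
have mw : measurable_fun setT w.
  pose V : set (measurableTypeR R * measurableTypeR R) :=
    [set z | (0 < z.2)%R /\ z.1%:E < D (y, z.2)].
  have mV : measurable V.
    apply: measurableI; first exact: measurable_ltr_set.
    rewrite -[X in measurable X]setTI; apply: measurable_lte => //.
      by apply/measurable_EFinP; exact: measurable_fst.
    exact: (measurableT_comp mDy measurable_snd).
  rewrite (_ : w = leb \o xsection V); first exact: measurable_fun_xsection.
  by apply/funext => s; rewrite /w/= xsectionE.
have WE t : (0 < t)%R -> W y t = \int[leb]_(s in `]0%R, t[) w s.
  move=> t0; rewrite -(integral_min_superlevel t0 mDy)//.
  rewrite [RHS]integral_mkcond; apply: eq_integral => m _.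
  rewrite /patch (gtr0_norm t0); case: ifPn => //.
  rewrite notin_setE/= in_itv/= andbT => /negP; rewrite -leNgt => m0.
  by rewrite /D ysectionS ltNge m0/= measure0 min_r// lee_fin ltW.
have := hardy_inequality mw (fun s => measure_ge0 leb _) p1 q1.
rewrite (_ : \int[leb]_(t in `]0%R, +oo[) _ = \int[leb]_(t in `]0%R, +oo[)
    (((t `^ p^-1)%:E * ((t^-1)%:E * W y t)) `^ q * (t^-1)%:E)); last first.
  by apply: eq_integral => t; rewrite inE/= in_itv/= andbT => t0; rewrite WE.
move=> /le_trans; apply; rewrite EFinM; apply: lee_wpmul2l.
  by rewrite lee_fin powR_ge0.
apply: le_trans (normd y); apply: le_integral_nonmeasurable => s.
  rewrite /= in_itv/= andbT => s0.
  by rewrite mule_ge0 ?poweR_ge0// lee_fin invr_ge0 ltW.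
rewrite /= in_itv/= andbT => s0.
apply: lee_wpmul2r; first by rewrite lee_fin invr_ge0 ltW.
have ws : w s <= rearr (d y) s.
  rewrite /w (_ : [set m | _] = [set m | (0 < m)%R /\ s%:E < d y m]).
    apply: lebesgue_superlevel_le_rearr; first exact: dmono.
    rewrite (_ : [set m | _] = [set m | (0 < m)%R /\ s%:E < D (y, m)]).
      apply: measurableI; first exact: measurable_ltr_set.
      by rewrite -[X in measurable X]setTI; exact: emeasurable_fun_o_infty.
    by apply/seteqP; split => m /= [m0]; rewrite Dd.
  by apply/seteqP; split => m /= [m0]; rewrite Dd.
have w0 : 0 <= w s by exact: measure_ge0.
apply: le_poweR; first exact: le_trans q1.
  by rewrite mule_ge0// lee_fin powR_ge0.
by apply: lee_wpmul2l => //; rewrite lee_fin powR_ge0.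
Qed.


Lemma measurable_convolution_majorant : measurable_fun setT convolution_majorant.
Proof.
apply: (measurable_fun_fubini_tonelli_F (m2 := lam)
  (fun z : T * T => (k z.2 * h (tsub z.1 z.2))%:E)).
  apply/measurable_EFinP; apply: measurable_funM.
    exact: (measurableT_comp mk measurable_snd).
  apply: (measurableT_comp mh).
  by apply: measurable_tsub; [exact: measurable_fst|exact: measurable_snd].
by move=> z; rewrite lee_fin mulr_ge0.
Qed.

Let kY (z : T * measurableTypeR R) := (k z.1)%:E.

Let mkY : measurable_fun setT kY.
Proof. by apply/measurable_EFinP; exact: (measurableT_comp mk measurable_fst). Qed.

Let mindS x : measurable_fun setT (fun z : T * measurableTypeR R => (\1_S (x, z) : R)%:E).
Proof.
rewrite (_ : (fun z => _) = EFin \o \1_(xsection S x)); last first.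
  by apply/funext => z; rewrite /= !indicE mem_xsection.
by apply/measurable_EFinP; apply: measurable_indic; exact: measurable_xsection.
Qed.

Let layer_cake x : B x ->
  \int[lam \x leb]_z (kY z * (\1_S (x, z) : R)%:E) = convolution_majorant x.
Proof.
move=> Bx; rewrite (fubini_tonelli1 (fun z => kY z * (\1_S (x, z) : R)%:E)).
- apply: eq_integral => y _; rewrite /fubini_F /kY /=.
  have mxy : measurable_fun setT (fun m : measurableTypeR R => (\1_S (x, (y, m)) : R)%:E).
    exact: (measurableT_comp (mindS x) (pair1_measurable y)).
  rewrite ge0_integralZl ?lee_fin// EFinM; congr (_ * _).
  rewrite (_ : (fun m => _) = EFin \o \1_(`]0%R, h (tsub x y)[%classic : set R)).
    rewrite integral_indic//= setIT lebesgue_measure_itv/= lte_fin.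
    have := h0 (tsub x y); rewrite le_eqVlt => /predU1P[<-|->]; last by rewrite sube0.
    by rewrite ltxx.
  apply/funext => m /=; rewrite !indicE; congr (_%:R%:E); congr nat_of_bool.
  apply/idP/idP; rewrite !inE /S/= in_itv/=; first by move=> [_ /andP].
  by move=> /andP.
- by apply: emeasurable_funM.
- by move=> z; rewrite mule_ge0 ?lee_fin.
Qed.

(** The weak-type estimate with the pair of a translation and a level as parameter, and with a
    weight that ignores the level. Integrating the truncated section measures over the level gives
    [W y t]. *)
Lemma rearr_bound_weak (t m : R) : (0 < t)%R -> rearr_bound t < m%:E ->
  lam [set x | B x /\ m%:E < convolution_majorant x] <= t%:E.
Proof.
move=> t0 tm.
have kY0 z : 0 <= kY z by rewrite lee_fin.
have : \int[lam \x leb]_z (kY z * mine t%:E (lam (ysection S z))) < (t * m)%:E ->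
    lam [set x | m%:E < \int[lam \x leb]_z (kY z * (\1_S (x, z))%:E)] <= t%:E.
  exact: (weak_type_section (nu := sigma_finite_product lam leb) mkY kY0 mS t0).
rewrite (fubini_tonelli1 (fun z => kY z * mine t%:E (lam (ysection S z)))); last 2 first.
- by apply: emeasurable_funM => //; apply: measurable_mine.
- by move=> z; rewrite mule_ge0// le_min lee_fin ltW//= measure_ge0.
rewrite /fubini_F /= (_ : \int[lam]_y _ = \int[lam]_y ((k y)%:E * W y t)); last first.
  apply: eq_integral => y _; rewrite /W /kY/= (gtr0_norm t0) ge0_integralZl//.
  - apply: measurable_mine => //.
    exact: (measurableT_comp mD (pair1_measurable y)).
  - by move=> m' _; rewrite le_min lee_fin ltW//= measure_ge0.
  - by rewrite lee_fin.
have -> : \int[lam]_y ((k y)%:E * W y t) = t%:E * rearr_bound t.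
  by rewrite /rearr_bound muleA -EFinM divff ?gt_eqF// mul1e.
rewrite EFinM lte_pmul2l ?lte_fin// => /(_ tm); apply: le_trans.
apply: le_measure; rewrite ?inE.
- apply: measurableI => //; rewrite -[X in measurable X]setTI.
  exact: (emeasurable_fun_o_infty _ measurable_convolution_majorant).
- rewrite -[X in measurable X]setTI; apply: emeasurable_fun_o_infty => //.
  pose g (z : T * (T * measurableTypeR R)) := kY z.2 * (\1_S z : R)%:E.
  apply: (measurable_fun_fubini_tonelli_F (m2 := sigma_finite_product lam leb) g).
    apply: emeasurable_funM; first exact: (measurableT_comp mkY measurable_snd).
    by apply/measurable_EFinP; exact: measurable_indic.
  by move=> z; rewrite mule_ge0 ?lee_fin.
by move=> x [Bx mx] /=; rewrite layer_cake.
Qed.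

Lemma rearr_bound_integral :
  \int[leb]_(t in `]0%R, +oo[)
    (((t `^ p^-1)%:E * rearr_bound t) `^ q * (t^-1)%:E) <=
  (((1 - p^-1)^-1 * kappa) `^ q * A)%:E.
Proof.
(* The inverse of [t] is written as a power so that joint measurability on the whole line follows
   from that of powers; on positive [t] the two agree. *)
pose V (y : T) (t : R) := ((t `^ p^-1)%:E * ((t `^ (-1))%:E * W y t)) `^ q.
have V0 y t : 0 <= V y t by exact: poweR_ge0.
have mpow (e : R) : measurable_fun setT (fun z : T * measurableTypeR R => (z.2 `^ e)%:E).
  apply/measurable_EFinP; apply: (measurableT_comp (measurable_powR e)).
  exact: measurable_snd.
have mV : measurable_fun setT (fun z : T * measurableTypeR R => V z.1 z.2).
  apply: (measurableT_comp (measurable_poweR q)); apply: emeasurable_funM => //.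
  exact: emeasurable_funM.
pose G (z : T * measurableTypeR R) :=
  kY z * (V z.1 z.2 * (z.2 `^ (-1) * \1_(`]0%R, +oo[%classic : set R) z.2)%:E).
have mG : measurable_fun setT G.
  apply: emeasurable_funM => //; apply: emeasurable_funM => //.
  rewrite [X in measurable_fun _ X](_ : _ = (fun z : T * measurableTypeR R =>
    (z.2 `^ (-1))%:E * (\1_(`]0%R, +oo[%classic : set R) z.2)%:E)) //.
  apply: emeasurable_funM => //; apply/measurable_EFinP.
  apply: (measurableT_comp _ measurable_snd).
  exact: measurable_indic.
have G0 z : 0 <= G z.
  rewrite /G !mule_ge0 ?lee_fin//.
  by rewrite mulr_ge0 ?powR_ge0// indicE ler0n.
pose c := (kappa `^ (q - 1))%R.
have step t : (0 < t)%R ->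
    ((t `^ p^-1)%:E * rearr_bound t) `^ q * (t^-1)%:E <=
    c%:E * \int[lam]_y G (y, t).
  move=> t0.
  have mWt : measurable_fun setT (fun y => W y t).
    exact: (measurableT_comp mW (pair2_measurable t)).
  have mVt : measurable_fun setT (fun y => (t `^ p^-1)%:E * ((t `^ (-1))%:E * W y t)).
    by apply: emeasurable_funM => //; exact: emeasurable_funM.
  have tV : (t `^ (-1) = t^-1)%R by rewrite powR_inv1// ltW.
  have mkE : measurable_fun setT (fun y => (k y)%:E) by exact/measurable_EFinP.
  have k0E y : setT y -> 0 <= (k y)%:E by rewrite lee_fin.
  have U0 y : setT y -> 0 <= (t `^ p^-1)%:E * ((t `^ (-1))%:E * W y t).
    by move=> _; rewrite !mule_ge0 ?lee_fin ?powR_ge0.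
  have := jensen_poweR measurableT kappa0 q1 mkE mVt k0E U0 intk.
  rewrite (_ : \int[lam]_y ((k y)%:E * _) = (t `^ p^-1)%:E * rearr_bound t); last first.
    rewrite /rearr_bound tV muleA -EFinM -ge0_integralZl//.
    - apply: eq_integral => y _; rewrite EFinM !muleA; congr (_ * _).
      by rewrite -!EFinM; congr (_%:E); ring.
    - exact: emeasurable_funM.
    - by move=> y _; rewrite mule_ge0 ?lee_fin.
    - by rewrite lee_fin mulr_ge0 ?powR_ge0 ?invr_ge0 ?ltW.
  move=> H; apply: le_trans (lee_wpmul2r _ H) _.
    by rewrite lee_fin invr_ge0 ltW.
  rewrite -/c -muleA; apply: lee_wpmul2l; first by rewrite lee_fin powR_ge0.
  rewrite -ge0_integralZr//; last 3 first.
  - by apply: emeasurable_funM => //; exact: (measurableT_comp (measurable_poweR q)).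
  - by move=> y _; rewrite mule_ge0 ?lee_fin// poweR_ge0.
  - by rewrite lee_fin invr_ge0 ltW.
  rewrite le_eqVlt; apply/orP; left; apply/eqP; apply: eq_integral => y _.
  rewrite /G /kY/= indicE mem_set/= ?in_itv/= ?t0//.
  by rewrite mulr1 /V -muleA tV.
apply: (@le_trans _ _ (\int[leb]_(t in `]0%R, +oo[) (c%:E * \int[lam]_y G (y, t)))).
  apply: le_integral_nonmeasurable => t; rewrite /= in_itv/= andbT => t0.
    by rewrite mule_ge0 ?poweR_ge0// lee_fin invr_ge0 ltW.
  exact: step.
have mGt : measurable_fun setT (fun t : measurableTypeR R => \int[lam]_y G (y, t)).
  exact: (measurable_fun_fubini_tonelli_G (m1 := lam) G).
apply: (@le_trans _ _ (\int[leb]_t (c%:E * \int[lam]_y G (y, t)))).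
  apply: ge0_subset_integral => //.
  - exact: emeasurable_funM.
  - by move=> t _; rewrite mule_ge0 ?lee_fin ?powR_ge0// integral_ge0.
rewrite ge0_integralZl//; last 2 first.
- by move=> t _; exact: integral_ge0.
- by rewrite lee_fin powR_ge0.
rewrite -(fubini_tonelli (m1 := lam) (m2 := leb) G)//.
set b := ((1 - p^-1)^-1 `^ q * A)%R.
have b0 : (0 <= b)%R by rewrite mulr_ge0 ?powR_ge0.
apply: (@le_trans _ _ (c%:E * \int[lam]_y ((k y)%:E * b%:E))).
  apply: lee_wpmul2l; first by rewrite lee_fin powR_ge0.
  apply: le_integral_nonmeasurable => y _; first exact: integral_ge0.
  rewrite /G /kY/= ge0_integralZl//; last 3 first.
  - apply: emeasurable_funM; first exact: (measurableT_comp mV (pair1_measurable y)).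
    apply/measurable_EFinP; apply: measurable_funM; last exact: measurable_indic.
    exact: measurable_powR.
  - move=> t _; rewrite mule_ge0 ?lee_fin//.
    by rewrite mulr_ge0 ?powR_ge0// indicE ler0n.
  - by rewrite lee_fin.
  apply: lee_wpmul2l; first by rewrite lee_fin.
  apply: le_trans (hardyW y); rewrite [leRHS]integral_mkcond.
  rewrite le_eqVlt; apply/orP; left; apply/eqP; apply: eq_integral => t _.
  rewrite /patch indicE; case: ifPn => [|_]; last by rewrite mulr0 mule0.
  rewrite inE/= in_itv/= andbT => t0.
  by rewrite mulr1 /V powR_inv1// ltW.
rewrite ge0_integralZr ?lee_fin//; last 2 first.
- exact/measurable_EFinP.
- by move=> y _; rewrite lee_fin.
apply: (@le_trans _ _ (c%:E * (kappa%:E * b%:E))).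
  apply: lee_wpmul2l; first by rewrite lee_fin powR_ge0.
  by apply: lee_wpmul2r; rewrite ?lee_fin.
rewrite -!EFinM lee_fin powRM ?invr_ge0 ?(ltW kappa0)//.
rewrite /b /c [X in (_ * X * _)%R](_ : _ = kappa `^ (q - 1) * kappa)%R.
  by rewrite le_eqVlt; apply/orP; left; apply/eqP; ring.
  rewrite -[X in (_ * X)%R](powRr1 (ltW kappa0)) -powRD ?subrK//.
  by rewrite (gt_eqF kappa0) implybT.
by rewrite subr_ge0 invf_le1 ?ltW// (lt_trans _ p1).
Qed.

Let rearr_bound_ge0 t : (0 < t)%R -> 0 <= rearr_bound t.
Proof.
move=> t0; rewrite mule_ge0//; first by rewrite lee_fin invr_ge0 ltW.
by apply: integral_ge0 => y _; rewrite mule_ge0 ?lee_fin.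
Qed.

(** If the set had measure above some [e > 0], the weak estimate would fail at every finite level
    for [t <= e]. Hence [rearr_bound] would be infinite on []0, e]], against the finite bound of its
    weighted integral. *)
Lemma convolution_majorant_lty :
  lam [set x | B x /\ convolution_majorant x = +oo] = 0.
Proof.
set E := [set x | _].
have mE : measurable E.
  rewrite (_ : E = B `&` (convolution_majorant @^-1` [set +oo])).
    apply: measurableI => //; rewrite -[X in measurable X]setTI.
    exact: measurable_convolution_majorant.
  by apply/seteqP; split => x.
apply/eqP; rewrite eq_le measure_ge0 andbT leNgt; apply/negP => v0.
have [e e0 ev] : exists2 e, (0 < e)%R & e%:E < lam E.
  move: v0; case: (lam E) => [v v0|_|//].
    by exists (v / 2)%R; rewrite ?divr_gt0// lte_fin ltr_pdivrMr// ltr_pMr// ltr1n.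
  by exists 1%R; rewrite ?ltr01// ltry.
have oo t : (0 < t <= e)%R -> rearr_bound t = +oo.
  move=> /andP[t0 te]; apply/eqP; rewrite -leye_eq leNgt; apply/negP => foo.
  have fin : rearr_bound t \is a fin_num by rewrite ge0_fin_numE// rearr_bound_ge0.
  have : rearr_bound t < (fine (rearr_bound t) + 1)%:E.
    by rewrite EFinD fineK// lteDl// lte01.
  move=> /(rearr_bound_weak t0); rewrite leNgt => /negP; apply.
  apply: (@le_lt_trans _ _ e%:E); rewrite ?lee_fin//; apply: (lt_le_trans ev).
  apply: le_measure; rewrite ?inE//.
    apply: measurableI => //; rewrite -[X in measurable X]setTI.
    exact: (emeasurable_fun_o_infty _ measurable_convolution_majorant).
  by move=> x [Bx xoo]; split => //; rewrite xoo ltry.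
suff : +oo <= (((1 - p^-1)^-1 * kappa) `^ q * A)%:E by rewrite leye_eq.
apply: le_trans rearr_bound_integral.
have -> : +oo = \int[leb]_(t in `]0%R, e]) (cst +oo) t.
  rewrite integral_cst//=; rewrite lebesgue_measure_itv/= lte_fin e0 sube0.
  by rewrite gt0_mulye// lte_fin.
rewrite [leLHS]integral_mkcond [leRHS]integral_mkcond.
apply: le_integral_nonmeasurable => t _; rewrite /patch.
  by case: ifPn => _; [exact: leey|exact: lexx].
case: ifPn => [|_]; last first.
  case: ifPn => //; rewrite inE/= in_itv/= andbT => t0.
  by rewrite mule_ge0 ?poweR_ge0// lee_fin invr_ge0 ltW.
rewrite inE/= in_itv/= => /andP[t0 te]; rewrite ifT; last first.
  by rewrite inE/= in_itv/= t0.
rewrite oo ?t0// gt0_muley ?lte_fin ?powR_gt0// poweRyr.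
  by rewrite gt0_mulye// lte_fin invr_gt0.
by rewrite gt_eqF// (lt_le_trans _ q1).
Qed.

Lemma convolution_lorentz (G : T -> R) : measurable_fun setT G ->
  (forall x, B x -> (G x)%:E <= convolution_majorant x) ->
  \int[leb]_(t in `]0%R, +oo[)
    (((t `^ p^-1)%:E * rearr (fun m => lam [set x | B x /\ (m < G x)%R]) t) `^ q *
     (t^-1)%:E) <=
  (((1 - p^-1)^-1 * kappa) `^ q * A)%:E.
Proof.
move=> mG GB; apply: le_trans rearr_bound_integral.
apply: le_integral_nonmeasurable => t; rewrite /= in_itv/= andbT => t0.
  by rewrite mule_ge0 ?poweR_ge0// lee_fin invr_ge0 ltW.
apply: lee_wpmul2r; first by rewrite lee_fin invr_ge0 ltW.
apply: le_poweR; first exact: le_trans q1.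
  by rewrite mule_ge0 ?rearr_ge0// lee_fin powR_ge0.
apply: lee_wpmul2l; first by rewrite lee_fin powR_ge0.
(* The weak estimate needs a level strictly above [rearr_bound t], hence the slack [e]. *)
apply/lee_addgt0Pr => e e0.
have [foo|foo] := ltP (rearr_bound t) +oo; last first.
  by move: foo; rewrite leye_eq => /eqP ->; rewrite addye// leey.
have fin : rearr_bound t \is a fin_num by rewrite ge0_fin_numE// rearr_bound_ge0.
have rm : rearr_bound t < (fine (rearr_bound t) + e)%:E.
  by rewrite EFinD fineK// lteDl// lte_fin.
have r0 := fine_ge0 (rearr_bound_ge0 t0).
rewrite -[in leRHS](fineK fin) -EFinD.
move: (fine _) r0 rm => r r0 rm.
apply: ereal_inf_lbound; exists (r + e)%R => //; split; first by rewrite ltr_wpDl.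
apply: le_trans (rearr_bound_weak t0 rm); apply: le_measure; rewrite ?inE.
- by apply: measurableI => //; exact: measurable_ltr_set.
- apply: measurableI => //; rewrite -[X in measurable X]setTI.
  exact: (emeasurable_fun_o_infty _ measurable_convolution_majorant).
by move=> x [Bx Gx]; split => //; apply: lt_le_trans (GB _ Bx); rewrite lte_fin.
Qed.

End convolution.

(** * Lorentz-Morrey norms *)

Section transfer.
Context (R : realType) (n : nat).
Notation T := (n.-tuple (measurableTypeR R)).
Notation leb := (@lebesgue_measure R).
Notation lam := (@borel_lebesgue R n).
Notation lamC := (@lebesgue_Rn R n).

Lemma measurable_sqrtr : measurable_fun setT (Num.sqrt : R -> R).
Proof. by apply: continuous_measurable_fun; exact: sqrt_continuous. Qed.

Lemma subRn_tsub (x y : Rn R n) : subRn x y = tsub x y :> T.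
Proof. by apply: eq_from_tnth => i; rewrite !tnthE tnth_mktuple mulN1r. Qed.

Lemma measurable_ballRn (z : Rn R n) (rho : R) : measurable (ballRn z rho : set T).
Proof.
have -> : ballRn z rho = [set y : T | tnorm (tsub y z) < rho].
  by apply/seteqP; split => y; rewrite /ballRn/= subRn_tsub.
apply: measurable_ltr_set => //.
apply: (measurableT_comp measurable_sqrtr).
by apply: measurable_tdot; exact: measurable_tsub.
Qed.

Lemma ballRn_tsub (x y : T) (z : Rn R n) (rho : R) :
  ballRn (tsub z y : Rn R n) rho (tsub x y) = ballRn z rho x.
Proof.
rewrite /ballRn/= !subRn_tsub; congr (Num.sqrt (dotRn _ _) < rho);
  by apply: eq_from_tnth => i; rewrite !tnthE; ring.
Qed.

Lemma borel_lebesgue_tsub (y : T) (A : set T) : measurable A ->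
  lam [set x | A (tsub x y)] = lam A.
Proof.
move=> mA; have m1 : measurable_fun setT (fun x : T => (\1_A x : R)%:E).
  by apply/measurable_EFinP; exact: measurable_indic.
have mS : measurable [set x | A (tsub x y)].
  by rewrite -[X in measurable X]setTI; exact: measurable_tsub.
transitivity (\int[lam]_x (\1_A x)%:E)%E; last by rewrite integral_indic// setIT.
rewrite -(ge0_integral_tadd (tscale (-1) y) m1); last first.
  by move=> x; rewrite lee_fin indicE.
rewrite -[X in lam X]setIT -(integral_indic lam measurableT mS).
by apply: eq_integral => x _; rewrite !indicE.
Qed.

Lemma completion_null_eq (E : set (Rn R n)) (D N : set T) :
  measurable E -> measurable D -> measurable N -> lam N = 0%E ->
  (forall x, ~ N x -> (E x <-> D x)) -> lamC E = lam D.
Proof.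
move=> mE mD mN N0 ED; have mDc := measurable_completion lam mD.
have mNc := measurable_completion lam mN.
rewrite -(completionE lam mD); apply/eqP; rewrite eq_le; apply/andP; split.
- have := measureU2 lamC mDc mNc; rewrite [X in (_ + X)%E](completionE lam mN) N0 adde0.
  apply: le_trans; apply: le_measure; rewrite ?inE//; first exact: measurableU.
  move=> x Ex; have [Nx|Nx] := pselect (N x); [by right|left].
  by apply/ED.
- have := measureU2 lamC mE mNc; rewrite [X in (_ + X)%E](completionE lam mN) N0 adde0.
  apply: le_trans; apply: le_measure; rewrite ?inE//; first exact: measurableU.
  move=> x Ex; have [Nx|Nx] := pselect (N x); [by right|left].
  by apply/ED.
Qed.

Definition cabs (u v : T -> R) (x : T) : R := Normc.normc (Complex (u x) (v x)).

Lemma measurable_cabs (u v : T -> R) : measurable_fun setT u ->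
  measurable_fun setT v -> measurable_fun setT (cabs u v).
Proof.
move=> mu mv; apply: (measurableT_comp measurable_sqrtr).
by apply: measurable_funD; exact: measurable_funX.
Qed.

Lemma cabs_ge0 u v x : 0 <= cabs u v x. Proof. exact: sqrtr_ge0. Qed.

Lemma norm_le_cabs u v x : `|u x| <= cabs u v x /\ `|v x| <= cabs u v x.
Proof.
by rewrite /cabs /= -!sqrtr_sqr; split; apply: ler_wsqrtr; rewrite ?lerDl ?lerDr sqr_ge0.
Qed.

Lemma cabs_le_norm u v x : cabs u v x <= `|u x| + `|v x|.
Proof.
rewrite -(@ler_pXn2r _ 2) ?nnegrE ?cabs_ge0 ?addr_ge0// /cabs/= sqr_sqrtr ?addr_ge0 ?sqr_ge0//.
rewrite sqrrD !real_normK ?num_real// lerD2r lerDl mulrn_wge0// mulr_ge0//.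
Qed.

Definition borel_representative (f : Rn R n -> R[i]) (u v : T -> R) (N : set T) :=
  [/\ measurable_fun setT u, measurable_fun setT v, measurable N, lam N = 0%E &
    forall x, ~ N x -> f x = Complex (u x) (v x)].

Lemma exists_borel_representative (f : Rn R n -> R[i]) : cmeasurable f ->
  exists u v N, borel_representative f u v N.
Proof.
move=> [mRe mIm]; have [u [N [mu mN N0 uP]]] := completion_measurable_fun_ae mRe.
have [v [M [mv mM M0 vP]]] := completion_measurable_fun_ae mIm.
exists u, v, (N `|` M); split => //; first exact: measurableU.
  by apply/eqP; rewrite eq_le measure_ge0 andbT -[leRHS]adde0
    -[X in (_ <= X + _)%E]N0 -[X in (_ <= _ + X)%E]M0 measureU2.
move=> x NMx; rewrite -uP => [|?]; last by apply: NMx; left.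
rewrite -vP => [|?]; last by apply: NMx; right.
by case: (f x).
Qed.

(** Rearrangements see only the measures of level sets, which null sets do not change. Only positive
    levels occur, so the zeros that the cutoff puts outside the ball are not counted. *)
Lemma rearrangement_cutoff (f : Rn R n -> R[i]) u v N (z : Rn R n) (rho t : R) :
  cmeasurable f -> borel_representative f u v N ->
  rearrangement (cutoff f (ballRn z rho)) t =
  rearr (fun m => lam [set x | ballRn z rho x /\ m < cabs u v x]) t.
Proof.
move=> [mRe mIm] [mu mv mN N0 fP]; have mB := measurable_ballRn z rho.
have mf : measurable_fun setT (fun x => Normc.normc (f x)).
  rewrite (_ : (fun x => _) = fun x => Num.sqrt (complex.Re (f x) ^+ 2 + complex.Im (f x) ^+ 2)).
    apply: (measurableT_comp measurable_sqrtr).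
    by apply: measurable_funD; exact: measurable_funX.
  by apply/funext => x; case: (f x).
have mc := measurable_cabs mu mv.
suff E m : 0 < m -> lamC [set x | m < Normc.normc (cutoff f (ballRn z rho) x)] =
    lam [set x | ballRn z rho x /\ m < cabs u v x].
  rewrite /rearrangement /rearr; congr (ereal_inf (_ @` _)).
  by apply/seteqP; split => m /= [m0]; rewrite E.
move=> m0; have -> : [set x | m < Normc.normc (cutoff f (ballRn z rho) x)] =
    [set x | ballRn z rho x /\ m < Normc.normc (f x)].
  apply/seteqP; split => x /=; rewrite /cutoff.
    by case: ifPn => [|_]; rewrite ?inE// Normc.normc0 ltNge (ltW m0).
  by move=> [Bx mx]; rewrite mem_set.
apply: (completion_null_eq (N := N)) => //.
- apply: measurableI; first exact: (measurable_completion lam).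
  exact: (measurable_ltr_set (measurable_cst m) mf).
- by apply: measurableI => //; exact: measurable_ltr_set.
- by move=> x Nx /=; rewrite fP.
Qed.

(** The exceptional set lies in the integration variable, so the identities hold at every [x], not
    merely almost every [x]. This is why the convolution later has a Borel representative with empty
    exceptional set. *)
Lemma integral_borel_representative (K : T -> R) (f : Rn R n -> R)
    (u : T -> R) (N : set T) (x : T) :
  measurable_fun setT K -> measurable_fun setT f -> measurable_fun setT u ->
  measurable N -> lam N = 0%E -> (forall y, ~ N y -> f y = u y) ->
  let g := fun y : Rn R n => (K (tsub x y) * f y)%:E in
  measurable_fun setT g /\
  (\int[lamC]_y g y = \int[lam]_y (K (tsub x y) * u y)%:E)%E /\
  (\int[lamC]_y `|g y| = \int[lam]_y `|(K (tsub x y) * u y)%:E|)%E.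
Proof.
move=> mK mf mu mN N0 fu; set g := (X in let g := X in _); rewrite /=.
have mKx : measurable_fun setT (fun y => K (tsub x y)).
  by apply: (measurableT_comp mK); exact: measurable_tsub.
have mg : measurable_fun setT g.
  apply/measurable_EFinP; apply: measurable_funM; last exact: mf.
  exact: (@measurable_fun_completion _ _ _ lam _ _ _ mKx).
have mgu : measurable_fun setT (fun y => (K (tsub x y) * u y)%:E).
  by apply/measurable_EFinP; exact: measurable_funM.
have mguC := @measurable_fun_completion _ _ _ lam _ _ _ mgu.
have ae : ae_eq lamC setT g (fun y => (K (tsub x y) * u y)%:E).
  exists N; split.
  - exact: (measurable_completion lam).
  - by rewrite [LHS](completionE lam mN).
  - by move=> y /= gu; apply: contrapT => Ny; apply: gu => _; rewrite /g fu.
split => //; split.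
- rewrite -[RHS](integral_completion lam mgu).
  by apply: ae_eq_integral.
- rewrite -[RHS](integral_completion lam (f := fun y => `|(K (tsub x y) * u y)%:E|%E)); last first.
    exact: measurableT_comp.
  have m1 : measurable_fun setT (fun y : Rn R n => `|g y|%E) by exact: measurableT_comp.
  have m2 : measurable_fun setT (fun y : Rn R n => `|(K (tsub x y) * u y)%:E|%E).
    by apply: measurableT_comp; [|exact: mguC].
  apply: (ae_eq_integral (fun y : Rn R n => `|(K (tsub x y) * u y)%:E|%E)
    (fun y => `|g y|%E) measurableT m1 m2).
  by apply: filterS ae => y gu yT; exact: (congr1 abse (gu yT)).
Qed.

End transfer.

Section bochner_riesz.
Context (R : realType) (n : nat).
Notation T := (n.-tuple (measurableTypeR R)).
Notation leb := (@lebesgue_measure R).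
Notation lam := (@borel_lebesgue R n).
Notation lamC := (@lebesgue_Rn R n).

Lemma BR_symbolE (d : R) (x : Rn R n) : BR_symbol d x = tsymbol d (x : T).
Proof. by rewrite /BR_symbol /normRn sqr_sqrtr// sumr_ge0// => i _; rewrite -expr2 sqr_ge0. Qed.

(** Both parts of the complex integral pass to the Borel measure; the imaginary one is the vanishing
    sine transform. *)
Lemma BR_kernel_dilatedE (d r : R) (x : Rn R n) : 0 < d ->
  BR_kernel_dilated d r x = (r ^- n * tsymbol_transform d (tscale r^-1 (x : T)))%:C%C.
Proof.
move=> d0; set x' := tscale _ _.
have mcs (g : R -> R) : measurable_fun setT g -> measurable_fun setT
    (fun y : T => (tsymbol d y * g (2 * pi * tdot x' y))%:E).
  move=> mg; apply/measurable_EFinP; apply: measurable_funM; first exact: measurable_tsymbol.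
  by apply: (measurableT_comp mg); apply: measurable_funM => //; exact: measurable_tdot.
have E : BR_kernel d (scaleRn r^-1 x) = (tsymbol_transform d x')%:C%C.
  rewrite /BR_kernel /inverse_fourier /cintegral; congr Complex.
  - rewrite /Rintegral /tsymbol_transform; congr fine.
    rewrite -(integral_completion lam (mcs _ (continuous_measurable_fun (@continuous_cos R)))).
    by apply: eq_integral => y _; rewrite BR_symbolE /= mul0r subr0.
  - rewrite /Rintegral [RHS](_ : 0 = fine (0 : \bar R))//; congr fine.
    rewrite -(@integral_tsymbol_fourier_sin R n d x' d0).
    rewrite -(integral_completion lam (mcs _ (continuous_measurable_fun (@continuous_sin R)))).
    by apply: eq_integral => y _; rewrite BR_symbolE /= mul0r addr0.
by rewrite /BR_kernel_dilated E -rmorphM.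
Qed.

Lemma lorentz_norm_powR (p q : R) (f : Rn R n -> R[i]) : 0 < q ->
  ((lorentz_norm p q f) `^ q = \int[leb]_(t in `]0%R, +oo[)
     (((t `^ p^-1)%:E * rearrangement f t) `^ q * (t^-1)%:E))%E.
Proof.
move=> q0; rewrite /lorentz_norm -poweRrM mulVf ?gt_eqF// poweRe1//.
apply: integral_ge0 => t /=; rewrite in_itv/= andbT => t0.
by rewrite mule_ge0 ?poweR_ge0// lee_fin invr_ge0 ltW.
Qed.

Lemma lorentz_norm_ball_le (p q l : R) (f : Rn R n -> R[i]) (z : Rn R n) (rho : R) :
  0 < rho -> (lorentz_norm p q (cutoff f (ballRn z rho)) <=
    (rho `^ (l / p))%:E * lorentz_morrey_norm p q l f)%E.
Proof.
move=> rho0; have rp : 0 < rho `^ (l / p) by exact: powR_gt0.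
rewrite -lee_pdivrMl// -powRN.
by apply: ereal_sup_ubound; exists (z, rho).
Qed.

Lemma lorentz_morrey_norm_ge0 (p q l : R) (f : Rn R n -> R[i]) :
  (0 <= lorentz_morrey_norm p q l f)%E.
Proof.
have z : Rn R n := mkRn (fun=> 0).
apply: (@le_trans _ _ ((1 `^ (- (l / p)))%:E * lorentz_norm p q (cutoff f (ballRn z 1)))%E).
  by rewrite mule_ge0 ?lee_fin ?powR_ge0// poweR_ge0.
by apply: ereal_sup_ubound; exists (z, 1) => //=; exact: ltr01.
Qed.

End bochner_riesz.

(** * Convolution of a complex function with a dominated real kernel *)

Section complex_convolution.
Context (R : realType) (n : nat).
Notation T := (n.-tuple (measurableTypeR R)).
Notation leb := (@lebesgue_measure R).
Notation lam := (@borel_lebesgue R n).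
Notation lamC := (@lebesgue_Rn R n).

Context (K k : T -> R) (kappa : R).
Context (mK : measurable_fun setT K) (mk : measurable_fun setT k).
Context (k0 : forall x, 0 <= k x) (Kk : forall x, `|K x| <= k x).
Context (kappa0 : 0 < kappa) (intk : (\int[lam]_x (k x)%:E <= kappa%:E)%E).
Context (f : Rn R n -> R[i]) (u v : T -> R) (N : set T).
Context (mf : cmeasurable f) (fP : borel_representative f u v N).

Definition kernel_product (x y : Rn R n) : R[i] := (K (subRn x y))%:C%C * f y.

Let h := cabs u v.

Let Phi (x : T) : \bar R := (\int[lam]_y (k (tsub x y) * h y)%:E)%E.

Let mu : measurable_fun setT u. Proof. by case: fP. Qed.
Let mv : measurable_fun setT v. Proof. by case: fP. Qed.
Let mh : measurable_fun setT h. Proof. exact: measurable_cabs. Qed.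

Let kernel_productE x y : kernel_product x y =
  Complex (K (tsub x y) * complex.Re (f y)) (K (tsub x y) * complex.Im (f y)).
Proof.
rewrite /kernel_product subRn_tsub; case: (f y) => a b.
by apply/eqP; rewrite eq_complex /= !mul0r subr0 addr0 !eqxx.
Qed.

Let fRe y : ~ N y -> complex.Re (f y) = u y.
Proof. by case: fP => _ _ _ _ E /E ->. Qed.

Let fIm y : ~ N y -> complex.Im (f y) = v y.
Proof. by case: fP => _ _ _ _ E /E ->. Qed.

Let transfer_Re x := let: And5 _ _ mN N0 _ := fP in
  integral_borel_representative (x : T) mK mf.1 mu mN N0 fRe.

Let transfer_Im x := let: And5 _ _ mN N0 _ := fP in
  integral_borel_representative (x : T) mK mf.2 mv mN N0 fIm.

Let conv (w : T -> R) (x : T) : R := fine (\int[lam]_y (K (tsub x y) * w y)%:E)%E.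

Let measurable_conv w : measurable_fun setT w -> measurable_fun setT (conv w).
Proof.
move=> mw; apply: measurableT_comp => //.
apply: (@measurable_param_integral _ _ _ _ R lam
  (fun z : T * T => K (tsub z.1 z.2) * w z.2)).
apply: measurable_funM; last exact: (measurableT_comp mw measurable_snd).
apply: (measurableT_comp mK).
by apply: measurable_tsub; [exact: measurable_fst|exact: measurable_snd].
Qed.

Let mPhi_arg x : measurable_fun setT (fun y : T => (k (tsub x y) * h y)%:E).
Proof.
apply/measurable_EFinP; apply: measurable_funM => //.
by apply: (measurableT_comp mk); exact: measurable_tsub.
Qed.

Let abs_conv_le (w : T -> R) x : (forall y, `|w y| <= h y) ->
  (\int[lam]_y `|(K (tsub x y) * w y)%:E| <= Phi x)%E.
Proof.
move=> wh; apply: le_integral_nonmeasurable => y _; first exact: abse_ge0.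
by rewrite lee_fin normrM ler_pM.
Qed.

Let conv_le (w : T -> R) x : measurable_fun setT w -> (forall y, `|w y| <= h y) ->
  (`|conv w x|%:E <= Phi x)%E.
Proof.
move=> mw wh; apply: le_trans (abs_conv_le x wh).
apply: (@le_trans _ _ `|\int[lam]_y (K (tsub x y) * w y)%:E|%E).
  (* At an infinite integral [fine] returns 0, so the inequality is trivial there. *)
  by rewrite /conv; case: (integral _ _ _) => //=; rewrite normr0 leey.
apply: le_abse_integral => //; apply/measurable_EFinP; apply: measurable_funM => //.
by apply: (measurableT_comp mK); exact: measurable_tsub.
Qed.

Let uh y : `|u y| <= h y. Proof. exact: (norm_le_cabs u v y).1. Qed.
Let vh y : `|v y| <= h y. Proof. exact: (norm_le_cabs u v y).2. Qed.

Let majorantE x : convolution_majorant h (fun y => 2 * k y) x = (2%:E * Phi x)%E.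
Proof.
rewrite /convolution_majorant -(ge0_integral_tsub x); last 2 first.
- apply/measurable_EFinP; apply: measurable_funM; first exact: measurable_funM.
  by apply: (measurableT_comp mh); exact: measurable_tsub.
- by move=> y; rewrite lee_fin !mulr_ge0// cabs_ge0.
rewrite /Phi -ge0_integralZl//; last first.
  by move=> y _; rewrite lee_fin mulr_ge0// cabs_ge0.
apply: eq_integral => y _; rewrite -EFinM mulrA; congr (_ * h _)%:E.
by apply: eq_from_tnth => i; rewrite !tnthE; ring.
Qed.

Lemma cintegral_kernel_product x :
  cintegral (kernel_product x) = Complex (conv u x) (conv v x).
Proof.
rewrite /cintegral; congr Complex; rewrite /Rintegral /conv.
- rewrite -(transfer_Re x).2.1; congr fine.
  by apply: eq_integral => y _; rewrite kernel_productE.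
- rewrite -(transfer_Im x).2.1; congr fine.
  by apply: eq_integral => y _; rewrite kernel_productE.
Qed.

Lemma borel_representative_kernel_product :
  borel_representative (fun x => cintegral (kernel_product x)) (conv u) (conv v) set0.
Proof.
split; [exact: measurable_conv|exact: measurable_conv|exact: measurable0|exact: measure0|].
by move=> x _; exact: cintegral_kernel_product.
Qed.

Lemma cmeasurable_kernel_product : cmeasurable (fun x => cintegral (kernel_product x)).
Proof.
have mu' := measurable_conv mu; have mv' := measurable_conv mv.
split.
- rewrite (_ : (fun x => _) = conv u); last by apply/funext => x; rewrite cintegral_kernel_product.
  exact: (@measurable_fun_completion _ _ _ lam _ _ _ mu').
- rewrite (_ : (fun x => _) = conv v); last by apply/funext => x; rewrite cintegral_kernel_product.
  exact: (@measurable_fun_completion _ _ _ lam _ _ _ mv').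
Qed.

(** The modulus is at most the sum of the absolute values of the two components, each bounded by the
    same integral [Phi x]; this is the origin of the kernel [2 * k]. *)
Lemma cabs_kernel_product_le x :
  ((cabs (conv u) (conv v) x)%:E <= convolution_majorant h (fun y => 2 * k y)%R x)%E.
Proof.
rewrite majorantE; apply: (@le_trans _ _ (`|conv u x| + `|conv v x|)%:E).
  by rewrite lee_fin cabs_le_norm.
rewrite EFinD -[2]/(1 + 1)%R EFinD ge0_muleDl ?lee_fin// !mul1e.
by rewrite leeD// conv_le.
Qed.

Lemma cintegrable_kernel_product (x : T) :
  convolution_majorant h (fun y => 2 * k y) x <> +oo%E ->
  cintegrable (kernel_product x).
Proof.
move=> xoo; have Poo : (Phi x < +oo)%E.
  rewrite ltey; apply/eqP => Pxoo; apply: xoo; rewrite majorantE Pxoo.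
  by rewrite gt0_muley// lte_fin.
have [m1 [_ I1]] := transfer_Re x; have [m2 [_ I2]] := transfer_Im x.
split; apply/integrableP; split.
- by rewrite (_ : (fun y => _) = (fun y => (K (tsub x y) * complex.Re (f y))%:E))//;
    apply/funext => y; rewrite kernel_productE.
- apply: le_lt_trans Poo; apply: le_trans (abs_conv_le x uh); rewrite -I1.
  rewrite le_eqVlt; apply/orP; left; apply/eqP.
  by apply: eq_integral => y _; rewrite kernel_productE.
- by rewrite (_ : (fun y => _) = (fun y => (K (tsub x y) * complex.Im (f y))%:E))//;
    apply/funext => y; rewrite kernel_productE.
- apply: le_lt_trans Poo; apply: le_trans (abs_conv_le x vh); rewrite -I2.
  rewrite le_eqVlt; apply/orP; left; apply/eqP.
  by apply: eq_integral => y _; rewrite kernel_productE.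
Qed.

Context (p q l : R).
Context (p1 : 1 < p) (q1 : 1 <= q).
Context (fN : (lorentz_morrey_norm p q l f < +oo)%E).

Let Nf := fine (lorentz_morrey_norm p q l f).

Let NfE : lorentz_morrey_norm p q l f = Nf%:E.
Proof. by rewrite /Nf fineK// ge0_fin_numE// lorentz_morrey_norm_ge0. Qed.

Let Nf0 : 0 <= Nf.
Proof. by rewrite fine_ge0// lorentz_morrey_norm_ge0. Qed.

Let q0 : 0 < q. Proof. exact: lt_le_trans q1. Qed.

Let translate_bound (z : Rn R n) (rho : R) (y : T) : 0 < rho ->
  (\int[leb]_(t in `]0%R, +oo[) (((t `^ p^-1)%:E *
     rearr (fun m => lam [set x : T | ballRn z rho x /\ (m < h (tsub x y))%R]) t) `^ q *
     (t^-1)%:E) <= ((rho `^ (l / p) * Nf) `^ q)%:E)%E.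
Proof.
move=> rho0; rewrite -poweR_EFin EFinM -NfE.
have := @lorentz_norm_ball_le R n p q l f (tsub z y) rho rho0.
move=> /(le_poweR (ltW q0) (poweR_ge0 _ _)); apply: le_trans.
rewrite lorentz_norm_powR// le_eqVlt; apply/orP; left; apply/eqP.
apply: eq_integral => t _; rewrite (rearrangement_cutoff _ _ _ mf fP).
congr ((_ * rearr _ t) `^ q * _)%E; apply/funext => m.
rewrite -(borel_lebesgue_tsub y (A := [set x | ballRn (tsub z y : Rn R n) rho x /\ m < h x])).
  by congr (lam _); apply/seteqP; split => x /=; rewrite (ballRn_tsub x y z rho).
by apply: measurableI; [exact: measurable_ballRn|exact: measurable_ltr_set].
Qed.

Let mk2 : measurable_fun setT (fun y => 2 * k y). Proof. exact: measurable_funM. Qed.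
Let k20 y : 0 <= 2 * k y. Proof. by rewrite mulr_ge0. Qed.
Let kappa20 : 0 < 2 * kappa. Proof. by rewrite mulr_gt0. Qed.
Let intk2 : (\int[lam]_y (2 * k y)%:E <= (2 * kappa)%:E)%E.
Proof.
under eq_integral do rewrite EFinM.
rewrite ge0_integralZl//; last by move=> y _; rewrite lee_fin.
  by rewrite EFinM lee_wpmul2l.
exact/measurable_EFinP.
Qed.

(** On each ball the majorant is finite off a null set, and countably many balls about a fixed
    centre exhaust the space. *)
Lemma ae_cintegrable_kernel_product :
  {ae lamC, forall x, cintegrable (kernel_product x)}.
Proof.
have z : Rn R n := mkRn (fun=> 0).
pose E i := [set x : T | ballRn z i.+1%:R x /\
  convolution_majorant h (fun y => 2 * k y) x = +oo%E].
have E0 i : lamC.-negligible (E i).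
  have rho0 : 0 < i.+1%:R :> R by [].
  have := @convolution_majorant_lty R n h (fun y => 2 * k y) (ballRn z i.+1%:R)
    p q (2 * kappa) ((i.+1%:R `^ (l / p) * Nf) `^ q) mh (cabs_ge0 u v) mk2 k20
    (measurable_ballRn z _) p1 q1 kappa20 (powR_ge0 _ _) intk2
    (fun y => translate_bound z y rho0).
  move=> lE.
  have mE : measurable (E i).
    apply: measurableI; first exact: measurable_ballRn.
    rewrite -[X in measurable X]setTI.
    exact: (measurable_convolution_majorant mh (cabs_ge0 u v) mk2 k20
      measurableT (emeasurable_set1 +oo%E)).
  exists (E i); split => //; first exact: (measurable_completion lam).
  by rewrite [LHS](completionE lam mE).
apply: (negligibleS _ (negligible_bigcup E0)) => x /= nx.
have [i ix] : exists i : nat, ballRn z i.+1%:R x.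
  exists (Num.truncn (normRn (subRn x z))) => /=.
  exact: truncnS_gt.
exists i => //; split => //; apply: contrapT => xoo; apply: nx.
exact: cintegrable_kernel_product.
Qed.

Lemma lorentz_morrey_norm_kernel_product :
  (lorentz_morrey_norm p q l (fun x => cintegral (kernel_product x)) <=
   ((1 - p^-1)^-1 * (2 * kappa))%:E * lorentz_morrey_norm p q l f)%E.
Proof.
set C := (1 - p^-1)^-1 * (2 * kappa).
have pV : 0 <= (1 - p^-1)^-1.
  by rewrite invr_ge0 subr_ge0 invf_le1 ?ltW// (lt_trans _ p1).
have C0 : 0 <= C by rewrite mulr_ge0// ltW.
apply: ge_ereal_sup => _ [[z rho] /= rho0 <-].
have rp : 0 < rho `^ (l / p) by exact: powR_gt0.
have X0 : 0 <= C * (rho `^ (l / p) * Nf) by rewrite !mulr_ge0// ltW.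
rewrite powRN lee_pdivrMl// NfE -!EFinM.
rewrite /lorentz_norm.
(* The convolution estimate compares q-th powers; once the right-hand side is a q-th root,
   monotonicity of the root reduces the goal to it. *)
rewrite -[leRHS](_ : (((C * (rho `^ (l / p) * Nf)) `^ q)%:E `^ q^-1)%E = _); last first.
  rewrite poweR_EFin -powRrM mulfV ?gt_eqF// powRr1//.
  by congr (_%:E); ring.
apply: le_poweR; first by rewrite invr_ge0 ltW.
  apply: integral_ge0 => t /=; rewrite in_itv/= andbT => t0.
  by rewrite mule_ge0 ?poweR_ge0// lee_fin invr_ge0 ltW.
rewrite powRM//; last by rewrite mulr_ge0// ltW.
have := @convolution_lorentz R n h (fun y => 2 * k y) (ballRn z rho)
    p q (2 * kappa) ((rho `^ (l / p) * Nf) `^ q) mh (cabs_ge0 u v) mk2 k20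
    (measurable_ballRn z _) p1 q1 kappa20 (powR_ge0 _ _) intk2
    (fun y => translate_bound z y rho0)
    (cabs (conv u) (conv v)) (measurable_cabs (measurable_conv mu) (measurable_conv mv))
    (fun x _ => cabs_kernel_product_le x).
apply: le_trans; rewrite le_eqVlt; apply/orP; left; apply/eqP.
apply: eq_integral => t _.
by rewrite (rearrangement_cutoff _ _ _ cmeasurable_kernel_product
  borel_representative_kernel_product).
Qed.

End complex_convolution.

Theorem theorem4p1 (R : realType) (n : nat) (delta p q lambda : R)
    (hn : (1 <= n)%N) (hdelta : (n%:R - 1) / 2 < delta)
    (hp : 1 < p) (hq : 1 <= q) (hlambda : 0 <= lambda <= n%:R)
    (r : R) (hr : 0 < r) :
  exists2 C : R, 0 < C &
    forall f : Rn R n -> R[i], lorentz_morrey p q lambda f ->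
      [/\ {ae @lebesgue_Rn R n, forall x, cintegrable (BR_integrand delta r f x)},
          lorentz_morrey p q lambda (Bochner_Riesz delta r f) &
          (lorentz_morrey_norm p q lambda (Bochner_Riesz delta r f) <=
             C%:E * lorentz_morrey_norm p q lambda f)%E].
Proof.
(* The dimension becomes [n.+1], so that one coordinate can be split off, and the condition on
   [delta] turns into [n / 2 < delta]. *)
case: n hn hdelta hlambda => // n _ hdelta _.
have nd : n%:R / 2 < delta by move: hdelta; rewrite -natr1 addrK.
have d0 : 0 < delta by apply: le_lt_trans nd; rewrite divr_ge0.
have [k [kappa [mk k0 kappa0 intk Kk]]] := tsymbol_transform_majorant d0 nd hr.
pose K (x : n.+1.-tuple (measurableTypeR R)) := r ^- n.+1 * tsymbol_transform delta (tscale r^-1 x).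
have mK : measurable_fun setT K.
  apply: measurable_funM => //.
  apply: (measurableT_comp (@measurable_tsymbol_transform R _ delta)).
  exact: measurable_tscale.
have C0 : 0 < (1 - p^-1)^-1 * (2 * kappa).
  by rewrite !mulr_gt0// invr_gt0 subr_gt0 invf_lt1// (lt_trans _ hp).
exists ((1 - p^-1)^-1 * (2 * kappa)); first exact: C0.
move=> f [mf fN].
have [u [v [N fP]]] := exists_borel_representative mf.
have BRE : BR_integrand delta r f = kernel_product K f.
  by apply/funext => x; apply/funext => y; rewrite /BR_integrand BR_kernel_dilatedE.
have TE : Bochner_Riesz delta r f = fun x => cintegral (kernel_product K f x).
  by apply/funext => x; rewrite /Bochner_Riesz BRE.
have le := lorentz_morrey_norm_kernel_product mK mk k0 Kk kappa0 intk mf fP hp hq fN.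
rewrite TE BRE; split; last exact: le.
- exact: (ae_cintegrable_kernel_product mK mk k0 Kk kappa0 intk mf fP hp hq fN).
- split; first exact: (cmeasurable_kernel_product mK mf fP).
  apply: le_lt_trans le _; by rewrite lte_mul_pinfty// lee_fin ltW.
Qed.
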